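(* Let $G_1, G_2\in\mathcal{G}$, where $G_i(a)=\frac12(\overline{\sigma}_{G_i}^2a^+-\underline{\sigma}_{G_i}^2a^-)$ with $0<\underline{\sigma}_{G_i}\le\overline{\sigma}_{G_i}<\infty$ for $i=1,2$. Then the convolution $N_{G_1}*N_{G_2}$ is a $G$-normal distribution (that is, there exists $G\in\mathcal{G}^0$ such that $N_{G_1}*N_{G_2}[\varphi]=N_G[\varphi]$ for all $\varphi\in C_{b,Lip}(\mathbb{R})$) if and only if $$\beta_{G_1}:=\frac{\overline{\sigma}_{G_1}}{\underline{\sigma}_{G_1}}=\frac{\overline{\sigma}_{G_2}}{\underline{\sigma}_{G_2}}=:\beta_{G_2}.$$
   Context: $C_{b,Lip}(\mathbb{R})$ is the set of bounded Lipschitz functions $\varphi:\mathbb{R}\to\mathbb{R}$. For $a\in\mathbb{R}$ write $a^+=\max(a,0)$, $a^-=\max(-a,0)$. $\mathcal{G}^0$ is the collection of functions $G:\mathbb{R}\to\mathbb{R}$ of the form $G(a)=\frac12(\overline{\sigma}^2a^+-\underline{\sigma}^2a^-)$ with constants $0\le\underline{\sigma}\le\overline{\sigma}<\infty$. $\mathcal{G}\subset\mathcal{G}^0$ is the subset of those $G$ with $\underline{\sigma}>0$. For $G\in\mathcal{G}^0$ and $\varphi\in C_{b,Lip}(\mathbb{R})$, let $u^\varphi$ be the (unique bounded continuous) viscosity solution on $[0,\infty)\times\mathbb{R}$ of the $G$-heat equation $\partial_t u-G(\partial_x^2u)=0$ on $(0,\infty)\times\mathbb{R}$ with $u(0,x)=\varphi(x)$.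 The (one-dimensional) $G$-normal distribution $N_G$ is the functional on $C_{b,Lip}(\mathbb{R})$ defined by $N_G[\varphi]=u^\varphi(1,0)$. For $G_1,G_2\in\mathcal{G}^0$, the convolution $N_{G_1}*N_{G_2}$ is the functional on $C_{b,Lip}(\mathbb{R})$ defined by $N_{G_1}*N_{G_2}[\varphi]:=N_{G_1}[\phi]$, where $\phi(x):=N_{G_2}[\varphi(x+\cdot)]$. *)

(* Defs.v *)
From Stdlib Require Import Reals ClassicalEpsilon.
From Coquelicot Require Import Coquelicot.
Open Scope R_scope.

Definition bounded_lipschitz (phi : R -> R) : Prop :=
  (exists M, forall x, Rabs (phi x) <= M) /\
  (exists L, forall x y, Rabs (phi x - phi y) <= L * Rabs (x - y)).

Definition pos_part (a : R) : R := Rmax a 0.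
Definition neg_part (a : R) : R := Rmax (- a) 0.

Definition G_fun (sl su : R) (a : R) : R :=
  / 2 * (su ^ 2 * pos_part a - sl ^ 2 * neg_part a).

Definition in_calG0 (G : R -> R) : Prop :=
  exists sl su, 0 <= sl <= su /\ forall a, G a = G_fun sl su a.

(* Functions of time and space are curried, [u t x]; only their values at
   [0 <= t] matter. *)
Definition dt (u : R -> R -> R) (t x : R) : R := Derive (fun s => u s x) t.
Definition dx (u : R -> R -> R) (t x : R) : R := Derive (u t) x.
Definition dxx (u : R -> R -> R) (t x : R) : R := Derive_n (u t) 2 x.

Definition continuous2 (u : R -> R -> R) (t x : R) : Prop :=
  continuous (fun p : R * R => u (fst p) (snd p)) (t, x).

(* The class C^{1,2}((0, +oo) x R). [ex_derive (psi t) x] is not redundant: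
   [ex_derive_n f 2 x] only says that the total function [Derive f] is
   differentiable at [x]. *)
Definition C12 (psi : R -> R -> R) : Prop :=
  forall t x, 0 < t ->
    ex_derive (fun s => psi s x) t /\
    ex_derive (psi t) x /\
    ex_derive_n (psi t) 2 x /\
    continuous2 psi t x /\
    continuous2 (dt psi) t x /\
    continuous2 (dx psi) t x /\
    continuous2 (dxx psi) t x.

Definition local_max2 (f : R -> R -> R) (t x : R) : Prop :=
  locally (t, x) (fun p : R * R => f (fst p) (snd p) <= f t x).

Definition local_min2 (f : R -> R -> R) (t x : R) : Prop :=
  locally (t, x) (fun p : R * R => f t x <= f (fst p) (snd p)).

Definition viscosity_subsolution (G : R -> R) (u : R -> R -> R) : Prop :=
  forall psi t x, C12 psi -> 0 < t ->
    local_max2 (fun s y => u s y - psi s y) t x ->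
    dt psi t x - G (dxx psi t x) <= 0.

Definition viscosity_supersolution (G : R -> R) (u : R -> R -> R) : Prop :=
  forall psi t x, C12 psi -> 0 < t ->
    local_min2 (fun s y => u s y - psi s y) t x ->
    0 <= dt psi t x - G (dxx psi t x).

Definition continuous_halfplane (u : R -> R -> R) : Prop :=
  forall t x, 0 <= t ->
    filterlim (fun p : R * R => u (fst p) (snd p))
      (within (fun p : R * R => 0 <= fst p) (locally (t, x)))
      (locally (u t x)).

Definition bounded_halfplane (u : R -> R -> R) : Prop :=
  exists M, forall t x, 0 <= t -> Rabs (u t x) <= M.

(* Bounded continuous viscosity solution on [0, +oo) x R of
   u_t - G (u_xx) = 0 on (0, +oo) x R with u(0, .) = phi. *)
Definition G_heat_solution (G phi : R -> R) (u : R -> R -> R) : Prop :=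
  bounded_halfplane u /\
  continuous_halfplane u /\
  viscosity_subsolution G u /\
  viscosity_supersolution G u /\
  (forall x, u 0 x = phi x).

(* For G in G^0 and phi in C_{b,Lip} the solution exists and is unique on
   [0, +oo) x R, so the choice made by [epsilon] is irrelevant at [t >= 0]. *)
Definition G_heat (G phi : R -> R) : R -> R -> R :=
  epsilon (inhabits (fun _ _ => 0)) (G_heat_solution G phi).

Definition G_normal (G : R -> R) (phi : R -> R) : R := G_heat G phi 1 0.

Definition convolution (N1 N2 : (R -> R) -> R) (phi : R -> R) : R :=
  N1 (fun x => N2 (fun y => phi (x + y))).

Definition is_G_normal (N : (R -> R) -> R) : Prop :=
  exists G, in_calG0 G /\
    forall phi, bounded_lipschitz phi -> N phi = G_normal G phi.

(* Main.v *)
Require Import Defs.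
From Stdlib Require Import Reals Lra Lia Psatz FunctionalExtensionality ClassicalEpsilon Classical.
From Coquelicot Require Import Coquelicot.
Open Scope R_scope.

(** Solutions of the G-heat equation are constructed by Perron's method, as the infimum of all
    viscosity supersolutions; a supersolution dominates this infimum by definition.  To see
    that a subsolution is dominated by it, one first takes smooth data, so that the infimum
    is Lipschitz in (t, x).  A supersolution of u_t = (s^2/2) u_xx dominates the iterates of
    the symmetric averages (f(x + d) + f(x - d))/2, a property preserved by space-time
    averaging; since G(a) is the maximum of sl^2 a/2 and su^2 a/2, an averaged supersolution
    is a classical supersolution, for which comparison is elementary.  So neither the
    theorem on sums nor regularity theory is needed.

    Write U and W for the flows of G_1 and G_2.  If the ratios agree, U and W are time changes
    of one semigroup.  Conversely, if U(1)W(1) is a G-normal distribution, scaling gives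
    U(t)W(t) = S(t) for the semigroup S of some G.  Let phi be the periodic function with
    G_2(phi'') = - phi/2, so that W(t) phi = e^(-t/2) phi, and put g = U(t) phi.  Then
    S(t + s) = S(s)S(t) yields U(s)[W(s) g] = U(s)[e^(-s/2) g].  When the ratios differ, one of
    G_1, G_2 is a maximum of two multiples of the other, which orders W(s)U(t) and U(t)W(s),
    hence W(s) g and e^(-s/2) g; by strict monotonicity of U(s) these are equal, that is,
    G_2(g'') = - g/2.  Conservation of energy for this ordinary differential equation fixes
    the ratio of the extreme values of g to that of phi, whereas comparison of U with
    the two multiples of G_2 shows that U(t) changes this ratio. *)

(** The infimum runs over supersolutions because [G] is convex: by Jensen's inequality an average of
    supersolutions is again a supersolution, while subsolutions have no such property. So only the
    upper function of a comparison can be smoothed. A viscosity inequality lives at contact points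
    and cannot be averaged directly; domination of random walk steps is its integrated form, linear
    in the function, and does survive averaging.

    In the converse, flows of general data have no formula and the hypothesis concerns only
    [U(1)W(1)] at the point 0. On [phi] the flow [W] acts by a scalar, so [S(t) phi] is a multiple
    of [g] and the semigroup law of [S] becomes a statement about [g]. That statement is seen only
    through a further [U(s)], which has no evident inverse; an order between the two arguments is
    what allows it to be removed. Positive lower volatility matters here, since a degenerate flow
    need not spread a positive difference to every point. The flow [S] may be degenerate, and only
    its semigroup law and its scaling enter. *)

Lemma Rinv_nonneg x : 0 < x -> 0 <= / x.
Proof. intros H. left. now apply Rinv_0_lt_compat. Qed.

(** * Test functions and comparison with classical subsolutions *)

(** The derivatives are carried as explicit functions, so that sums, reflections and changes of
    variables of test functions come with formulas for their derivatives; [smooth_C12] and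
    [C12_smooth] identify the class with [C12]. *)
Definition smooth (psi ft fx fxx : R -> R -> R) : Prop :=
  forall t x, 0 < t ->
    is_derive (fun s => psi s x) t (ft t x) /\
    is_derive (psi t) x (fx t x) /\
    is_derive (fx t) x (fxx t x) /\
    continuity_2d_pt psi t x /\ continuity_2d_pt ft t x /\
    continuity_2d_pt fx t x /\ continuity_2d_pt fxx t x.

Lemma continuous2_2d f t x : continuous2 f t x <-> continuity_2d_pt f t x.
Proof. symmetry; apply continuity_2d_pt_filterlim. Qed.

Ltac rmin a b := pose proof (Rmin_l a b); pose proof (Rmin_r a b).

Ltac fun_ext2 t x := apply functional_extensionality; intros t;
  apply functional_extensionality; intros x.

Ltac split7 := refine (conj _ (conj _ (conj _ (conj _ (conj _ (conj _ _)))))).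

Lemma smooth_values psi ft fx fxx : smooth psi ft fx fxx ->
  forall t x, 0 < t ->
    dt psi t x = ft t x /\ dx psi t x = fx t x /\ dxx psi t x = fxx t x.
Proof.
  intros H t x Ht.
  destruct (H t x Ht) as (H1 & H2 & H3 & _).
  repeat split.
  - now apply is_derive_unique.
  - now apply is_derive_unique.
  - unfold dxx. simpl.
    rewrite (Derive_ext _ (fx t)).
    + now apply is_derive_unique.
    + intros y. apply is_derive_unique. now apply H.
Qed.

Lemma locally_2d_pos t x : 0 < t -> locally_2d (fun s _ => 0 < s) t x.
Proof.
  intros Ht. exists (mkposreal t Ht). intros u v Hu _. simpl in Hu.
  apply Rabs_def2 in Hu. lra.
Qed.

Lemma smooth_C12 psi ft fx fxx : smooth psi ft fx fxx -> C12 psi.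
Proof.
  intros H t x Ht.
  pose proof (smooth_values _ _ _ _ H) as V.
  destruct (H t x Ht) as (H1 & H2 & H3 & H4 & H5 & H6 & H7).
  assert (E : forall f g : R -> R -> R,
    (forall s y, 0 < s -> f s y = g s y) -> continuity_2d_pt g t x -> continuous2 f t x).
  { intros f g Hfg Hg. apply continuous2_2d.
    apply continuity_2d_pt_ext_loc with g; trivial.
    destruct (locally_2d_pos t x Ht) as [d Hd]. exists d.
    intros u v Hu Hv. symmetry. now apply Hfg, (Hd u v). }
  split7.
  - now exists (ft t x).
  - now exists (fx t x).
  - simpl. exists (fxx t x).
    apply is_derive_ext with (fx t); trivial.
    intros y. symmetry. now apply is_derive_unique, H.
  - now apply continuous2_2d.
  - apply E with ft; trivial. intros; now apply V.
  - apply E with fx; trivial. intros; now apply V.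
  - apply E with fxx; trivial. intros; now apply V.
Qed.

Lemma C12_smooth psi : C12 psi -> smooth psi (dt psi) (dx psi) (dxx psi).
Proof.
  intros H t x Ht.
  destruct (H t x Ht) as (H1 & H2 & H3 & H4 & H5 & H6 & H7).
  split7; try (now apply continuous2_2d).
  - now apply Derive_correct.
  - now apply Derive_correct.
  - unfold dx, dxx. simpl. apply Derive_correct. exact H3.
Qed.

Definition touches_below (psi v : R -> R -> R) (t x : R) : Prop :=
  locally_2d (fun s y => v t x - psi t x <= v s y - psi s y) t x.

Definition super (G : R -> R) (v : R -> R -> R) : Prop :=
  forall psi ft fx fxx t x, smooth psi ft fx fxx -> 0 < t ->
    touches_below psi v t x -> G (fxx t x) <= ft t x.

(** The dual operator: [u] is a subsolution for [G] exactly when [- u] is a supersolution for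
    [Gbar G] ([sub_iff]). Viscosity arguments can thus all be phrased for supersolutions. *)
Definition Gbar (G : R -> R) (a : R) : R := - G (- a).

Lemma super_iff G v : viscosity_supersolution G v <-> super G v.
Proof.
  split.
  - intros H psi ft fx fxx t x Hs Ht Hl.
    specialize (H psi t x (smooth_C12 _ _ _ _ Hs) Ht).
    destruct (smooth_values _ _ _ _ Hs t x Ht) as (E1 & _ & E2).
    rewrite E1, E2 in H. apply locally_2d_locally in Hl.
    specialize (H Hl). lra.
  - intros H psi t x Hs Ht Hl.
    assert (G (dxx psi t x) <= dt psi t x).
    { apply (H psi (dt psi) (dx psi) (dxx psi) t x (C12_smooth _ Hs) Ht).
      now apply locally_2d_locally. }
    lra.
Qed.

Lemma smooth_opp psi ft fx fxx : smooth psi ft fx fxx ->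
  smooth (fun t x => - psi t x) (fun t x => - ft t x) (fun t x => - fx t x)
    (fun t x => - fxx t x).
Proof.
  intros H t x Ht. destruct (H t x Ht) as (H1 & H2 & H3 & H4 & H5 & H6 & H7).
  split7; try (now apply continuity_2d_pt_opp).
  - now apply (is_derive_opp (fun s => psi s x)).
  - now apply (is_derive_opp (psi t)).
  - now apply (is_derive_opp (fx t)).
Qed.

Lemma smooth_plus f ft fx fxx g gt gx gxx :
  smooth f ft fx fxx -> smooth g gt gx gxx ->
  smooth (fun t x => f t x + g t x) (fun t x => ft t x + gt t x)
    (fun t x => fx t x + gx t x) (fun t x => fxx t x + gxx t x).
Proof.
  intros Hf Hg t x Ht.
  destruct (Hf t x Ht) as (H1 & H2 & H3 & H4 & H5 & H6 & H7).
  destruct (Hg t x Ht) as (K1 & K2 & K3 & K4 & K5 & K6 & K7).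
  split7; try (now apply continuity_2d_pt_plus).
  - now apply (is_derive_plus (fun s => f s x) (fun s => g s x)).
  - now apply (is_derive_plus (f t) (g t)).
  - now apply (is_derive_plus (fx t) (gx t)).
Qed.

Lemma smooth_scal c f ft fx fxx : smooth f ft fx fxx ->
  smooth (fun t x => c * f t x) (fun t x => c * ft t x)
    (fun t x => c * fx t x) (fun t x => c * fxx t x).
Proof.
  intros Hf t x Ht.
  destruct (Hf t x Ht) as (H1 & H2 & H3 & H4 & H5 & H6 & H7).
  assert (C : forall g, continuity_2d_pt g t x ->
    continuity_2d_pt (fun t x => c * g t x) t x).
  { intros g Hg. apply continuity_2d_pt_mult; trivial. apply continuity_2d_pt_const. }
  split7; try (now apply C).
  - now apply (is_derive_scal (fun s => f s x)).
  - now apply (is_derive_scal (f t)).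
  - now apply (is_derive_scal (fx t)).
Qed.

Lemma sub_iff G u :
  viscosity_subsolution G u <-> super (Gbar G) (fun t x => - u t x).
Proof.
  split.
  - intros H psi ft fx fxx t x Hs Ht Hl. unfold Gbar.
    pose proof (smooth_opp _ _ _ _ Hs) as Ho.
    specialize (H _ t x (smooth_C12 _ _ _ _ Ho) Ht).
    destruct (smooth_values _ _ _ _ Ho t x Ht) as (E1 & _ & E2).
    rewrite E1, E2 in H.
    enough (- ft t x - G (- fxx t x) <= 0) by lra.
    apply H. apply (locally_2d_locally (fun s y => u s y - - psi s y <= u t x - - psi t x)).
    destruct Hl as [d Hd]. exists d. intros s y Hu Hv.
    specialize (Hd s y Hu Hv). simpl in Hd. lra.
  - intros H psi t x Hs Ht Hl.
    pose proof (smooth_opp _ _ _ _ (C12_smooth _ Hs)) as Ho.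
    assert (Gbar G (- dxx psi t x) <= - dt psi t x).
    { apply (H _ _ _ _ t x Ho Ht).
      apply (locally_2d_locally (fun s y => u s y - psi s y <= u t x - psi t x)) in Hl.
      destruct Hl as [d Hd]. exists d. intros s y Hu Hv.
      specialize (Hd s y Hu Hv). simpl in Hd. lra. }
    unfold Gbar in H0. rewrite Ropp_involutive in H0. lra.
Qed.

(** Degenerate ellipticity with a Lipschitz bound. Both pass to [Gbar G], so one comparison lemma
    serves both kinds of solutions. *)
Definition elliptic (K : R) (G : R -> R) : Prop :=
  0 <= K /\ forall a c, 0 <= c -> G a <= G (a + c) <= G a + K * c.

Lemma elliptic_mono K G a b : elliptic K G -> a <= b -> G a <= G b.
Proof.
  intros [_ H] Hab. destruct (H a (b - a)) as [H1 _]; [lra|].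
  now replace (a + (b - a)) with b in H1 by ring.
Qed.

Lemma elliptic_lip K G a b : elliptic K G -> Rabs (G a - G b) <= K * Rabs (a - b).
Proof.
  intros [_ H]. destruct (Rle_dec b a).
  - destruct (H b (a - b)) as [H1 H2]; [lra|].
    replace (b + (a - b)) with a in * by ring.
    rewrite !Rabs_pos_eq; lra.
  - destruct (H a (b - a)) as [H1 H2]; [lra|].
    replace (a + (b - a)) with b in * by ring.
    rewrite !Rabs_left1; lra.
Qed.

Lemma elliptic_Gbar K G : elliptic K G -> elliptic K (Gbar G).
Proof.
  intros [H0 H]. split; trivial. intros a c Hc. unfold Gbar.
  destruct (H (- (a + c)) c Hc) as [H1 H2].
  replace (- (a + c) + c) with (- a) in * by ring. lra.
Qed.

Lemma elliptic_continuous_2d K G f t x : elliptic K G -> continuity_2d_pt f t x ->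
  continuity_2d_pt (fun s y => G (f s y)) t x.
Proof.
  intros HG Hf. apply (continuity_1d_2d_pt_comp G f); trivial.
  intros eps Heps. exists (eps / (K + 1)). destruct HG as [HK HG].
  split. { apply Rdiv_lt_0_compat; lra. }
  intros y [_ Hy]. simpl in *. unfold R_dist in *.
  eapply Rle_lt_trans. { apply elliptic_lip with (K := K); now split. }
  apply Rle_lt_trans with ((K + 1) * Rabs (y - f t x)).
  { apply Rmult_le_compat_r; [apply Rabs_pos|lra]. }
  apply Rmult_lt_compat_l with (r := K + 1) in Hy; [|lra].
  replace ((K + 1) * (eps / (K + 1))) with eps in Hy; trivial. field. lra.
Qed.

(** * Lower semicontinuity and minima on rectangles *)

Definition lsc (u : R -> R -> R) : Prop :=
  forall t x e, 0 <= t -> 0 < e -> exists d, 0 < d /\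
    forall s y, 0 <= s -> Rabs (s - t) < d -> Rabs (y - x) < d -> u t x - e < u s y.

Lemma lsc_plus u v : lsc u -> lsc v -> lsc (fun t x => u t x + v t x).
Proof.
  intros Hu Hv t x e Ht He.
  destruct (Hu t x (e / 2) Ht) as (d1 & D1 & H1); [lra|].
  destruct (Hv t x (e / 2) Ht) as (d2 & D2 & H2); [lra|].
  exists (Rmin d1 d2). split. { now apply Rmin_pos. }
  intros s y Hs H3 H4.
  rmin d1 d2.
  specialize (H1 s y Hs). specialize (H2 s y Hs). lra.
Qed.

Lemma lsc_continuity_2d u :
  (forall t x, 0 <= t -> continuity_2d_pt u t x) -> lsc u.
Proof.
  intros H t x e Ht He. destruct (H t x Ht (mkposreal e He)) as [d Hd].
  exists d. split. { apply cond_pos. }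
  intros s y _ H1 H2. specialize (Hd s y H1 H2). simpl in Hd.
  apply Rabs_def2 in Hd. lra.
Qed.

Lemma box_lower_bound (f : R -> R -> R) a b c d :
  (forall t x, a <= t <= b -> c <= x <= d -> exists r m, 0 < r /\
     forall s y, a <= s <= b -> c <= y <= d ->
       Rabs (s - t) < r -> Rabs (y - x) < r -> m <= f s y) ->
  exists m, forall t x, a <= t <= b -> c <= x <= d -> m <= f t x.
Proof.
  intros H.
  assert (H' : forall p : R * R, exists q : posreal * R,
    a <= fst p <= b -> c <= snd p <= d ->
    forall s y, a <= s <= b -> c <= y <= d ->
      Rabs (s - fst p) < fst q -> Rabs (y - snd p) < fst q -> snd q <= f s y).
  { intros [t x]. simpl.
    destruct (classic (a <= t <= b /\ c <= x <= d)) as [[H1 H2]|H1].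
    - destruct (H t x H1 H2) as (r & m & Hr & Hm).
      exists (mkposreal r Hr, m). intros _ _. exact Hm.
    - exists (mkposreal 1 Rlt_0_1, 0). tauto. }
  pose (q := fun p => proj1_sig (constructive_indefinite_description _ (H' p))).
  assert (Hq : forall p, a <= fst p <= b -> c <= snd p <= d ->
    forall s y, a <= s <= b -> c <= y <= d ->
      Rabs (s - fst p) < fst (q p) -> Rabs (y - snd p) < fst (q p) -> snd (q p) <= f s y).
  { intros p. exact (proj2_sig (constructive_indefinite_description _ (H' p))). }
  (* The gauge records the local bound [m] as [/ (1 + Rabs m)] next to the radius. A positive [e]
     below the gauge at suitable centres then forces [1 + Rabs m <= / e], which makes the local
     bounds uniform. *)
  assert (P : forall p, 0 < Rmin (fst (q p)) (/ (1 + Rabs (snd (q p))))).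
  { intros p. apply Rmin_pos. apply cond_pos. apply Rinv_0_lt_compat.
    pose proof (Rabs_pos (snd (q p))). lra. }
  destruct (compactness_value_2d a b c d (fun t x => mkposreal _ (P (t, x)))) as [e He].
  exists (- / e). intros t x Ht Hx. specialize (He t x Ht Hx).
  apply Rnot_lt_le. intros Hlt. apply He. intros (u & v & Hu & Hv & H1 & H2 & H3).
  simpl in H1, H2, H3.
  pose proof (Rmin_l (fst (q (u, v))) (/ (1 + Rabs (snd (q (u, v)))))) as M1.
  pose proof (Rmin_r (fst (q (u, v))) (/ (1 + Rabs (snd (q (u, v)))))) as M2.
  pose proof (Hq (u, v) Hu Hv t x Ht Hx) as M3. simpl in M3.
  set (m := snd (q (u, v))) in *.
  assert (m <= f t x) by (apply M3; lra).
  pose proof (cond_pos e) as E.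
  assert (e <= / (1 + Rabs m)) by lra.
  apply Rinv_le_contravar in H4; trivial.
  rewrite Rinv_inv in H4.
  pose proof (Rle_abs (- m)). rewrite Rabs_Ropp in H5. lra.
Qed.

(** If the infimum [- i] were not attained, [/ (f + i)] would be locally bounded by semicontinuity,
    hence bounded on the rectangle, and [f] would stay away from its infimum. *)
Lemma box_minimum (f : R -> R -> R) a b c d : a <= b -> c <= d ->
  (forall t x e, a <= t <= b -> c <= x <= d -> 0 < e -> exists r, 0 < r /\
     forall s y, a <= s <= b -> c <= y <= d ->
       Rabs (s - t) < r -> Rabs (y - x) < r -> f t x - e < f s y) ->
  exists t x, a <= t <= b /\ c <= x <= d /\
    forall s y, a <= s <= b -> c <= y <= d -> f t x <= f s y.
Proof.
  intros Hab Hcd H.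
  destruct (box_lower_bound f a b c d) as [m Hm].
  { intros t x Ht Hx. destruct (H t x 1 Ht Hx Rlt_0_1) as (r & Hr & Hr').
    exists r, (f t x - 1). split; trivial.
    intros s y Hs Hy H1 H2. apply Rlt_le. now apply Hr'. }
  destruct (completeness (fun z => exists s y, a <= s <= b /\ c <= y <= d /\ z = - f s y))
    as [i [I1 I2]].
  { exists (- m). intros z (s & y & Hs & Hy & ->). specialize (Hm s y Hs Hy). lra. }
  { exists (- f a c), a, c. repeat split; lra. }
  apply NNPP. intros Hn.
  assert (Hs : forall t x, a <= t <= b -> c <= x <= d -> - i < f t x).
  { intros t x Ht Hx.
    destruct (Req_dec (f t x) (- i)) as [E|E].
    - exfalso. apply Hn. exists t, x. repeat split; try lra.
      intros s y Hs Hy. enough (- f s y <= i) by lra. apply I1. now exists s, y.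
    - enough (- f t x <= i) by lra. apply I1. now exists t, x. }
  destruct (box_lower_bound (fun s y => - / (f s y + i)) a b c d) as [k Hk].
  { intros t x Ht Hx. pose proof (Hs t x Ht Hx) as H0.
    destruct (H t x ((f t x + i) / 2) Ht Hx) as (r & Hr & Hr'); [lra|].
    exists r, (- / ((f t x + i) / 2)). split; trivial.
    intros s y H1 H2 H3 H4. specialize (Hr' s y H1 H2 H3 H4).
    apply Ropp_le_contravar. apply Rinv_le_contravar; lra. }
  assert (B : forall s y, a <= s <= b -> c <= y <= d -> - f s y <= i - / (1 + Rabs k)).
  { intros s y H1 H2. specialize (Hk s y H1 H2). specialize (Hs s y H1 H2).
    enough (/ (1 + Rabs k) <= f s y + i) by lra.
    rewrite <- (Rinv_inv (f s y + i)).
    apply Rinv_le_contravar. { apply Rinv_0_lt_compat. lra. }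
    pose proof (Rle_abs (- k)). rewrite Rabs_Ropp in H0. lra. }
  assert (i <= i - / (1 + Rabs k)).
  { apply I2. intros z (s & y & H1 & H2 & ->). now apply B. }
  assert (0 < / (1 + Rabs k)).
  { apply Rinv_0_lt_compat. pose proof (Rabs_pos k). lra. }
  lra.
Qed.

Ltac cont2 := repeat first
  [ apply continuity_2d_pt_plus | apply continuity_2d_pt_minus
  | apply continuity_2d_pt_mult | apply continuity_2d_pt_opp
  | apply continuity_2d_pt_const | apply continuity_2d_pt_id1
  | apply continuity_2d_pt_id2 ].

Lemma continuity_2d_snd f t x : continuity_pt f x -> continuity_2d_pt (fun _ x => f x) t x.
Proof.
  intros Hf. apply (continuity_1d_2d_pt_comp f (fun _ x => x)); trivial.
  apply continuity_2d_pt_id2.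
Qed.

Lemma smooth_parabola k t0 x0 a b c :
  smooth (fun t x => k + a * (t - t0) + b * (x - x0) * (x - x0) + c * (t - t0) * (t - t0))
    (fun t x => a + 2 * c * (t - t0)) (fun t x => 2 * b * (x - x0)) (fun t x => 2 * b).
Proof.
  intros t x Ht. split7; try (unfold Rminus; cont2).
  - auto_derive; trivial. ring.
  - auto_derive; trivial. ring.
  - auto_derive; trivial. ring.
Qed.

(** As [b] is smooth, [b] lowered by the penalty [e * (x * x + k * t)] is itself a test function for
    [v]. The penalty grows in both variables, so it confines the minimum to a rectangle without
    fixing a time horizon. *)
Lemma super_ge_smooth G K v b bt bx bxx C : elliptic K G ->
  lsc v -> super G v -> smooth b bt bx bxx -> lsc (fun t x => - b t x) ->
  (forall t x, 0 < t -> bt t x <= G (bxx t x)) ->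
  (forall x, b 0 x <= v 0 x) ->
  (forall t x, 0 <= t -> b t x <= v t x + C) ->
  forall t x, 0 <= t -> b t x <= v t x.
Proof.
  intros HG Lv Sv Sb Lb Hb H0 HC t1 x1 Ht1.
  apply Rnot_lt_le. intros Hlt.
  pose proof (proj1 HG) as HK.
  set (D := b t1 x1 - v t1 x1). set (k := 2 * K + 1).
  set (N := x1 * x1 + k * t1 + 1).
  assert (HN : 0 < N). { unfold N, k. nra. }
  set (e := D / (2 * N)).
  assert (He : 0 < e). { apply Rdiv_lt_0_compat; unfold D; lra. }
  assert (HeN : e * N = D / 2). { unfold e. field. lra. }
  set (F := fun t x => v t x + - b t x + e * (x * x + k * t)).
  assert (F1 : F t1 x1 < 0).
  { unfold F. unfold N in HeN. unfold D in *. nra. }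
  (* Outside the rectangle of size [X] the penalty exceeds the bound [C] on [b - v], so [F] is
     positive there. *)
  set (X := (Rabs C + 1) / e + 1).
  assert (HX0 : 0 < (Rabs C + 1) / e).
  { apply Rdiv_lt_0_compat; trivial. pose proof (Rabs_pos C). lra. }
  assert (HX : e * X > Rabs C + 1).
  { unfold X. replace (e * ((Rabs C + 1) / e + 1)) with (Rabs C + 1 + e) by (field; lra). lra. }
  assert (X1 : 1 <= X) by (unfold X; lra).
  assert (Fout : forall t x, 0 <= t -> F t x <= 0 -> t <= X /\ - X <= x <= X).
  { intros t x Ht HF. unfold F in HF. specialize (HC t x Ht).
    pose proof (Rle_abs C).
    assert (P : e * (x * x + k * t) <= Rabs C) by lra.
    assert (x * x + k * t <= X).
    { apply Rnot_lt_le. intros HH. apply Rmult_lt_compat_l with (r := e) in HH; lra. }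
    assert (0 <= k * t - t) by (unfold k; nra).
    split; [nra|]. split; nra. }
  assert (LF : lsc F).
  { apply (lsc_plus (fun t x => v t x + - b t x)).
    - now apply lsc_plus.
    - apply lsc_continuity_2d. intros; cont2. }
  destruct (box_minimum F 0 X (- X) X) as (t0 & x0 & Bt & Bx & Hmin); try lra.
  { intros t x r Ht Hx Hr. destruct (LF t x r) as (d & Hd & Hd'); try lra.
    exists d. split; trivial. intros s y Hs Hy. apply Hd'. lra. }
  destruct (Fout t1 x1 Ht1) as [Q1 Q2]; [lra|].
  assert (M1 : F t0 x0 < 0). { apply Rle_lt_trans with (F t1 x1); trivial. apply Hmin; lra. }
  assert (T0 : 0 < t0).
  { destruct (Rle_lt_dec t0 0); trivial. replace t0 with 0 in M1 by lra.
    unfold F in M1. specialize (H0 x0). assert (0 <= e * (x0 * x0 + k * 0)).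
    { apply Rmult_le_pos; nra. } lra. }
  assert (Hall : forall s y, 0 <= s -> F t0 x0 <= F s y).
  { intros s y Hs. destruct (Rle_dec (F s y) 0) as [c|c]; [|lra].
    destruct (Fout s y Hs c). apply Hmin; lra. }
  pose proof (smooth_plus _ _ _ _ _ _ _ _ Sb (smooth_parabola 0 0 0 (- (e * k)) (- e) 0)) as Sp.
  pose proof (Sv _ _ _ _ t0 x0 Sp T0) as Hv. simpl in Hv.
  assert (Hv' : G (bxx t0 x0 + 2 * - e) <= bt t0 x0 + (- (e * k) + 2 * 0 * (t0 - 0))).
  { apply Hv. destruct (locally_2d_pos t0 x0 T0) as [d Hd]. exists d.
    intros s y Hs Hy. specialize (Hd s y Hs Hy).
    specialize (Hall s y (Rlt_le _ _ Hd)). unfold F in Hall. lra. }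
  specialize (Hb t0 x0 T0).
  destruct HG as [_ HG]. destruct (HG (bxx t0 x0 + 2 * - e) (2 * e)) as [_ HG2]; [lra|].
  replace (bxx t0 x0 + 2 * - e + 2 * e) with (bxx t0 x0) in HG2 by ring.
  unfold k in Hv'. nra.
Qed.

(* Coquelicot's derivative lemmas leave equations over the carrier of [R_AbsRing]. *)
Ltac real_eq := match goal with |- @eq _ ?x ?y => change (@eq R x y) end.
Ltac req := real_eq; ring.

Lemma is_derive_eps (f : R -> R) (x l : R) : is_derive f x l <->
  forall e, 0 < e -> exists d, 0 < d /\
    forall y, Rabs (y - x) < d -> Rabs (f y - f x - l * (y - x)) <= e * Rabs (y - x).
Proof.
  split.
  - intros [_ H] e He.
    destruct (H x (fun P HP => HP) (mkposreal e He)) as [d Hd].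
    exists d. split. { apply cond_pos. }
    intros y Hy. specialize (Hd y Hy). simpl in Hd.
    unfold norm, minus, scal, plus, opp in Hd; simpl in Hd.
    unfold abs, mult in Hd; simpl in Hd.
    replace (f y - f x - l * (y - x)) with (f y + - f x + - ((y + - x) * l)) by ring.
    exact Hd.
  - intros H. split. { apply is_linear_scal_l. }
    intros z Hz. apply (is_filter_lim_locally_unique (K := R_AbsRing) (V := R_NormedModule) x z) in Hz. subst z.
    intros eps. destruct (H eps (cond_pos eps)) as (d & Hd & Hd').
    exists (mkposreal d Hd). intros y Hy. specialize (Hd' y Hy).
    unfold norm, minus, scal, plus, opp; simpl. unfold abs, mult; simpl.
    replace (f y + - f x + - ((y + - x) * l)) with (f y - f x - l * (y - x)) by ring.
    exact Hd'.
Qed.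

Lemma derive_past_min (f : R -> R) (x l d : R) : 0 < d -> is_derive f x l ->
  (forall y, x - d < y <= x -> f x <= f y) -> l <= 0.
Proof.
  intros Hd Hf Hm. apply Rnot_lt_le. intros Hl.
  destruct (proj1 (is_derive_eps f x l) Hf (l / 2)) as (r & Hr & Hr'); [lra|].
  set (h := Rmin d r / 2).
  assert (0 < Rmin d r) by now apply Rmin_pos.
  rmin d r.
  specialize (Hm (x - h)). specialize (Hr' (x - h)).
  replace (x - h - x) with (- h) in Hr' by ring.
  rewrite Rabs_Ropp, (Rabs_pos_eq h) in Hr' by (unfold h; lra).
  assert (H2 : h < r) by (unfold h; lra). specialize (Hr' H2).
  assert (H3 : f x <= f (x - h)) by (apply Hm; unfold h; lra).
  apply Rabs_le_between in Hr'. assert (0 < h) by (unfold h; lra). nra.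
Qed.

Lemma derive_local_min (f : R -> R) (x l d : R) : 0 < d -> is_derive f x l ->
  (forall y, Rabs (y - x) < d -> f x <= f y) -> l = 0.
Proof.
  intros Hd Hf Hm. apply Rle_antisym.
  - apply derive_past_min with f x d; trivial.
    intros y Hy. apply Hm. apply Rabs_def1; lra.
  - assert (E : 2 * x - x = x) by ring. enough (- l <= 0) by lra.
    apply derive_past_min with (fun y => f (2 * x - y)) x d; trivial.
    + replace (- l) with (scal (-1) l) by (unfold scal; simpl; unfold mult; simpl; ring).
      apply (is_derive_comp f (fun y => 2 * x - y)).
      * rewrite E. exact Hf.
      * auto_derive; [exact I|req].
    + intros y Hy. rewrite E. apply Hm. apply Rabs_def1; lra.
Qed.

Lemma derive2_local_min (f f1 : R -> R) (x l d : R) : 0 < d ->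
  (forall y, is_derive f y (f1 y)) -> is_derive f1 x l ->
  (forall y, Rabs (y - x) < d -> f x <= f y) -> 0 <= l.
Proof.
  intros Hd Hf Hf1 Hm. apply Rnot_lt_le. intros Hl.
  pose proof (derive_local_min f x (f1 x) d Hd (Hf x) Hm) as H0.
  destruct (proj1 (is_derive_eps f1 x l) Hf1 (- l / 2)) as (r & Hr & Hr'); [lra|].
  set (h := Rmin d r / 2).
  assert (0 < Rmin d r) by now apply Rmin_pos.
  rmin d r.
  assert (Hh : 0 < h) by (unfold h; lra).
  assert (Hneg : forall c, x < c <= x + h -> f1 c < 0).
  { intros c Hc. specialize (Hr' c). rewrite (Rabs_pos_eq (c - x)) in Hr' by lra.
    assert (H4 : c - x < r) by (unfold h in *; lra). specialize (Hr' H4).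
    rewrite H0 in Hr'. apply Rabs_le_between in Hr'. nra. }
  destruct (MVT_cor2 f f1 x (x + h)) as (c & Hc & Hc'); [lra| |].
  { intros c _. apply is_derive_Reals, Hf. }
  assert (Hm' : f x <= f (x + h)).
  { apply Hm. replace (x + h - x) with h by ring. rewrite Rabs_pos_eq; unfold h; lra. }
  assert (f1 c < 0) by (apply Hneg; lra). nra.
Qed.

(** A minimum over past times bounds the time derivative from one side only, and this is the side
    that a supersolution needs. The lemma serves at the junction time of two glued functions, where
    the formula for [b] holds only up to [t]. *)
Lemma touch_past psi ft fx fxx b bt bx bxx t x : 0 < t ->
  smooth psi ft fx fxx ->
  is_derive (fun s => b s x) t (bt t x) ->
  (forall y, is_derive (b t) y (bx t y)) -> is_derive (bx t) x (bxx t x) ->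
  locally_2d (fun s y => s <= t -> b t x - psi t x <= b s y - psi s y) t x ->
  bt t x <= ft t x /\ fxx t x <= bxx t x.
Proof.
  intros Ht Hs B1 B2 B3 [d Hd]. destruct (Hs t x Ht) as (H1 & _ & H3 & _).
  pose proof (cond_pos d) as Hd0. split.
  - enough (bt t x - ft t x <= 0) by lra.
    apply derive_past_min with (fun s => b s x - psi s x) t d; trivial.
    + now apply (is_derive_minus (fun s => b s x) (fun s => psi s x)).
    + intros s Hs'. apply Hd; try lra; [apply Rabs_def1; lra|].
      unfold Rminus. rewrite Rplus_opp_r, Rabs_R0. trivial.
  - enough (0 <= bxx t x - fxx t x) by lra.
    apply derive2_local_min with (fun y => b t y - psi t y) (fun y => bx t y - fx t y) x d;
      trivial.
    + intros y. apply (is_derive_minus (b t) (psi t)); trivial. now apply Hs.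
    + now apply (is_derive_minus (bx t) (fx t)).
    + intros y Hy. apply Hd; trivial; [|lra].
      unfold Rminus. rewrite Rplus_opp_r, Rabs_R0. trivial.
Qed.

Lemma super_smooth K G b bt bx bxx : elliptic K G -> smooth b bt bx bxx ->
  (forall t x, 0 < t -> G (bxx t x) <= bt t x) -> super G b.
Proof.
  intros HG Hb H psi ft fx fxx t x Hs Ht [d Hd].
  destruct (Hb t x Ht) as (B1 & B2 & B3 & _).
  destruct (touch_past psi ft fx fxx b bt bx bxx t x) as [T1 T2]; trivial.
  { intros y. now apply Hb. }
  { exists d. intros; now apply Hd. }
  apply Rle_trans with (G (bxx t x)). { now apply elliptic_mono with K. }
  apply Rle_trans with (bt t x); auto.
Qed.

Lemma continuity_2d_comp f g h t x : continuity_2d_pt f (g t x) (h t x) ->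
  continuity_2d_pt g t x -> continuity_2d_pt h t x ->
  continuity_2d_pt (fun s y => f (g s y) (h s y)) t x.
Proof.
  intros Hf Hg Hh e. destruct (Hf e) as [d Hd].
  destruct (Hg d) as [d1 Hd1]. destruct (Hh d) as [d2 Hd2].
  assert (P : 0 < Rmin d1 d2) by (apply Rmin_pos; apply cond_pos).
  exists (mkposreal _ P). simpl. intros u v Hu Hv.
  rmin d1 d2.
  apply Hd; [apply Hd1|apply Hd2]; lra.
Qed.

Lemma smooth_comp psi ft fx fxx th th' a h : smooth psi ft fx fxx ->
  (forall t, 0 < t -> 0 < th t /\ is_derive th t (th' t) /\ continuity_pt th' t) ->
  smooth (fun t x => psi (th t) (a * x + h)) (fun t x => th' t * ft (th t) (a * x + h))
    (fun t x => a * fx (th t) (a * x + h)) (fun t x => a * a * fxx (th t) (a * x + h)).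
Proof.
  intros Hs Hth t x Ht. destruct (Hth t Ht) as (T1 & T2 & T3).
  destruct (Hs (th t) (a * x + h) T1) as (H1 & H2 & H3 & H4 & H5 & H6 & H7).
  assert (A : is_derive (fun y => a * y + h) x a) by (auto_derive; [exact I|req]).
  assert (C : forall f, continuity_2d_pt f (th t) (a * x + h) ->
    continuity_2d_pt (fun t x => f (th t) (a * x + h)) t x).
  { intros f Hf. apply (continuity_2d_comp f (fun t _ => th t) (fun _ x => a * x + h)); trivial.
    - apply (continuity_1d_2d_pt_comp th (fun t _ => t)); [|apply continuity_2d_pt_id1].
      apply continuity_pt_filterlim.
      apply (ex_derive_continuous (K := R_AbsRing) (V := R_NormedModule)). now exists (th' t).
    - cont2. }
  split7.
  - now apply (is_derive_comp (fun s => psi s (a * x + h)) th).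
  - now apply (is_derive_comp (psi (th t)) (fun y => a * y + h)).
  - rewrite Rmult_assoc. apply (is_derive_scal (fun y => fx (th t) (a * y + h))).
    now apply (is_derive_comp (fx (th t)) (fun y => a * y + h)).
  - now apply C.
  - apply (continuity_2d_pt_mult (fun t _ => th' t)); [|now apply C].
    apply (continuity_1d_2d_pt_comp th' (fun t _ => t)); trivial. apply continuity_2d_pt_id1.
  - apply continuity_2d_pt_mult; [apply continuity_2d_pt_const|now apply C].
  - apply continuity_2d_pt_mult; [apply continuity_2d_pt_const|now apply C].
Qed.

Lemma is_derive_pos_sq (y : R) : is_derive (fun y => Rmax 0 y * Rmax 0 y) y (2 * Rmax 0 y).
Proof.
  apply is_derive_eps. intros e He. exists e. split; trivial. intros z Hz.
  apply Rle_trans with (Rabs (z - y) * Rabs (z - y)).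
  - rewrite <- Rabs_mult, (Rabs_pos_eq ((z - y) * (z - y))) by apply Rle_0_sqr.
    unfold Rmax. destruct (Rle_dec 0 z); destruct (Rle_dec 0 y); apply Rabs_le; split; pose proof (Rle_0_sqr (z - y)) as Q; unfold Rsqr in Q; nra.
  - apply Rmult_le_compat_r; [apply Rabs_pos|lra].
Qed.

Lemma lipschitz_continuity_pt (f : R -> R) L x :
  (forall x y, Rabs (f x - f y) <= L * Rabs (x - y)) -> continuity_pt f x.
Proof.
  intros H e He. exists (e / (Rabs L + 1)).
  assert (HL : 0 < Rabs L + 1) by (pose proof (Rabs_pos L); lra).
  split. { now apply Rdiv_lt_0_compat. }
  intros y [_ Hy]. simpl in *. unfold R_dist in *.
  eapply Rle_lt_trans; [apply H|].
  apply Rle_lt_trans with ((Rabs L + 1) * Rabs (y - x)).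
  - apply Rmult_le_compat_r; [apply Rabs_pos|]. pose proof (Rle_abs L). lra.
  - apply Rmult_lt_compat_l with (r := Rabs L + 1) in Hy; trivial.
    replace ((Rabs L + 1) * (e / (Rabs L + 1))) with e in Hy by (field; lra). exact Hy.
Qed.

(* The quadratic correction makes the shifted clock positive on all of (0, +oo)
   without changing it near t0 + s, as test functions must be C^{1,2} for all t > 0. *)
Lemma smooth_delay psi ft fx fxx s t0 : 0 <= s -> 0 < t0 -> smooth psi ft fx fxx ->
  exists p pt px pxx, smooth p pt px pxx /\
    (forall t x, s + t0 / 2 <= t -> p t x = psi (t - s) x /\ pt t x = ft (t - s) x /\
       pxx t x = fxx (t - s) x).
Proof.
  intros Hs Ht0 Hpsi.
  set (c := s + t0 / 2). set (h := t0 / 2).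
  set (th := fun t => t - s + / h * (Rmax 0 (c - t) * Rmax 0 (c - t))).
  set (th' := fun t => 1 + / h * (- 1 * (2 * Rmax 0 (c - t)))).
  assert (Hh : 0 < h) by (unfold h; lra).
  assert (T : forall t, 0 < t -> 0 < th t /\ is_derive th t (th' t) /\ continuity_pt th' t).
  { intros t Ht. refine (conj _ (conj _ _)).
    - unfold th, Rmax. destruct (Rle_dec 0 (c - t)).
      + set (u := c - t). replace (t - s) with (h - u) by (unfold u, h, c; lra).
        replace (h - u + / h * (u * u)) with (/ h * ((u - h / 2) * (u - h / 2) + 3 / 4 * h * h))
          by (field; lra).
        apply Rmult_lt_0_compat; [now apply Rinv_0_lt_compat|].
        pose proof (Rle_0_sqr (u - h / 2)) as Q. unfold Rsqr in Q. nra.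
      + rewrite !Rmult_0_r. unfold c in *. lra.
    - apply (is_derive_plus (fun t => t - s)). { auto_derive; [exact I|req]. }
      apply (is_derive_scal (fun t => Rmax 0 (c - t) * Rmax 0 (c - t))).
      apply (is_derive_comp (fun y => Rmax 0 y * Rmax 0 y) (fun t => c - t)).
      + apply is_derive_pos_sq.
      + auto_derive; [exact I|req].
    - apply lipschitz_continuity_pt with (2 * / h). intros x y.
      assert (P : 0 < / h) by now apply Rinv_0_lt_compat.
      unfold th'. replace (_ - _) with (- (2 * / h) * (Rmax 0 (c - x) - Rmax 0 (c - y))) by ring.
      rewrite Rabs_mult, Rabs_Ropp, (Rabs_pos_eq (2 * / h)) by lra.
      apply Rmult_le_compat_l; [lra|]. unfold Rmax, Rabs.
      destruct (Rle_dec 0 (c - x)), (Rle_dec 0 (c - y)); repeat destruct Rcase_abs; lra. }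
  pose proof (smooth_comp psi ft fx fxx th th' 1 0 Hpsi T) as S.
  eexists _, _, _, _. split. { exact S. }
  intros t x Ht. simpl.
  assert (E : Rmax 0 (c - t) = 0).
  { apply Rmax_left. fold c in Ht. lra. }
  unfold th, th'. rewrite E. rewrite !Rmult_0_r, !Rplus_0_r, !Rmult_1_l.
  auto.
Qed.

Lemma super_shift G w s h c : 0 <= s -> super G w ->
  super G (fun t x => w (t + s) (x + h) + c).
Proof.
  intros Hs Hw psi ft fx fxx t x Hpsi Ht [d Hd].
  destruct (smooth_delay psi ft fx fxx s t Hs Ht Hpsi) as (p & pt & px & pxx & Sp & Ep).
  assert (T1 : forall t, 0 < t -> 0 < (fun t => t) t /\ is_derive (fun t => t) t 1 /\
    continuity_pt (fun _ => 1) t).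
  { intros u Hu. refine (conj Hu (conj _ _)). apply (is_derive_id u).
    apply continuity_pt_const. now intros ? ?. }
  pose proof (smooth_comp _ _ _ _ (fun t => t) (fun _ => 1) 1 (- h) Sp T1) as S2.
  pose proof (Hw _ _ _ _ (t + s) (x + h) S2) as F. simpl in F.
  assert (Hp : forall y, 1 * y + - h = y - h) by (intros; ring).
  rewrite !Rmult_1_l in F.
  destruct (Ep (t + s) (x + h + - h)) as (E1 & E2 & E3); [lra|].
  rewrite E2, E3 in F.
  replace (t + s - s) with t in F by ring. replace (x + h + - h) with x in F by ring.
  apply F; [lra|].
  set (r := Rmin d (t / 2)).
  assert (Hr : 0 < r) by (apply Rmin_pos; [apply cond_pos|lra]).
  exists (mkposreal r Hr). simpl. intros u v Hu Hv.
  rmin d (t / 2). fold r in H, H0.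
  apply Rabs_def2 in Hu as Hu'.
  rewrite !Rmult_1_l.
  destruct (Ep (t + s) (x + h + - h)) as (-> & _ & _); [lra|].
  destruct (Ep u (v + - h)) as (-> & _ & _); [lra|].
  replace (t + s - s) with t by ring. replace (x + h + - h) with x by ring.
  specialize (Hd (u - s) (v - h)).
  replace (u - s - t) with (u - (t + s)) in Hd by ring.
  replace (v - h - x) with (v - (x + h)) in Hd by ring.
  replace (u - s + s) with u in Hd by ring. replace (v - h + h) with v in Hd by ring.
  replace (v + - h) with (v - h) by ring. simpl in Hd.
  enough (w (t + s) (x + h) + c - psi t x <= w u v + c - psi (u - s) (v - h)) by lra.
  apply Hd; lra.
Qed.

(** * Perron's method *)

Definition supersol (G phi : R -> R) (w : R -> R -> R) : Prop :=
  lsc w /\ (exists m, forall t x, 0 <= t -> m <= w t x) /\ super G w /\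
  (forall x, phi x <= w 0 x).

(** For data bounded by [M] the infimum is finite: the constant [M] belongs to the class, and every
    member stays above [- M]. *)
Definition perron (G phi : R -> R) (t x : R) : R :=
  real (Glb_Rbar (fun z => exists w, supersol G phi w /\ z = w t x)).

Definition bounded_by (M : R) (f : R -> R) : Prop := forall x, Rabs (f x) <= M.

Lemma smooth_affine_time k a : smooth (fun t _ => k + a * t) (fun _ _ => a)
  (fun _ _ => 0) (fun _ _ => 0).
Proof.
  intros t x Ht. split7; try cont2.
  - auto_derive; [exact I|req].
  - auto_derive; [exact I|req].
  - auto_derive; [exact I|req].
Qed.

Lemma supersol_lower_bound K G phi w M : elliptic K G -> G 0 = 0 ->
  bounded_by M phi -> supersol G phi w -> forall t x, 0 <= t -> - M <= w t x.
Proof.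
  intros HG G0 HM (Lw & [m Hm] & Sw & Iw) t x Ht.
  replace (- M) with (- M + 0 * t) by ring.
  apply (super_ge_smooth G K w _ _ _ _ (- M - m) HG Lw Sw (smooth_affine_time (- M) 0)); trivial.
  - apply lsc_continuity_2d. intros; cont2.
  - intros. rewrite G0. lra.
  - intros y. specialize (HM y). apply Rabs_le_between in HM. specialize (Iw y). lra.
  - intros s y Hs. specialize (Hm s y Hs). lra.
Qed.

Lemma supersol_const K G phi M : elliptic K G -> G 0 = 0 -> bounded_by M phi ->
  supersol G phi (fun _ _ => M).
Proof.
  intros HG G0 HM. split; [|split; [|split]].
  - apply lsc_continuity_2d. intros; cont2.
  - exists M. intros; lra.
  - pose proof (smooth_affine_time M 0) as S.
    replace (fun _ _ : R => M) with (fun t _ : R => M + 0 * t).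
    + apply (super_smooth K G _ _ _ _ HG S). intros; rewrite G0; lra.
    + fun_ext2 t x; ring.
  - intros x. specialize (HM x). apply Rabs_le_between in HM. lra.
Qed.

Lemma supersol_shift_const G phi psi w h c : supersol G phi w ->
  (forall x, psi x <= phi (x + h) + c) -> supersol G psi (fun t x => w t (x + h) + c).
Proof.
  intros (Lw & [m Hm] & Sw & Iw) H. split; [|split; [|split]].
  - intros t x e Ht He. destruct (Lw t (x + h) e Ht He) as (d & Hd & Hd').
    exists d. split; trivial. intros s y Hs H1 H2.
    specialize (Hd' s (y + h) Hs H1).
    replace (y + h - (x + h)) with (y - x) in Hd' by ring. specialize (Hd' H2). lra.
  - exists (m + c). intros t x Ht. specialize (Hm t (x + h) Ht). lra.
  - pose proof (super_shift G w 0 h c (Rle_refl 0) Sw) as S.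
    replace (fun t x => w t (x + h) + c) with (fun t x => w (t + 0) (x + h) + c); trivial.
    apply functional_extensionality; intros t. now rewrite Rplus_0_r.
  - intros x. specialize (H x). specialize (Iw (x + h)). lra.
Qed.

Section Perron.
Variables (K : R) (G : R -> R).
Hypothesis (HG : elliptic K G) (G0 : G 0 = 0).

Lemma perron_glb phi M t x : bounded_by M phi -> 0 <= t ->
  (forall w, supersol G phi w -> perron G phi t x <= w t x) /\
  (forall c, (forall w, supersol G phi w -> c <= w t x) -> c <= perron G phi t x).
Proof.
  intros HM Ht. unfold perron.
  set (A := fun z => exists w, supersol G phi w /\ z = w t x).
  destruct (Glb_Rbar_correct A) as [L1 L2].
  assert (B1 : Rbar_le (Finite (- M)) (Glb_Rbar A)).
  { apply L2. intros z (w & Hw & ->). simpl. now apply (supersol_lower_bound K G phi). }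
  assert (B2 : Rbar_le (Glb_Rbar A) (Finite M)).
  { apply L1. exists (fun _ _ => M). split; trivial. now apply (supersol_const K). }
  destruct (Glb_Rbar A) as [g| |]; simpl in *; try tauto.
  split.
  - intros w Hw. apply (L1 (w t x)). now exists w.
  - intros c Hc. apply (L2 (Finite c)). intros z (w & Hw & ->). now apply Hc.
Qed.

Lemma perron_le phi M w t x : bounded_by M phi -> 0 <= t ->
  supersol G phi w -> perron G phi t x <= w t x.
Proof. intros HM Ht. now apply (perron_glb phi M). Qed.

Lemma perron_approx phi M t x e : bounded_by M phi -> 0 <= t -> 0 < e ->
  exists w, supersol G phi w /\ w t x < perron G phi t x + e.
Proof.
  intros HM Ht He. apply NNPP. intros Hn.
  assert (perron G phi t x + e <= perron G phi t x); [|lra].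
  apply (perron_glb phi M); trivial. intros w Hw. apply Rnot_lt_le. intros Hlt.
  apply Hn. now exists w.
Qed.

Lemma perron_bounded phi M t x : bounded_by M phi -> 0 <= t ->
  Rabs (perron G phi t x) <= M.
Proof.
  intros HM Ht. apply Rabs_le. split.
  - apply (perron_glb phi M); trivial. intros. now apply (supersol_lower_bound K G phi).
  - apply (perron_le phi M (fun _ _ => M)); trivial. now apply (supersol_const K).
Qed.

Lemma perron_initial_ge phi M x : bounded_by M phi -> phi x <= perron G phi 0 x.
Proof.
  intros HM. apply (perron_glb phi M); trivial; [lra|]. intros w Hw. apply Hw.
Qed.

(** Translating and lifting carries supersolutions for [phi] to supersolutions for [psi].
    Monotonicity, contraction and the spatial Lipschitz bound are all instances. *)
Lemma perron_compare phi psi M M' h c t x : bounded_by M phi -> bounded_by M' psi ->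
  0 <= t -> (forall x, psi x <= phi (x + h) + c) ->
  perron G psi t x <= perron G phi t (x + h) + c.
Proof.
  intros HM HM' Ht H. enough (perron G psi t x - c <= perron G phi t (x + h)) by lra.
  apply (perron_glb phi M); trivial. intros w Hw.
  enough (perron G psi t x <= w t (x + h) + c) by lra.
  apply (perron_le psi M' (fun t x => w t (x + h) + c)); trivial.
  now apply supersol_shift_const with phi.
Qed.

Lemma perron_lip phi M L t x y : bounded_by M phi -> 0 <= t ->
  (forall x y, Rabs (phi x - phi y) <= L * Rabs (x - y)) ->
  Rabs (perron G phi t x - perron G phi t y) <= L * Rabs (x - y).
Proof.
  intros HM Ht HL.
  assert (E : forall x y, perron G phi t x <= perron G phi t y + L * Rabs (x - y)).
  { intros u v. replace v with (u + (v - u)) at 1 by ring.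
    apply (perron_compare phi phi M M); trivial. intros z.
    specialize (HL z (z + (v - u))).
    replace (z - (z + (v - u))) with (u - v) in HL by ring.
    apply Rabs_le_between in HL. lra. }
  pose proof (E x y). pose proof (E y x). rewrite Rabs_minus_sym in H0.
  apply Rabs_le. lra.
Qed.

(** For such data [K * B] bounds [G] of the second derivative, so [phi x - K * B * t] and
    [phi x + K * B * t] are classical barriers and the Perron function is Lipschitz in time. *)
Definition C2b (phi p1 p2 : R -> R) (B : R) : Prop :=
  (forall x, is_derive phi x (p1 x)) /\ (forall x, is_derive p1 x (p2 x)) /\
  (forall x, continuity_pt p2 x) /\ bounded_by B p2.

Lemma C2b_continuity phi p1 p2 B x : C2b phi p1 p2 B ->
  continuity_pt phi x /\ continuity_pt p1 x /\ continuity_pt p2 x.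
Proof.
  intros (H1 & H2 & H3 & _). refine (conj _ (conj _ (H3 x)));
  apply continuity_pt_filterlim;
  apply (ex_derive_continuous (K := R_AbsRing) (V := R_NormedModule)).
  - now exists (p1 x). - now exists (p2 x).
Qed.

Lemma smooth_time_C2 phi p1 p2 B k : C2b phi p1 p2 B ->
  smooth (fun t x => phi x + k * t) (fun _ _ => k) (fun _ x => p1 x) (fun _ x => p2 x).
Proof.
  intros H t x Ht. destruct (C2b_continuity _ _ _ _ x H) as (C0 & C1 & C2).
  pose proof (fun f => continuity_2d_snd f t x) as D.
  destruct H as (H1 & H2 & _).
  split7; try (now apply D); try cont2; try (now apply D); try apply H2.
  - auto_derive; [exact I|req].
  - rewrite <- (Rplus_0_r (p1 x)).
    apply (is_derive_plus (K := R_AbsRing) (V := R_NormedModule)).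
    + apply H1. + apply (is_derive_const (k * t) x).
Qed.

Lemma C2b_G_bound phi p1 p2 B x : C2b phi p1 p2 B -> Rabs (G (p2 x)) <= K * B.
Proof.
  intros (_ & _ & _ & H). replace (G (p2 x)) with (G (p2 x) - G 0) by lra.
  eapply Rle_trans. { apply elliptic_lip, HG. }
  apply Rmult_le_compat_l. { apply HG. } rewrite Rminus_0_r. apply H.
Qed.

Lemma continuity_2d_affine_time phi k t x : continuity_pt phi x ->
  continuity_2d_pt (fun t x => phi x + k * t) t x.
Proof.
  intros H. cont2. now apply continuity_2d_snd.
Qed.

Lemma supersol_early phi p1 p2 B M w t x : C2b phi p1 p2 B -> bounded_by M phi ->
  supersol G phi w -> 0 <= t -> phi x - K * B * t <= w t x.
Proof.
  intros H HM Hw Ht. pose proof (supersol_lower_bound K G phi w M HG G0 HM Hw) as Hb.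
  destruct Hw as (Lw & _ & Sw & Iw).
  assert (HB : 0 <= B). { eapply Rle_trans; [apply Rabs_pos|]. apply (proj2 (proj2 (proj2 H)) 0). }
  assert (HKB : 0 <= K * B). { apply Rmult_le_pos; trivial. apply HG. }
  replace (phi x - K * B * t) with (phi x + - (K * B) * t) by ring.
  apply (super_ge_smooth G K w _ _ _ _ (2 * M) HG Lw Sw
    (smooth_time_C2 _ _ _ _ (- (K * B)) H)); trivial.
  - apply lsc_continuity_2d. intros s y _. apply continuity_2d_pt_opp.
    apply continuity_2d_affine_time. now apply (C2b_continuity _ _ _ _ y H).
  - intros s y _. pose proof (C2b_G_bound _ _ _ _ y H) as Q.
    apply Rabs_le_between in Q. lra.
  - intros y. specialize (Iw y). lra.
  - intros s y Hs. specialize (Hb s y Hs). specialize (HM y). apply Rabs_le_between in HM. nra.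
Qed.

(** The glued function follows the classical barrier up to time [s], then [w]. At the junction it
    takes the lower of the two values, because [phi x <= w 0 x]; this keeps it lower semicontinuous,
    and a test function touching there is handled by [touch_past]. *)
Lemma supersol_late phi p1 p2 B M w s : C2b phi p1 p2 B -> bounded_by M phi ->
  supersol G phi w -> 0 <= s ->
  supersol G phi (fun t x => if Rle_dec t s then phi x + K * B * t else w (t - s) x + K * B * s).
Proof.
  intros H HM Hw Hs. pose proof (supersol_lower_bound K G phi w M HG G0 HM Hw) as Hb.
  destruct Hw as (Lw & _ & Sw & Iw).
  assert (HB : 0 <= B). { eapply Rle_trans; [apply Rabs_pos|]. apply (proj2 (proj2 (proj2 H)) 0). }
  assert (HKB : 0 <= K * B). { apply Rmult_le_pos; trivial. apply HG. }
  split; [|split; [|split]].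
  - intros t x e Ht He.
    assert (C : exists d, 0 < d /\ forall u y, Rabs (u - t) < d -> Rabs (y - x) < d ->
      phi x + K * B * t - e < phi y + K * B * u).
    { destruct (continuity_2d_affine_time phi (K * B) t x (proj1 (C2b_continuity _ _ _ _ x H))
        (mkposreal e He)) as [d Hd]. exists d. split; [apply cond_pos|].
      intros u y H1 H2. specialize (Hd u y H1 H2). simpl in Hd. apply Rabs_def2 in Hd. lra. }
    destruct C as (d1 & Hd1 & C).
    destruct (Rle_dec t s) as [c|c].
    + destruct (Rle_lt_or_eq_dec _ _ c) as [c'|c'].
      * exists (Rmin d1 (s - t)). split. { apply Rmin_pos; lra. }
        intros u y Hu H1 H2. rmin d1 (s - t).
        pose proof (Rabs_def2 _ _ H1).
        destruct (Rle_dec u s); [|lra]. apply C; lra.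
      * destruct (Lw 0 x e (Rle_refl 0) He) as (d2 & Hd2 & W).
        exists (Rmin d1 d2). split. { apply Rmin_pos; lra. }
        intros u y Hu H1 H2. rmin d1 d2.
        destruct (Rle_dec u s). { apply C; lra. }
        specialize (W (u - s) y). rewrite Rminus_0_r in W. subst t.
        assert (w 0 x - e < w (u - s) y) by (apply W; lra). specialize (Iw x). nra.
    + destruct (Lw (t - s) x e) as (d2 & Hd2 & W); try lra.
      exists (Rmin d2 (t - s)). split. { apply Rmin_pos; lra. }
      intros u y Hu H1 H2. rmin d2 (t - s).
      pose proof (Rabs_def2 _ _ H1).
      destruct (Rle_dec u s); [lra|]. specialize (W (u - s) y).
      replace (u - s - (t - s)) with (u - t) in W by ring.
      assert (w (t - s) x - e < w (u - s) y) by (apply W; lra). lra.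
  - exists (- M). intros t x Ht. destruct (Rle_dec t s).
    + specialize (HM x). apply Rabs_le_between in HM. nra.
    + specialize (Hb (t - s) x). assert (- M <= w (t - s) x) by (apply Hb; lra). nra.
  - intros psi ft fx fxx t x Hpsi Ht [d Hd].
    destruct (Rle_dec t s) as [c|c].
    + pose proof (smooth_time_C2 _ _ _ _ (K * B) H) as Sb.
      destruct (Sb t x Ht) as (B1 & _).
      destruct (touch_past psi ft fx fxx (fun t x => phi x + K * B * t) (fun _ _ => K * B) (fun _ x => p1 x) (fun _ x => p2 x) t x Ht Hpsi B1)
        as [T1 T2].
      * intros y. now apply Sb.
      * apply H.
      * exists d. intros u y H1 H2 H3. specialize (Hd u y H1 H2). cbv beta in Hd.
        destruct (Rle_dec u s), (Rle_dec t s); lra.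
      * cbv beta in T1, T2. apply Rle_trans with (G (p2 x)).
        { now apply elliptic_mono with K. }
        pose proof (C2b_G_bound _ _ _ _ x H) as Q. apply Rabs_le_between in Q. lra.
    + assert (T : forall t, 0 < t -> 0 < (fun t => t + s) t /\
        is_derive (fun t => t + s) t 1 /\ continuity_pt (fun _ => 1) t).
      { intros u Hu. refine (conj _ (conj _ _)). lra. auto_derive; [exact I|req].
        apply continuity_pt_const. now intros ? ?. }
      pose proof (smooth_comp _ _ _ _ _ _ 1 0 Hpsi T) as S2.
      pose proof (Sw _ _ _ _ (t - s) x S2) as F. simpl in F.
      rewrite !Rmult_1_l, Rplus_0_r in F.
      replace (t - s + s) with t in F by ring. apply F; [lra|].
      assert (P : 0 < Rmin d (t - s)) by (apply Rmin_pos; [apply cond_pos|lra]).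
      exists (mkposreal _ P). simpl. intros u y H1 H2.
      rmin d (t - s).
      pose proof (Rabs_def2 _ _ H1).
      rewrite !Rmult_1_l, !Rplus_0_r. replace (t - s + s) with t by ring.
      specialize (Hd (u + s) y). replace (u + s - t) with (u - (t - s)) in Hd by ring.
      cbv beta in Hd. destruct (Rle_dec t s); [lra|]. destruct (Rle_dec (u + s) s); [lra|].
      replace (u + s - s) with u in Hd by ring.
      assert (w (t - s) x + K * B * s - psi t x <= w u y + K * B * s - psi (u + s) y)
        by (apply Hd; lra). lra.
  - intros x. destruct (Rle_dec 0 s); [nra|lra].
Qed.

Lemma perron_time_lip phi p1 p2 B M t s x : C2b phi p1 p2 B -> bounded_by M phi ->
  0 <= t -> 0 <= s -> Rabs (perron G phi t x - perron G phi s x) <= K * B * Rabs (t - s).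
Proof.
  intros H HM Ht Hs.
  assert (E : forall t s, 0 <= t -> 0 < s ->
    Rabs (perron G phi (t + s) x - perron G phi t x) <= K * B * s).
  { clear t s Ht Hs. intros t s Ht Hs. apply Rabs_le. split.
    - enough (perron G phi t x - K * B * s <= perron G phi (t + s) x) by lra.
      apply (perron_glb phi M); trivial; [lra|]. intros w Hw.
      enough (perron G phi t x <= w (t + s) x + K * B * s) by lra.
      apply (perron_le phi M (fun t x => w (t + s) x + K * B * s)); trivial.
      (* At time [s] the function [w] is still above [phi - K * B * s]; started there and lifted by
         [K * B * s] it is again admissible for [phi]. *)
      pose proof (fun y => supersol_early _ _ _ _ _ w s y H HM Hw (Rlt_le _ _ Hs)) as E'.
      destruct Hw as (Lw & [m Hm] & Sw & Iw). split; [|split; [|split]].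
      + intros u y e Hu He. destruct (Lw (u + s) y e) as (d & Hd & Hd'); try lra.
        exists d. split; trivial. intros v z Hv H1 H2. specialize (Hd' (v + s) z).
        replace (v + s - (u + s)) with (v - u) in Hd' by ring.
        assert (w (u + s) y - e < w (v + s) z) by (apply Hd'; lra). lra.
      + exists (m + K * B * s). intros u y Hu.
        assert (m <= w (u + s) y) by (apply Hm; lra). lra.
      + pose proof (super_shift G w s 0 (K * B * s) (Rlt_le _ _ Hs) Sw) as S.
        replace (fun t x => w (t + s) x + K * B * s)
          with (fun t x => w (t + s) (x + 0) + K * B * s); trivial.
        fun_ext2 u y.
        now rewrite Rplus_0_r.
      + intros y. rewrite Rplus_0_l. specialize (E' y). lra.
    - enough (perron G phi (t + s) x - K * B * s <= perron G phi t x) by lra.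
      apply (perron_glb phi M); trivial. intros w Hw.
      destruct (Rle_lt_or_eq_dec _ _ Ht) as [c|c].
      + pose proof (perron_le phi M _ (t + s) x HM ltac:(lra)
          (supersol_late _ _ _ _ _ w s H HM Hw (Rlt_le _ _ Hs))) as Q. simpl in Q.
        destruct (Rle_dec (t + s) s); [lra|]. replace (t + s - s) with t in Q by ring. lra.
      + subst t. pose proof (perron_le phi M _ (0 + s) x HM ltac:(lra)
          (supersol_late _ _ _ _ _ w s H HM Hw (Rlt_le _ _ Hs))) as Q. simpl in Q.
        destruct (Rle_dec (0 + s) s); [|lra]. rewrite Rplus_0_l in *.
        destruct Hw as (_ & _ & _ & Iw). specialize (Iw x). lra. }
  destruct (Rtotal_order t s) as [c|[c|c]].
  - rewrite Rabs_minus_sym, (Rabs_minus_sym t s), (Rabs_pos_eq (s - t)) by lra.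
    replace s with (t + (s - t)) at 1 by ring. apply E; lra.
  - subst. unfold Rminus. rewrite !Rplus_opp_r, Rabs_R0. lra.
  - rewrite (Rabs_pos_eq (t - s)) by lra.
    replace t with (s + (t - s)) at 1 by ring. apply E; lra.
Qed.

Lemma perron_initial_C2 phi p1 p2 B M x : C2b phi p1 p2 B -> bounded_by M phi ->
  perron G phi 0 x = phi x.
Proof.
  intros H HM. apply Rle_antisym; [|now apply perron_initial_ge with M].
  pose proof (supersol_const K G phi M HG G0 HM) as Hw.
  (* With waiting time 0 the glued supersolution takes exactly the value [phi x] at time 0. *)
  pose proof (perron_le phi M _ 0 x HM (Rle_refl 0)
    (supersol_late _ _ _ _ _ _ 0 H HM Hw (Rle_refl 0))) as Q. simpl in Q.
  destruct (Rle_dec 0 0); lra.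
Qed.

Definition approx_C2 (phi : R -> R) : Prop := forall e, 0 < e ->
  exists p p1 p2 B M, C2b p p1 p2 B /\ bounded_by M p /\
    forall x, Rabs (phi x - p x) <= e.

Lemma perron_close phi psi M M' e t x : bounded_by M phi -> bounded_by M' psi -> 0 <= t ->
  (forall x, Rabs (phi x - psi x) <= e) ->
  Rabs (perron G phi t x - perron G psi t x) <= e.
Proof.
  intros H1 H2 Ht H.
  assert (perron G phi t x <= perron G psi t (x + 0) + e).
  { apply (perron_compare psi phi M' M); trivial. intros y. rewrite Rplus_0_r.
    specialize (H y). apply Rabs_le_between in H. lra. }
  assert (perron G psi t x <= perron G phi t (x + 0) + e).
  { apply (perron_compare phi psi M M'); trivial. intros y. rewrite Rplus_0_r.
    specialize (H y). apply Rabs_le_between in H. lra. }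
  rewrite Rplus_0_r in *. apply Rabs_le. lra.
Qed.

Lemma perron_initial phi M x : approx_C2 phi -> bounded_by M phi ->
  perron G phi 0 x = phi x.
Proof.
  intros HA HM. apply Rle_antisym; [|now apply perron_initial_ge with M].
  apply le_epsilon. intros e He.
  destruct (HA (e / 2)) as (p & p1 & p2 & B & M' & Hp & HM' & Hd); [lra|].
  pose proof (perron_close phi p M M' (e / 2) 0 x HM HM' (Rle_refl 0) Hd) as C.
  rewrite (perron_initial_C2 p p1 p2 B M' x Hp HM') in C.
  specialize (Hd x). apply Rabs_le_between in Hd, C. lra.
Qed.

(** Data that are merely Lipschitz need not give a flow Lipschitz in time; approximation by [C2b]
    data leaves a modulus of continuity uniform in [x]. *)
Definition time_equicont (u : R -> R -> R) : Prop := forall e, 0 < e ->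
  exists d, 0 < d /\ forall t s x, 0 <= t -> 0 <= s -> Rabs (t - s) < d ->
    Rabs (u t x - u s x) < e.

Lemma perron_time_equicont phi M : approx_C2 phi -> bounded_by M phi ->
  time_equicont (perron G phi).
Proof.
  intros HA HM e He.
  destruct (HA (e / 4)) as (p & p1 & p2 & B & M' & Hp & HM' & Hd); [lra|].
  assert (HB : 0 <= B). { eapply Rle_trans; [apply Rabs_pos|]. apply (proj2 (proj2 (proj2 Hp)) 0). }
  assert (HKB : 0 <= K * B). { apply Rmult_le_pos; trivial. apply HG. }
  exists (e / (4 * (K * B + 1))).
  assert (D0 : 0 < e / (4 * (K * B + 1))) by (apply Rdiv_lt_0_compat; lra).
  split; trivial.
  intros t s x Ht Hs Hts.
  pose proof (perron_close phi p M M' (e / 4) t x HM HM' Ht Hd) as C1.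
  pose proof (perron_close phi p M M' (e / 4) s x HM HM' Hs Hd) as C2.
  pose proof (perron_time_lip p p1 p2 B M' t s x Hp HM' Ht Hs) as C3.
  assert (K * B * Rabs (t - s) <= e / 4).
  { apply Rle_trans with ((K * B + 1) * (e / (4 * (K * B + 1)))).
    - apply Rmult_le_compat; try lra. apply Rabs_pos.
    - right. field. lra. }
  apply Rabs_le_between in C1, C2, C3. apply Rabs_def1; lra.
Qed.

End Perron.

Definition lipschitz (L : R) (f : R -> R) : Prop :=
  forall x y, Rabs (f x - f y) <= L * Rabs (x - y).

Lemma lipschitz_pos L f : lipschitz L f -> 0 <= L.
Proof.
  intros H. specialize (H 1 0). rewrite Rminus_0_r, Rabs_R1 in H.
  pose proof (Rabs_pos (f 1 - f 0)). lra.
Qed.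

Lemma lsc_equicont u L : 0 <= L -> time_equicont u ->
  (forall t x y, 0 <= t -> Rabs (u t x - u t y) <= L * Rabs (x - y)) ->
  lsc u /\ lsc (fun t x => - u t x).
Proof.
  intros HL HT HX.
  assert (E : forall t x e, 0 <= t -> 0 < e -> exists d, 0 < d /\ forall s y, 0 <= s ->
    Rabs (s - t) < d -> Rabs (y - x) < d -> Rabs (u s y - u t x) < e).
  { intros t x e Ht He. destruct (HT (e / 2)) as (d & Hd & H); [lra|].
    assert (HE : 0 < e / (2 * (L + 1))) by (apply Rdiv_lt_0_compat; lra).
    exists (Rmin d (e / (2 * (L + 1)))). split. { now apply Rmin_pos. }
    intros s y Hs H1 H2. pose proof (Rmin_l d (e / (2 * (L + 1)))).
    pose proof (Rmin_r d (e / (2 * (L + 1)))).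
    assert (A : Rabs (u s y - u t y) < e / 2) by (apply H; lra).
    assert (B : Rabs (u t y - u t x) <= e / 2).
    { eapply Rle_trans; [now apply HX|].
      apply Rle_trans with ((L + 1) * (e / (2 * (L + 1)))).
      - apply Rmult_le_compat; try lra. apply Rabs_pos.
      - right. field. lra. }
    apply Rabs_le_between in B. apply Rabs_def2 in A. apply Rabs_def1; lra. }
  split; intros t x e Ht He; destruct (E t x e Ht He) as (d & Hd & Hd');
  exists d; split; trivial; intros s y Hs H1 H2; specialize (Hd' s y Hs H1 H2);
  apply Rabs_def2 in Hd'; lra.
Qed.

Lemma positive_near f t x : continuity_2d_pt f t x -> 0 < f t x ->
  exists d, 0 < d /\ forall s y, Rabs (s - t) < d -> Rabs (y - x) < d -> 0 < f s y.
Proof.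
  intros Hf Hp. destruct (Hf (mkposreal _ Hp)) as [d Hd]. exists d.
  split; [apply cond_pos|]. intros s y H1 H2. specialize (Hd s y H1 H2).
  simpl in Hd. apply Rabs_def2 in Hd. lra.
Qed.

Section PerronSolution.
Variables (K : R) (G phi : R -> R) (M L : R).
Hypotheses (HG : elliptic K G) (G0 : G 0 = 0) (HM : bounded_by M phi)
  (HL : lipschitz L phi) (HA : approx_C2 phi).

Lemma perron_lsc : lsc (perron G phi) /\ lsc (fun t x => - perron G phi t x).
Proof.
  apply lsc_equicont with L.
  - now apply lipschitz_pos with phi.
  - now apply (perron_time_equicont K G HG G0 phi M).
  - intros t x y Ht. now apply (perron_lip K G HG G0 phi M).
Qed.

(** A violated test at the infimum is handed to a member [w] of the class that nearly attains it:
    subtracting a paraboloid makes the contact strict, so [w - P] still has an interior minimum near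
    the point, where the violation persists. *)
Lemma perron_super : super G (perron G phi).
Proof.
  intros psi ft fx fxx t0 x0 Hpsi Ht0 [d Hd]. set (V := perron G phi) in *.
  apply Rnot_lt_le. intros Hlt.
  pose proof (proj1 HG) as HK.
  (* The paraboloid costs at most [2 * k * K] in [G], against a violation of [4 * k * (K + 1)]. *)
  set (k := (G (fxx t0 x0) - ft t0 x0) / (4 * (K + 1))).
  assert (Hk : 0 < k) by (apply Rdiv_lt_0_compat; lra).
  pose proof (smooth_plus _ _ _ _ _ _ _ _ Hpsi (smooth_parabola 0 t0 x0 0 (- k) (- k))) as S.
  set (P := fun t x => psi t x + (0 + 0 * (t - t0) + - k * (x - x0) * (x - x0)
    + - k * (t - t0) * (t - t0))) in *.
  destruct (Hpsi t0 x0 Ht0) as (_ & _ & _ & C1 & C2 & _ & C3).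
  destruct (positive_near (fun t x => G (fxx t x + 2 * - k) - (ft t x + (0 + 2 * - k * (t - t0))))
    t0 x0) as (d1 & Hd1 & Hpos).
  { apply continuity_2d_pt_minus.
    - apply (elliptic_continuous_2d K G (fun t x => fxx t x + 2 * - k)); trivial.
      apply continuity_2d_pt_plus; trivial. apply continuity_2d_pt_const.
    - apply continuity_2d_pt_plus; trivial. unfold Rminus. cont2. }
  { destruct HG as [_ HG']. destruct (HG' (fxx t0 x0 + 2 * - k) (2 * k)) as [_ Q]; [lra|].
    replace (fxx t0 x0 + 2 * - k + 2 * k) with (fxx t0 x0) in Q by ring.
    assert (E : k * (4 * (K + 1)) = G (fxx t0 x0) - ft t0 x0) by (unfold k; field; lra).
    nra. }
  set (r := Rmin (Rmin d d1) t0 / 2).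
  assert (Hr : 0 < r /\ r < d /\ r < d1 /\ r < t0).
  { rmin (Rmin d d1) t0.
    rmin d d1. pose proof (cond_pos d).
    assert (0 < Rmin (Rmin d d1) t0) by (repeat apply Rmin_pos; lra).
    unfold r. lra. }
  destruct Hr as (Hr & R1 & R2 & R3).
  (* On the boundary of the square of half-side [r], [P] is below [psi] by at least [k * r * r]. A
     [w] closer than that to [V] at the centre must attain its minimum inside. *)
  destruct (perron_approx K G HG G0 phi M t0 x0 (k * r * r) HM (Rlt_le _ _ Ht0)) as (w & Hw & Hw').
  { apply Rmult_lt_0_compat; trivial. now apply Rmult_lt_0_compat. }
  fold V in Hw'.
  assert (HwV : forall t x, 0 <= t -> V t x <= w t x).
  { intros t x Ht. now apply (perron_le K G HG G0 phi M). }
  destruct (box_minimum (fun t x => w t x + - P t x) (t0 - r) (t0 + r) (x0 - r) (x0 + r))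
    as (t & x & Bt & Bx & Hmin); try lra.
  { intros t x e Ht Hx He.
    assert (T : 0 < t) by lra. destruct (S t x T) as (_ & _ & _ & CP & _).
    destruct (proj1 Hw t x (e / 2)) as (d2 & D2 & W); try lra.
    assert (E2 : 0 < e / 2) by lra.
    destruct (CP (mkposreal _ E2)) as [d3 D3].
    exists (Rmin d2 d3). split. { apply Rmin_pos; [lra|apply cond_pos]. }
    intros s y Hs Hy H1 H2. rmin d2 d3.
    assert (w t x - e / 2 < w s y) by (apply W; lra).
    assert (Q : Rabs (P s y - P t x) < e / 2) by (apply D3; lra).
    apply Rabs_def2 in Q. lra. }
  assert (In : t0 - r < t < t0 + r /\ x0 - r < x < x0 + r).
  { specialize (Hmin t0 x0 ltac:(lra) ltac:(lra)).
    assert (Q : V t0 x0 - psi t0 x0 <= V t x - psi t x).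
    { apply Hd; apply Rabs_def1; lra. }
    specialize (HwV t x ltac:(lra)). unfold P in Hmin.
    assert (Q2 : (x - x0) * (x - x0) + (t - t0) * (t - t0) < r * r).
    { apply Rmult_lt_reg_l with k; trivial. nra. }
    pose proof (Rle_0_sqr (x - x0)) as Q3. pose proof (Rle_0_sqr (t - t0)) as Q4.
    unfold Rsqr in Q3, Q4. split; split; nra. }
  destruct In as [I1 I2].
  assert (Hc : G (fxx t x + 2 * - k) <= ft t x + (0 + 2 * - k * (t - t0))).
  { destruct Hw as (_ & _ & Sw & _).
    apply (Sw _ _ _ _ t x S); [lra|].
    set (q := Rmin (r - Rabs (t - t0)) (r - Rabs (x - x0))).
    assert (Hq : 0 < q).
    { apply Rmin_pos; apply Rlt_0_minus; apply Rabs_def1; lra. }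
    exists (mkposreal q Hq). simpl. intros s y H1 H2.
    enough (w t x + - P t x <= w s y + - P s y) by (unfold P in *; lra).
    rmin (r - Rabs (t - t0)) (r - Rabs (x - x0)).
    fold q in H, H0.
    assert (Z1 : Rabs (s - t0) <= r).
    { replace (s - t0) with ((s - t) + (t - t0)) by ring.
      eapply Rle_trans; [apply Rabs_triang|lra]. }
    assert (Z2 : Rabs (y - x0) <= r).
    { replace (y - x0) with ((y - x) + (x - x0)) by ring.
      eapply Rle_trans; [apply Rabs_triang|lra]. }
    apply Rabs_le_between in Z1, Z2. apply Hmin; lra. }
  specialize (Hpos t x). assert (0 < G (fxx t x + 2 * - k) - (ft t x + (0 + 2 * - k * (t - t0)))).
  { apply Hpos; apply Rabs_def1; lra. }
  lra.
Qed.

Lemma super_bar_intro u :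
  (forall psi ft fx fxx t x, smooth psi ft fx fxx -> 0 < t ->
     locally_2d (fun s y => u s y - psi s y <= u t x - psi t x) t x ->
     ft t x <= G (fxx t x)) -> super (Gbar G) (fun t x => - u t x).
Proof.
  intros H psi ft fx fxx t x Hpsi Ht [d Hd].
  specialize (H _ _ _ _ t x (smooth_opp _ _ _ _ Hpsi) Ht). simpl in H. unfold Gbar.
  enough (- ft t x <= G (- fxx t x)) by lra.
  apply H. exists d. intros s y H1 H2. specialize (Hd s y H1 H2). cbv beta in Hd. lra.
Qed.

(* A test function violating the subsolution inequality can be lowered and strictified
   into a local supersolution; its minimum with the Perron function would be a strictly
   smaller element of the Perron class. *)
Lemma perron_sub : super (Gbar G) (fun t x => - perron G phi t x).
Proof.
  apply super_bar_intro. intros psi ft fx fxx t0 x0 Hpsi Ht0 [d Hd].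
  set (V := perron G phi) in *. apply Rnot_lt_le. intros Hlt.
  pose proof (proj1 HG) as HK. destruct perron_lsc as [LV UV]. fold V in LV, UV.
  pose proof perron_super as SV. fold V in SV.
  set (k := (ft t0 x0 - G (fxx t0 x0)) / (4 * (K + 1))).
  assert (Hk : 0 < k) by (apply Rdiv_lt_0_compat; lra).
  destruct (Hpsi t0 x0 Ht0) as (_ & _ & _ & C1 & C2 & _ & C3).
  destruct (positive_near (fun t x => (ft t x + (0 + 2 * k * (t - t0))) - G (fxx t x + 2 * k))
    t0 x0) as (d1 & Hd1 & Hpos).
  { apply continuity_2d_pt_minus.
    - apply continuity_2d_pt_plus; trivial. unfold Rminus. cont2.
    - apply (elliptic_continuous_2d K G (fun t x => fxx t x + 2 * k)); trivial.
      apply continuity_2d_pt_plus; trivial. apply continuity_2d_pt_const. }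
  { destruct HG as [_ HG']. destruct (HG' (fxx t0 x0) (2 * k)) as [_ Q]; [lra|].
    assert (E : k * (4 * (K + 1)) = ft t0 x0 - G (fxx t0 x0)) by (unfold k; field; lra).
    nra. }
  destruct (positive_near (fun t x => psi t x + (1 - psi t0 x0)) t0 x0) as (d2 & Hd2 & Hbd).
  { apply continuity_2d_pt_plus; trivial. apply continuity_2d_pt_const. }
  { lra. }
  set (r := Rmin (Rmin d d1) (Rmin d2 t0) / 2).
  assert (Hr : 0 < r /\ r < d /\ r < d1 /\ r < d2 /\ r < t0).
  { rmin (Rmin d d1) (Rmin d2 t0).
    rmin d d1. pose proof (cond_pos d).
    rmin d2 t0.
    assert (0 < Rmin (Rmin d d1) (Rmin d2 t0)) by (repeat apply Rmin_pos; lra).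
    unfold r. lra. }
  destruct Hr as (Hr & R1 & R2 & R4 & R3).
  (* Outside the half-size square the paraboloid rises by at least [eta]. Lowering by [eta] thus
     puts [P] strictly below [V] at the centre while [P] stays above [V] on the outer ring, so the
     minimum joins [V] there. *)
  set (eta := k * (r / 2) * (r / 2)).
  assert (Heta : 0 < eta) .
  { unfold eta. apply Rmult_lt_0_compat; [apply Rmult_lt_0_compat|]; lra. }
  pose proof (smooth_plus _ _ _ _ _ _ _ _ Hpsi
    (smooth_parabola (V t0 x0 - psi t0 x0 - eta) t0 x0 0 k k)) as S.
  set (P := fun t x => psi t x + (V t0 x0 - psi t0 x0 - eta + 0 * (t - t0)
    + k * (x - x0) * (x - x0) + k * (t - t0) * (t - t0))) in *.
  set (In := fun q t x => Rabs (t - t0) < q /\ Rabs (x - x0) < q).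
  assert (Out : forall t x, In r t x -> ~ In (r / 2) t x -> V t x <= P t x).
  { intros t x [H1 H2] H3. 
    assert (Q : V t x - psi t x <= V t0 x0 - psi t0 x0) by (apply Hd; lra).
    assert (Q2 : eta <= k * (x - x0) * (x - x0) + k * (t - t0) * (t - t0)).
    { unfold eta.
      assert (Z : r / 2 * (r / 2) <= (x - x0) * (x - x0) + (t - t0) * (t - t0)).
      { pose proof (Rle_0_sqr (x - x0)) as Q3. pose proof (Rle_0_sqr (t - t0)) as Q4.
        unfold Rsqr in Q3, Q4.
        assert (A : forall z, r / 2 <= Rabs z -> r / 2 * (r / 2) <= z * z).
        { intros z Hz. rewrite <- (Rabs_pos_eq (z * z)) by apply Rle_0_sqr.
          rewrite Rabs_mult. apply Rmult_le_compat; lra. }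
        destruct (Rlt_dec (Rabs (t - t0)) (r / 2)) as [c|c].
        - destruct (Rlt_dec (Rabs (x - x0)) (r / 2)) as [c'|c'].
          + exfalso. apply H3. now split.
          + specialize (A (x - x0) ltac:(lra)). lra.
        - specialize (A (t - t0) ltac:(lra)). lra. }
      apply Rmult_le_compat_l with (r := k) in Z; lra. }
    unfold P. lra. }
  set (w := fun t x => if excluded_middle_informative (In r t x)
    then Rmin (V t x) (P t x) else V t x).
  assert (wV : forall t x, w t x <= V t x).
  { intros t x. unfold w. destruct (excluded_middle_informative (In r t x)); [apply Rmin_l|lra]. }
  assert (wcase : forall t x, w t x = V t x \/ (In (r / 2) t x /\ w t x = P t x)).
  { intros t x. unfold w. destruct (excluded_middle_informative (In r t x)) as [i|]; [|now left].
    destruct (classic (In (r / 2) t x)) as [c|c].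
    - unfold Rmin. destruct (Rle_dec (V t x) (P t x)); tauto.
    - left. apply Rmin_left. now apply Out. }
  assert (wP : forall t x, In r t x -> w t x <= P t x).
  { intros t x i. unfold w. destruct (excluded_middle_informative (In r t x)); [apply Rmin_r|tauto]. }
  assert (Inpos : forall t x, In r t x -> 0 < t).
  { intros t x [H1 _]. apply Rabs_def2 in H1. lra. }
  assert (Inhalf : forall t x, In (r / 2) t x -> In r t x).
  { intros t x [H1 H2]. split; lra. }
  assert (Innear : forall t x s y, In (r / 2) s y -> Rabs (s - t) < r / 2 ->
    Rabs (y - x) < r / 2 -> In r t x).
  { intros t x s y [H1 H2] H3 H4. split.
    - replace (t - t0) with ((s - t0) - (s - t)) by ring.
      eapply Rle_lt_trans; [apply Rabs_triang|]. rewrite Rabs_Ropp. lra.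
    - replace (x - x0) with ((y - x0) - (y - x)) by ring.
      eapply Rle_lt_trans; [apply Rabs_triang|]. rewrite Rabs_Ropp. lra. }
  assert (Hw : supersol G phi w).
  { split; [|split; [|split]].
    - intros t x e Ht He. destruct (LV t x e Ht He) as (e1 & E1 & F1).
      destruct (classic (In r t x)) as [i|i].
      + destruct (S t x (Inpos t x i)) as (_ & _ & _ & CP & _).
        destruct (CP (mkposreal e He)) as [e2 F2].
        exists (Rmin e1 e2). split. { apply Rmin_pos; [lra|apply cond_pos]. }
        intros s y Hs H1 H2. rmin e1 e2.
        destruct (wcase s y) as [->|[j ->]].
        * assert (V t x - e < V s y) by (apply F1; lra). specialize (wV t x). lra.
        * assert (Q : Rabs (P s y - P t x) < e) by (apply F2; lra). apply Rabs_def2 in Q.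
          specialize (wP t x i). lra.
      + exists (Rmin e1 (r / 2)). split. { apply Rmin_pos; lra. }
        intros s y Hs H1 H2. rmin e1 (r / 2).
        destruct (wcase s y) as [->|[j ->]].
        * assert (V t x - e < V s y) by (apply F1; lra). specialize (wV t x). lra.
        * exfalso. apply i. apply (Innear t x s y j); lra.
    - exists (Rmin (- M) (V t0 x0 - 1 - eta)). intros t x Ht.
      rmin (- M) (V t0 x0 - 1 - eta).
      destruct (wcase t x) as [->|[j ->]].
      + pose proof (perron_bounded K G HG G0 phi M t x HM Ht) as Q.
        apply Rabs_le_between in Q. fold V in Q. lra.
      + destruct j as [j1 j2]. assert (0 < psi t x + (1 - psi t0 x0)) by (apply Hbd; lra).
        pose proof (Rle_0_sqr (x - x0)) as Q3. pose proof (Rle_0_sqr (t - t0)) as Q4.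
        unfold Rsqr in Q3, Q4. apply Rmult_le_compat_l with (r := k) in Q3, Q4; try lra.
        unfold P. lra.
    - intros f gt gx gxx t x Hf Ht [e He].
      destruct (wcase t x) as [E|[j E]].
      + apply (SV f gt gx gxx t x Hf Ht). exists e. intros s y H1 H2.
        specialize (He s y H1 H2). specialize (wV s y). rewrite E in He. lra.
      + destruct (S t x Ht) as (B1 & _ & B3 & _).
        destruct (touch_past f gt gx gxx P (fun t x => ft t x + (0 + 2 * k * (t - t0)))
          (fun t x => fx t x + 2 * k * (x - x0)) (fun t x => fxx t x + 2 * k) t x Ht Hf B1) as [T1 T2].
        * intros y. now apply S.
        * exact B3.
        * assert (Q : 0 < Rmin e (r / 2)) by (apply Rmin_pos; [apply cond_pos|lra]).
          exists (mkposreal _ Q). simpl. intros s y H1 H2 _.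
          rmin e (r / 2).
          assert (In r s y).
          { apply (Innear s y t x j); rewrite Rabs_minus_sym; lra. }
          specialize (He s y ltac:(lra) ltac:(lra)). cbv beta in He. specialize (wP s y H3).
          lra.
        * apply Rle_trans with (G (fxx t x + 2 * k)). { now apply elliptic_mono with K. }
          assert (0 < (ft t x + (0 + 2 * k * (t - t0))) - G (fxx t x + 2 * k)).
          { destruct j. apply Hpos; lra. }
          cbv beta in T1. lra.
    - intros x. destruct (wcase 0 x) as [->|[j _]].
      + now apply (perron_initial_ge K G HG G0 phi M).
      + exfalso. apply (Rlt_irrefl 0), (Inpos 0 x). now apply Inhalf. }
  assert (Z : V t0 x0 <= w t0 x0).
  { apply (perron_le K G HG G0 phi M); trivial. lra. }
  assert (In r t0 x0).
  { split; unfold Rminus; rewrite Rplus_opp_r, Rabs_R0; lra. }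
  specialize (wP t0 x0 H). unfold P in wP. unfold Rminus in wP.
  rewrite !Rplus_opp_r in wP. lra.
Qed.

End PerronSolution.

(** * Averages *)

(** The one-sided Steklov average. Its derivative is the difference quotient [dq d f], so iterated
    averages of Lipschitz functions have explicit Lipschitz derivatives. *)
Definition avg (d : R) (f : R -> R) (x : R) : R := RInt (fun r => f (x + d * r)) 0 1.
Definition dq (d : R) (f : R -> R) (x : R) : R := (f (x + d) - f x) / d.
Definition lip (f : R -> R) : Prop := exists L, lipschitz L f.

Lemma lip_continuous f x : lip f -> continuous f x.
Proof.
  intros [L H]. apply continuity_pt_filterlim. now apply lipschitz_continuity_pt with L.
Qed.

Lemma lip_ex_RInt f a b : lip f -> ex_RInt f a b.
Proof. intros H. apply (ex_RInt_continuous f). intros; now apply lip_continuous. Qed.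

Lemma lip_comp f x d : lip f -> lip (fun r => f (x + d * r)).
Proof.
  intros [L H]. exists (L * Rabs d). intros u v.
  eapply Rle_trans; [apply H|].
  replace (x + d * u - (x + d * v)) with (d * (u - v)) by ring. rewrite Rabs_mult. lra.
Qed.

Lemma avg_le d f g x y c : lip f -> lip g ->
  (forall r, 0 <= r <= 1 -> f (x + d * r) <= g (y + d * r) + c) ->
  avg d f x <= avg d g y + c.
Proof.
  intros Hf Hg H. unfold avg.
  assert (E : RInt (fun r => g (y + d * r) + c) 0 1 = RInt (fun r => g (y + d * r)) 0 1 + c).
  { rewrite (RInt_plus (fun r => g (y + d * r)) (fun _ => c)).
    - rewrite RInt_const. unfold scal, plus; simpl; unfold mult; simpl. ring.
    - now apply lip_ex_RInt, lip_comp.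
    - apply ex_RInt_const. }
  rewrite <- E. apply RInt_le; try lra.
  - now apply lip_ex_RInt, lip_comp.
  - apply (ex_RInt_plus (fun r => g (y + d * r)) (fun _ => c)).
    + now apply lip_ex_RInt, lip_comp. + apply ex_RInt_const.
  - intros r Hr. apply H. lra.
Qed.

Lemma avg_diff d f g x y c : lip f -> lip g ->
  (forall r, 0 <= r <= 1 -> Rabs (f (x + d * r) - g (y + d * r)) <= c) ->
  Rabs (avg d f x - avg d g y) <= c.
Proof.
  intros Hf Hg H.
  assert (avg d f x <= avg d g y + c).
  { apply avg_le; trivial. intros r Hr. specialize (H r Hr). apply Rabs_le_between in H. lra. }
  assert (avg d g y <= avg d f x + c).
  { apply avg_le; trivial. intros r Hr. specialize (H r Hr). apply Rabs_le_between in H. lra. }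
  apply Rabs_le. lra.
Qed.

Lemma avg_lincomb d f g a b x : lip f -> lip g ->
  avg d (fun x => a * f x + b * g x) x = a * avg d f x + b * avg d g x.
Proof.
  intros Hf Hg. unfold avg.
  pose proof (lip_ex_RInt _ 0 1 (lip_comp f x d Hf)) as I1.
  pose proof (lip_ex_RInt _ 0 1 (lip_comp g x d Hg)) as I2.
  rewrite (RInt_plus (fun r => a * f (x + d * r)) (fun r => b * g (x + d * r))).
  - apply (f_equal2 Rplus); [exact (RInt_scal _ 0 1 a I1)|exact (RInt_scal _ 0 1 b I2)].
  - apply (ex_RInt_scal (fun r => f (x + d * r)) 0 1 a I1).
  - apply (ex_RInt_scal (fun r => g (x + d * r)) 0 1 b I2).
Qed.

Lemma lipschitz_const c : lipschitz 0 (fun _ => c).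
Proof. intros x y. unfold Rminus. rewrite Rplus_opp_r, Rabs_R0. lra. Qed.

Lemma avg_const d c x : avg d (fun _ => c) x = c.
Proof. unfold avg. rewrite RInt_const. unfold scal; simpl; unfold mult; simpl. ring. Qed.

Lemma lipschitz_avg d f L : lipschitz L f -> lipschitz L (avg d f).
Proof.
  intros H x y. apply avg_diff; try (now exists L). intros r _.
  specialize (H (x + d * r) (y + d * r)).
  now replace (x + d * r - (y + d * r)) with (x - y) in H by ring.
Qed.

Lemma lip_avg d f : lip f -> lip (avg d f).
Proof. intros [L H]. exists L. now apply lipschitz_avg. Qed.

Lemma avg_close d f L x : 0 <= d -> lipschitz L f -> Rabs (avg d f x - f x) <= L * d.
Proof.
  intros Hd H. pose proof (lipschitz_pos _ _ H) as HL.
  replace (f x) with (avg d (fun _ => f x) 0) by apply avg_const.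
  apply avg_diff. { now exists L. } { exists 0; apply lipschitz_const. }
  intros r Hr. eapply Rle_trans; [apply H|]. apply Rmult_le_compat_l; trivial.
  replace (x + d * r - x) with (d * r) by ring. rewrite Rabs_pos_eq; nra.
Qed.

Lemma bounded_avg d f M : lip f -> bounded_by M f -> bounded_by M (avg d f).
Proof.
  intros Hf HM x. rewrite <- (Rminus_0_r (avg d f x)).
  rewrite <- (avg_const d 0 0). apply avg_diff; trivial. { exists 0; apply lipschitz_const. }
  intros r _. rewrite Rminus_0_r. apply HM.
Qed.

Lemma primitive_quadratic f L a h : lipschitz L f ->
  Rabs (RInt f 0 (a + h) - RInt f 0 a - h * f a) <= L * (h * h).
Proof.
  intros H. assert (Hf : lip f) by now exists L.
  assert (E : RInt f 0 (a + h) - RInt f 0 a - h * f a = RInt (fun y => f y - f a) a (a + h)).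
  { rewrite (RInt_minus f (fun _ => f a)).
    - rewrite <- (RInt_Chasles f 0 a (a + h)) by now apply lip_ex_RInt.
      rewrite RInt_const. unfold scal, plus, minus, opp; simpl; unfold plus, opp, mult; simpl.
      unfold mult; simpl. ring.
    - now apply lip_ex_RInt.
    - apply ex_RInt_const. }
  rewrite E.
  assert (I : forall p q, ex_RInt (fun y => f y - f a) p q).
  { intros p q. apply lip_ex_RInt. exists L. intros x y.
    replace (f x - f a - (f y - f a)) with (f x - f y) by ring. apply H. }
  pose proof (lipschitz_pos _ _ H) as HL.
  destruct (Rle_dec 0 h) as [c|c].
  - eapply Rle_trans. { apply (abs_RInt_le_const _ a (a + h) (L * h)); trivial; [lra|].
      intros t Ht. eapply Rle_trans; [apply H|]. rewrite Rabs_pos_eq by lra.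
      apply Rmult_le_compat_l; lra. }
    right; ring.
  - rewrite <- opp_RInt_swap by apply I. unfold opp; simpl. rewrite Rabs_Ropp.
    eapply Rle_trans. { apply (abs_RInt_le_const _ (a + h) a (L * - h)); trivial; [lra|].
      intros t Ht. eapply Rle_trans; [apply H|]. rewrite Rabs_left1 by lra.
      apply Rmult_le_compat_l; lra. }
    right; ring.
Qed.

Lemma avg_primitive d f x : d <> 0 -> lip f ->
  avg d f x = (RInt f 0 (x + d) - RInt f 0 x) / d.
Proof.
  intros Hd Hf. unfold avg.
  pose proof (RInt_comp_lin f d x 0 1 (lip_ex_RInt _ _ _ Hf)) as E.
  assert (E1 : RInt (fun r => d * f (d * r + x)) 0 1 = d * RInt (fun r => f (x + d * r)) 0 1).
  { rewrite (RInt_ext _ (fun r => d * f (x + d * r))).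
    - exact (RInt_scal _ 0 1 d (lip_ex_RInt _ 0 1 (lip_comp f x d Hf))).
    - intros r _. now rewrite (Rplus_comm (d * r)). }
  change (RInt (fun r => d * f (d * r + x)) 0 1 = RInt f (d * 0 + x) (d * 1 + x)) in E.
  rewrite E1 in E.
  replace (d * 0 + x) with x in E by ring. replace (d * 1 + x) with (x + d) in E by ring.
  rewrite <- (RInt_Chasles f 0 x (x + d)) by now apply lip_ex_RInt.
  rewrite <- E. set (A := RInt f 0 x). set (B := RInt (fun r => f (x + d * r)) 0 1).
  change (B = (A + d * B - A) / d :> R). clearbody A B. simpl in A, B. field. exact Hd.
Qed.

(** The error is quadratic uniformly in [x], hence stable under averaging in the other variable;
    time derivatives of mollified functions are obtained this way, through [tquad]. *)
Lemma avg_quadratic d f L x h : 0 < d -> lipschitz L f ->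
  Rabs (avg d f (x + h) - avg d f x - h * dq d f x) <= 2 * L / d * (h * h).
Proof.
  intros Hd H. assert (Hf : lip f) by now exists L.
  rewrite !avg_primitive by (trivial; lra).
  pose proof (primitive_quadratic f L x h H) as A.
  pose proof (primitive_quadratic f L (x + d) h H) as B.
  replace (x + h + d) with (x + d + h) by ring. unfold dq.
  set (P := RInt f 0 (x + h) - RInt f 0 x - h * f x) in *.
  set (Q := RInt f 0 (x + d + h) - RInt f 0 (x + d) - h * f (x + d)) in *.
  replace (_ - _ - _) with ((Q - P) / d) by (unfold P, Q; field; lra).
  unfold Rdiv. rewrite Rabs_mult, (Rabs_pos_eq (/ d)).
  2:{ now apply Rinv_nonneg. }
  replace (2 * L * / d * (h * h)) with (2 * L * (h * h) * / d) by ring.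
  apply Rmult_le_compat_r. { now apply Rinv_nonneg. }
  apply Rabs_le_between in A, B. apply Rabs_le. lra.
Qed.

Lemma is_derive_quadratic (f : R -> R) (x l C : R) :
  (forall h, Rabs (f (x + h) - f x - h * l) <= C * (h * h)) -> is_derive f x l.
Proof.
  intros H. apply is_derive_eps. intros e He.
  exists (e / (Rabs C + 1)).
  assert (HC : 0 < Rabs C + 1) by (pose proof (Rabs_pos C); lra).
  split. { now apply Rdiv_lt_0_compat. }
  intros y Hy. specialize (H (y - x)). replace (x + (y - x)) with y in H by ring.
  rewrite (Rmult_comm l). eapply Rle_trans; [apply H|].
  replace ((y - x) * (y - x)) with (Rabs (y - x) * Rabs (y - x)).
  2:{ rewrite <- Rabs_mult. apply Rabs_pos_eq, Rle_0_sqr. }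
  rewrite <- Rmult_assoc. apply Rmult_le_compat_r; [apply Rabs_pos|].
  apply Rle_trans with ((Rabs C + 1) * (e / (Rabs C + 1))).
  - apply Rle_trans with ((Rabs C + 1) * Rabs (y - x)).
    + apply Rmult_le_compat_r; [apply Rabs_pos|]. pose proof (Rle_abs C). lra.
    + apply Rmult_le_compat_l; lra.
  - right. field. lra.
Qed.

Lemma is_derive_avg d f (x : R) : 0 < d -> lip f -> is_derive (avg d f) x (dq d f x).
Proof.
  intros Hd [L H]. apply is_derive_quadratic with (2 * L / d). intros h.
  now apply avg_quadratic.
Qed.

Lemma is_derive_shift (f : R -> R) (c x l : R) : is_derive f (x + c) l ->
  is_derive (fun x => f (x + c)) x l.
Proof.
  intros H. replace l with (scal 1 l) by (unfold scal; simpl; unfold mult; simpl; ring).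
  apply (is_derive_comp f (fun x => x + c)); trivial. auto_derive; [exact I|req].
Qed.

Lemma is_derive_shift_r (f : R -> R) (c x l : R) : is_derive f (c + x) l ->
  is_derive (fun x => f (c + x)) x l.
Proof.
  intros H. apply (is_derive_ext (fun x => f (x + c))).
  - intros y. f_equal. ring.
  - apply is_derive_shift. now rewrite Rplus_comm.
Qed.

Lemma is_derive_reflect (f : R -> R) (c x l : R) : is_derive f (c - x) l ->
  is_derive (fun x => f (c - x)) x (- l).
Proof.
  intros H. replace (- l) with (scal (-1) l) by (unfold scal; simpl; unfold mult; simpl; ring).
  apply (is_derive_comp f (fun x => c - x)); trivial. auto_derive; [exact I|req].
Qed.

Lemma is_derive_dq d f f1 : (forall x : R, is_derive f x (f1 x)) ->
  forall x : R, is_derive (dq d f) x (dq d f1 x).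
Proof.
  intros H x. unfold dq, Rdiv.
  apply (is_derive_ext (fun x => / d * (f (x + d) - f x))). { intros; req. }
  replace ((f1 (x + d) - f1 x) * / d) with (/ d * (f1 (x + d) - f1 x)) by ring.
  apply (is_derive_scal (fun x => f (x + d) - f x)).
  apply (is_derive_minus (fun x => f (x + d)) f); trivial.
  apply (is_derive_shift f d x); trivial.
Qed.

Lemma lip_dq d f : lip f -> lip (dq d f).
Proof.
  intros [L H]. exists (2 * L * Rabs (/ d)). intros x y. unfold dq, Rdiv.
  replace ((f (x + d) - f x) * / d - (f (y + d) - f y) * / d)
    with (((f (x + d) - f (y + d)) - (f x - f y)) * / d) by ring.
  rewrite Rabs_mult.
  replace (2 * L * Rabs (/ d) * Rabs (x - y)) with (2 * L * Rabs (x - y) * Rabs (/ d)) by ring.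
  apply Rmult_le_compat_r; [apply Rabs_pos|].
  pose proof (H x y) as A. pose proof (H (x + d) (y + d)) as B.
  replace (x + d - (y + d)) with (x - y) in B by ring.
  apply Rabs_le_between in A, B. apply Rabs_le. lra.
Qed.

Lemma bounded_dq d f M : 0 < d -> bounded_by M f -> bounded_by (2 * M / d) (dq d f).
Proof.
  intros Hd H x. unfold dq, Rdiv. rewrite Rabs_mult, (Rabs_pos_eq (/ d)).
  2:{ now apply Rinv_nonneg. }
  apply Rmult_le_compat_r. { now apply Rinv_nonneg. }
  pose proof (H x) as A. pose proof (H (x + d)) as B.
  apply Rabs_le_between in A, B. apply Rabs_le. lra.
Qed.

(** The symmetric average is expanded to fourth order; odd derivatives cancel, so [f2] is the only
    derivative that appears in the expansion and the only one exposed. *)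
Definition C4b (f f2 : R -> R) (K : R) : Prop := exists f1 f3 f4 : R -> R,
  (forall x : R, is_derive f x (f1 x)) /\ (forall x : R, is_derive f1 x (f2 x)) /\
  (forall x : R, is_derive f2 x (f3 x)) /\ (forall x : R, is_derive f3 x (f4 x)) /\
  (forall x, continuity_pt f4 x) /\ bounded_by K f2 /\ bounded_by K f4.

(** [K] is fixed before [f], so that one constant serves all time slices of a function. *)
Lemma avg4_C4b d M : 0 < d -> exists K, forall f, lip f -> bounded_by M f ->
  C4b (avg d (avg d (avg d (avg d f)))) (dq d (dq d (avg d (avg d f)))) K.
Proof.
  intros Hd. set (K2 := 2 * (2 * M / d) / d). set (K4 := 2 * (2 * K2 / d) / d).
  exists (Rmax K2 K4). intros f Hf HM.
  exists (dq d (avg d (avg d (avg d f)))), (dq d (dq d (dq d (avg d f)))),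
    (dq d (dq d (dq d (dq d f)))).
  pose proof (lip_avg d f Hf) as A1. pose proof (lip_avg d _ A1) as A2.
  pose proof (lip_avg d _ A2) as A3.
  refine (conj _ (conj _ (conj _ (conj _ (conj _ (conj _ _)))))).
  - intros x. now apply is_derive_avg.
  - apply is_derive_dq. intros x. now apply is_derive_avg.
  - apply is_derive_dq, is_derive_dq. intros x. now apply is_derive_avg.
  - apply is_derive_dq, is_derive_dq, is_derive_dq. intros x. now apply is_derive_avg.
  - intros x. apply continuity_pt_filterlim. apply lip_continuous. now do 4 apply lip_dq.
  - intros x. eapply Rle_trans; [|apply Rmax_l].
    apply bounded_dq; trivial. apply bounded_dq; trivial. now do 2 (apply bounded_avg; trivial).
  - intros x. eapply Rle_trans; [|apply Rmax_r]. now do 4 (apply bounded_dq; trivial).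
Qed.

Lemma avg4_close d f L x : 0 <= d -> lipschitz L f ->
  Rabs (avg d (avg d (avg d (avg d f))) x - f x) <= 4 * L * d.
Proof.
  intros Hd H.
  pose proof (lipschitz_avg d f L H) as A1. pose proof (lipschitz_avg d _ L A1) as A2.
  pose proof (lipschitz_avg d _ L A2) as A3.
  pose proof (avg_close d _ L x Hd H) as C0. pose proof (avg_close d _ L x Hd A1) as C1.
  pose proof (avg_close d _ L x Hd A2) as C2. pose proof (avg_close d _ L x Hd A3) as C3.
  apply Rabs_le_between in C0, C1, C2, C3. apply Rabs_le. lra.
Qed.

Lemma avg2_C2b d f M : 0 < d -> lip f -> bounded_by M f ->
  C2b (avg d (avg d f)) (dq d (avg d f)) (dq d (dq d f)) (2 * (2 * M / d) / d) /\
  bounded_by M (avg d (avg d f)).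
Proof.
  intros Hd Hf HM. pose proof (lip_avg d f Hf) as Hf1. split; [split; [|split; [|split]]|].
  - intros x. now apply is_derive_avg.
  - apply is_derive_dq. intros x. now apply is_derive_avg.
  - intros x. apply continuity_pt_filterlim, lip_continuous. now do 2 apply lip_dq.
  - now do 2 (apply bounded_dq; trivial).
  - apply bounded_avg; trivial. now apply bounded_avg.
Qed.

Lemma avg2_close d f L x : 0 <= d -> lipschitz L f ->
  Rabs (avg d (avg d f) x - f x) <= 2 * L * d.
Proof.
  intros Hd HL. pose proof (avg_close d _ L x Hd HL) as C0.
  pose proof (avg_close d _ L x Hd (lipschitz_avg d _ L HL)) as C1.
  apply Rabs_le_between in C0, C1. apply Rabs_le. lra.
Qed.

Lemma approx_C2_lip phi M L : bounded_by M phi -> lipschitz L phi -> approx_C2 phi.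
Proof.
  intros HM HL e He. pose proof (lipschitz_pos _ _ HL) as L0.
  set (d := e / (2 * L + 1)).
  assert (Hd : 0 < d) by (apply Rdiv_lt_0_compat; lra).
  assert (Hf : lip phi) by now exists L.
  destruct (avg2_C2b d phi M Hd Hf HM) as [A B].
  exists (avg d (avg d phi)), (dq d (avg d phi)), (dq d (dq d phi)), (2 * (2 * M / d) / d), M.
  refine (conj A (conj B _)). intros x. rewrite Rabs_minus_sym.
  eapply Rle_trans; [apply avg2_close with (L := L); trivial; lra|].
  assert (E : d * (2 * L + 1) = e) by (unfold d; field; lra). nra.
Qed.

(** * Steps of the symmetric random walk and their Taylor expansion *)

Definition symavg (d : R) (f : R -> R) (x : R) : R := (f (x + d) + f (x - d)) / 2.

Fixpoint symiter (n : nat) (d : R) (f : R -> R) : R -> R :=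
  match n with O => f | S n => symiter n d (symavg d f) end.

Lemma symiter_le n d f g c : (forall x, f x <= g x + c) ->
  forall x, symiter n d f x <= symiter n d g x + c.
Proof.
  revert f g. induction n as [|n IH]; intros f g H; simpl; trivial.
  apply IH. intros x. unfold symavg. pose proof (H (x + d)). pose proof (H (x - d)). lra.
Qed.

Lemma nonneg_of_derive (f f1 : R -> R) d : 0 <= d ->
  (forall x : R, is_derive f x (f1 x)) -> f 0 = 0 ->
  (forall x, 0 <= x -> 0 <= f1 x) -> 0 <= f d.
Proof.
  intros Hd H H0 H1. destruct (Rle_lt_or_eq_dec _ _ Hd) as [c|<-]; [|lra].
  destruct (MVT_cor2 f f1 0 d c) as (z & E & Hz).
  { intros z _. apply is_derive_Reals, H. }
  specialize (H1 z ltac:(lra)). rewrite H0 in E. nra.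
Qed.

Lemma is_derive_even (f f1 : R -> R) x : (forall y : R, is_derive f y (f1 y)) ->
  forall s : R, is_derive (fun s => f (x + s) + f (x - s)) s (f1 (x + s) - f1 (x - s)).
Proof.
  intros H s. apply (is_derive_plus (fun s => f (x + s)) (fun s => f (x - s)) s (f1 (x + s)) (- f1 (x - s))).
  - apply (is_derive_shift_r f x s); trivial.
  - apply (is_derive_reflect f x s); trivial.
Qed.

Lemma is_derive_odd (f f1 : R -> R) x : (forall y : R, is_derive f y (f1 y)) ->
  forall s : R, is_derive (fun s => f (x + s) - f (x - s)) s (f1 (x + s) + f1 (x - s)).
Proof.
  intros H s.
  replace (f1 (x + s) + f1 (x - s)) with (minus (f1 (x + s)) (- f1 (x - s)))
    by (unfold minus, plus, opp; simpl; ring).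
  apply (is_derive_minus (fun s => f (x + s)) (fun s => f (x - s)) s (f1 (x + s)) (- f1 (x - s))).
  - apply (is_derive_shift_r f x s); trivial.
  - apply (is_derive_reflect f x s); trivial.
Qed.

Lemma is_derive_sub_poly (f : R -> R) (s l : R) (p : R -> R) (p' : R) :
  is_derive f s l -> is_derive p s p' -> is_derive (fun s => p s + f s) s (p' + l).
Proof. intros H1 H2. now apply (is_derive_plus p f). Qed.

Lemma C4b_opp f f2 K : C4b f f2 K -> C4b (fun x => - f x) (fun x => - f2 x) K.
Proof.
  intros (f1 & f3 & f4 & H1 & H2 & H3 & H4 & H5 & H6 & H7).
  exists (fun x => - f1 x), (fun x => - f3 x), (fun x => - f4 x).
  refine (conj _ (conj _ (conj _ (conj _ (conj _ (conj _ _)))))); intros x.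
  - now apply (is_derive_opp f).
  - now apply (is_derive_opp f1).
  - now apply (is_derive_opp f2).
  - now apply (is_derive_opp f3).
  - now apply continuity_pt_opp.
  - rewrite Rabs_Ropp. apply H6.
  - rewrite Rabs_Ropp. apply H7.
Qed.

(** The bound [f4 <= K] is integrated four times from the centre: [P3], [P2], [P1] and [P0] each
    concern a function that vanishes at 0 and whose derivative is nonnegative by the preceding
    bound. *)
Lemma symavg_taylor_le f f2 K d x : 0 <= d -> C4b f f2 K ->
  symavg d f x <= f x + d * d / 2 * f2 x + K * (d * d * d * d) / 24 /\
  symavg d f2 x <= f2 x + K * (d * d) / 2.
Proof.
  intros Hd (f1 & f3 & f4 & H1 & H2 & H3 & H4 & _ & _ & H7).
  assert (B : forall y, f4 y <= K).
  { intros y. specialize (H7 y). apply Rabs_le_between in H7. lra. }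
  assert (P3 : forall s, 0 <= s -> 0 <= 2 * K * s + - (f3 (x + s) - f3 (x - s))).
  { intros s Hs.
    apply (nonneg_of_derive (fun s => 2 * K * s + - (f3 (x + s) - f3 (x - s)))
      (fun s => 2 * K + - (f4 (x + s) + f4 (x - s)))); trivial.
    - intros z. apply is_derive_sub_poly.
      + apply (is_derive_opp (fun s => f3 (x + s) - f3 (x - s))). now apply is_derive_odd.
      + auto_derive; [exact I|req].
    - rewrite Rplus_0_r, Rminus_0_r. ring.
    - intros z _. pose proof (B (x + z)). pose proof (B (x - z)). lra. }
  assert (P2 : forall s, 0 <= s -> 0 <= 2 * f2 x + K * s * s + - (f2 (x + s) + f2 (x - s))).
  { intros s Hs.
    apply (nonneg_of_derive (fun s => 2 * f2 x + K * s * s + - (f2 (x + s) + f2 (x - s)))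
      (fun s => 2 * K * s + - (f3 (x + s) - f3 (x - s)))); trivial.
    - intros z. apply is_derive_sub_poly.
      + apply (is_derive_opp (fun s => f2 (x + s) + f2 (x - s))). now apply is_derive_even.
      + auto_derive; [exact I|req].
    - rewrite Rplus_0_r, Rminus_0_r. ring. }
  assert (P1 : forall s, 0 <= s -> 0 <= 2 * f2 x * s + K * s * s * s / 3 + - (f1 (x + s) - f1 (x - s))).
  { intros s Hs.
    apply (nonneg_of_derive (fun s => 2 * f2 x * s + K * s * s * s / 3 + - (f1 (x + s) - f1 (x - s)))
      (fun s => 2 * f2 x + K * s * s + - (f2 (x + s) + f2 (x - s)))); trivial.
    - intros z. apply is_derive_sub_poly.
      + apply (is_derive_opp (fun s => f1 (x + s) - f1 (x - s))). now apply is_derive_odd.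
      + auto_derive; [exact I|]. real_eq. field.
    - rewrite Rplus_0_r, Rminus_0_r. field. }
  assert (P0 : 0 <= 2 * f x + f2 x * d * d + K * d * d * d * d / 12 + - (f (x + d) + f (x - d))).
  { apply (nonneg_of_derive (fun s => 2 * f x + f2 x * s * s + K * s * s * s * s / 12 + - (f (x + s) + f (x - s)))
      (fun s => 2 * f2 x * s + K * s * s * s / 3 + - (f1 (x + s) - f1 (x - s)))); trivial.
    - intros z. apply is_derive_sub_poly.
      + apply (is_derive_opp (fun s => f (x + s) + f (x - s))). now apply is_derive_even.
      + auto_derive; [exact I|]. real_eq. field.
    - rewrite Rplus_0_r, Rminus_0_r. field. }
  specialize (P2 d Hd). unfold symavg. split; lra.
Qed.

Lemma symavg_taylor_ge f f2 K d x : 0 <= d -> C4b f f2 K ->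
  f x + d * d / 2 * f2 x - K * (d * d * d * d) / 24 <= symavg d f x /\
  f2 x - K * (d * d) / 2 <= symavg d f2 x.
Proof.
  intros Hd H. destruct (symavg_taylor_le _ _ K d x Hd (C4b_opp _ _ _ H)) as [A B].
  unfold symavg in *. split; lra.
Qed.

Lemma C4b_symavg d f f2 K : C4b f f2 K -> C4b (symavg d f) (symavg d f2) K.
Proof.
  intros (f1 & f3 & f4 & H1 & H2 & H3 & H4 & H5 & H6 & H7).
  exists (symavg d f1), (symavg d f3), (symavg d f4).
  assert (D : forall g g1 : R -> R, (forall x : R, is_derive g x (g1 x)) ->
    forall x : R, is_derive (symavg d g) x (symavg d g1 x)).
  { intros g g1 Hg x. unfold symavg.
    apply (is_derive_ext (fun x => / 2 * (g (x + d) + g (x - d)))). { intros; simpl. field. }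
    replace ((g1 (x + d) + g1 (x - d)) / 2) with (/ 2 * (g1 (x + d) + g1 (x - d))) by field.
    apply (is_derive_scal (fun x => g (x + d) + g (x - d))).
    apply (is_derive_plus (fun x => g (x + d)) (fun x => g (x - d))).
    - apply (is_derive_shift g d x); trivial.
    - apply (is_derive_shift g (- d) x); trivial. }
  assert (B : forall g, bounded_by K g -> bounded_by K (symavg d g)).
  { intros g Hg x. pose proof (Hg (x + d)) as P. pose proof (Hg (x - d)) as Q.
    apply Rabs_le_between in P, Q. unfold symavg. apply Rabs_le. lra. }
  refine (conj (D _ _ H1) (conj (D _ _ H2) (conj (D _ _ H3) (conj (D _ _ H4)
    (conj _ (conj (B _ H6) (B _ H7))))))).
  intros x. unfold symavg.
  apply (continuity_pt_mult (fun x => f4 (x + d) + f4 (x - d)) (fun _ => / 2)).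
  - apply (continuity_pt_plus (fun x => f4 (x + d)) (fun x => f4 (x - d))).
    + apply (continuity_pt_comp (fun x => x + d) f4); trivial.
      apply lipschitz_continuity_pt with 1. intros u v.
      replace (u + d - (v + d)) with (u - v) by ring. lra.
    + apply (continuity_pt_comp (fun x => x - d) f4); trivial.
      apply lipschitz_continuity_pt with 1. intros u v.
      replace (u - d - (v - d)) with (u - v) by ring. lra.
  - apply continuity_pt_const. now intros ? ?.
Qed.

(** [INR n * (d * d / 2)] is half the variance of the walk. The error is quadratic in it whatever
    the number of steps, so it is negligible against the drift term as the variance tends to 0. *)
Lemma symiter_ge n d f f2 K x : 0 <= d -> C4b f f2 K ->
  f x + INR n * (d * d / 2) * f2 x - K * (INR n * (d * d / 2)) * (INR n * (d * d / 2))
    <= symiter n d f x.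
Proof.
  intros Hd. revert f f2 x. induction n as [|n IH]; intros f f2 x H.
  - simpl. lra.
  - assert (HK : 0 <= K).
    { destruct H as (f1 & f3 & f4 & _ & _ & _ & _ & _ & H6 & _).
      eapply Rle_trans; [apply Rabs_pos|]. apply (H6 0). }
    rewrite S_INR. simpl symiter.
    specialize (IH _ _ x (C4b_symavg d _ _ _ H)).
    destruct (symavg_taylor_ge f f2 K d x Hd H) as [A B].
    eapply Rle_trans; [|apply IH].
    pose proof (pos_INR n) as Hn.
    set (q := d * d / 2) in *.
    assert (Hq : 0 <= q) by (unfold q; pose proof (Rle_0_sqr d) as Q; unfold Rsqr in Q; lra).
    replace (K * (d * d * d * d) / 24) with (K * (q * q) / 6) in A by (unfold q; field).
    replace (K * (d * d) / 2) with (K * q) in B by (unfold q; field).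
    assert (B' : INR n * q * (f2 x - K * q) <= INR n * q * symavg d f2 x).
    { apply Rmult_le_compat_l; trivial. now apply Rmult_le_pos. }
    assert (0 <= K * (q * q)) by (apply Rmult_le_pos; trivial; now apply Rmult_le_pos).
    assert (0 <= INR n * (K * (q * q))) by now apply Rmult_le_pos.
    lra.
Qed.

(** * Supersolutions of the heat equation and mollification *)

Lemma G_fun_pos sl su a : 0 <= a -> G_fun sl su a = su ^ 2 * a / 2.
Proof.
  intros H. unfold G_fun, pos_part, neg_part. rewrite Rmax_left, Rmax_right by lra. field.
Qed.

Lemma G_fun_neg sl su a : a <= 0 -> G_fun sl su a = sl ^ 2 * a / 2.
Proof.
  intros H. unfold G_fun, pos_part, neg_part. rewrite Rmax_right, Rmax_left by lra. field.
Qed.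

Lemma G_fun_0 sl su : G_fun sl su 0 = 0.
Proof. rewrite G_fun_pos; lra. Qed.

Lemma sq_le a b : 0 <= a <= b -> a ^ 2 <= b ^ 2.
Proof. intros H. apply pow_incr. exact H. Qed.

Lemma elliptic_G_fun sl su : 0 <= sl <= su -> elliptic (su ^ 2 / 2) (G_fun sl su).
Proof.
  intros H. pose proof (sq_le _ _ H). pose proof (pow2_ge_0 sl). split; [lra|].
  intros a c Hc. destruct (Rle_dec 0 a) as [p|p].
  - rewrite !G_fun_pos by lra. nra.
  - rewrite (G_fun_neg sl su a) by lra. destruct (Rle_dec 0 (a + c)) as [q|q].
    + rewrite G_fun_pos by lra. nra.
    + rewrite G_fun_neg by lra. nra.
Qed.

Lemma G_fun_le sl su sl' su' a : 0 <= sl <= sl' -> 0 <= su' <= su ->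
  G_fun sl' su' a <= G_fun sl su a.
Proof.
  intros H1 H2. pose proof (sq_le _ _ H1). pose proof (sq_le _ _ H2).
  destruct (Rle_dec 0 a).
  - rewrite !G_fun_pos by lra. nra.
  - rewrite !G_fun_neg by lra. nra.
Qed.

Lemma super_weaken G G' v : (forall a, G' a <= G a) -> super G v -> super G' v.
Proof.
  intros H Hv psi ft fx fxx t x Hs Ht Hl. eapply Rle_trans; [apply H|].
  now apply (Hv psi ft fx fxx).
Qed.

Lemma lsc_shift v s c : 0 <= s -> lsc v -> lsc (fun t x => v (t + s) x + c).
Proof.
  intros Hs Lv u y e Hu He. destruct (Lv (u + s) y e) as (d & Hd & Hd'); try lra.
  exists d. split; trivial. intros w z Hw H1 H2. specialize (Hd' (w + s) z).
  replace (w + s - (u + s)) with (w - u) in Hd' by ring.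
  assert (v (u + s) y - e < v (w + s) z) by (apply Hd'; lra). lra.
Qed.

Lemma super_shift_time G v s c : 0 <= s -> super G v -> super G (fun t x => v (t + s) x + c).
Proof.
  intros Hs Hv. pose proof (super_shift G v s 0 c Hs Hv) as S.
  replace (fun t x => v (t + s) x + c) with (fun t x => v (t + s) (x + 0) + c); trivial.
  fun_ext2 u y.
  now rewrite Rplus_0_r.
Qed.

Lemma continuity_pt_derive (f : R -> R) x l : is_derive f x l -> continuity_pt f x.
Proof.
  intros H. apply continuity_pt_filterlim.
  apply (ex_derive_continuous (K := R_AbsRing) (V := R_NormedModule)). now exists l.
Qed.

(** With [a = s ^ 2 / 2], the function [f x + t * (a * f2 x) - a * a * K / 2 * (t * t)] is a
    classical subsolution because [f4 >= - K]. At time [h] it agrees up to order [h * h] with a walk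
    step of length [s * sqrt h]. *)
Lemma heat_one_step s v m f f2 K M h x : 0 <= s -> lsc v -> super (G_fun s s) v ->
  (forall t x, 0 <= t -> m <= v t x) -> C4b f f2 K -> bounded_by M f ->
  (forall x, f x <= v 0 x) -> 0 <= h ->
  symavg (s * sqrt h) f x - K * s ^ 4 * (h * h) <= v h x.
Proof.
  intros Hs Lv Sv Hm Hf HM H0 Hh.
  pose proof Hf as (f1 & f3 & f4 & H1 & H2 & H3 & H4 & H5 & H6 & H7).
  assert (HK : 0 <= K). { eapply Rle_trans; [apply Rabs_pos|]. apply (H6 0). }
  set (a := s ^ 2 / 2).
  assert (Ha : 0 <= a) by (unfold a; pose proof (pow2_ge_0 s); lra).
  assert (Glin : forall b, G_fun s s b = a * b).
  { intros b. unfold a. destruct (Rle_dec 0 b).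
    - rewrite G_fun_pos by lra. field. - rewrite G_fun_neg by lra. field. }
  assert (Sb : smooth (fun t x => f x + t * (a * f2 x) - a * a * K / 2 * (t * t))
    (fun t x => a * f2 x - a * a * K * t) (fun t x => f1 x + t * (a * f3 x))
    (fun t x => f2 x + t * (a * f4 x))).
  { intros t y Ht.
    pose proof (fun g => continuity_2d_snd g t y) as D.
    pose proof (D f (continuity_pt_derive _ _ _ (H1 y))) as D0.
    pose proof (D f1 (continuity_pt_derive _ _ _ (H2 y))) as D1.
    pose proof (D f2 (continuity_pt_derive _ _ _ (H3 y))) as D2.
    pose proof (D f3 (continuity_pt_derive _ _ _ (H4 y))) as D3.
    pose proof (D f4 (H5 y)) as D4.
    assert (DX : forall g g1 k k1 : R -> R, is_derive g y (g1 y) -> is_derive k y (k1 y) ->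
      is_derive (fun y => g y + t * (a * k y)) y (g1 y + t * (a * k1 y))).
    { intros g g1 k k1 Hg Hk. apply (is_derive_plus g (fun y => t * (a * k y))); trivial.
      apply (is_derive_scal (fun y => a * k y)). now apply (is_derive_scal k). }
    split7; try (cont2; assumption).
    - auto_derive; [exact I|].
      real_eq. field.
    - rewrite <- (Rminus_0_r (f1 y + t * (a * f3 y))).
      apply (is_derive_minus (fun y => f y + t * (a * f2 y)) (fun _ => a * a * K / 2 * (t * t))).
      + now apply DX. + apply (is_derive_const (V := R_NormedModule)).
    - now apply DX. }
  assert (V : f x + h * (a * f2 x) - a * a * K / 2 * (h * h) <= v h x).
  { apply (super_ge_smooth (G_fun s s) (s ^ 2 / 2) v _ _ _ _ (M + K / 2 - m)
      (elliptic_G_fun s s (conj Hs (Rle_refl s))) Lv Sv Sb); trivial.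
    - apply lsc_continuity_2d. intros t y _.
      pose proof (fun g => continuity_2d_snd g t y) as D.
      pose proof (D f (continuity_pt_derive _ _ _ (H1 y))) as D0.
      pose proof (D f2 (continuity_pt_derive _ _ _ (H3 y))) as D2.
      cont2; assumption.
    - intros t y Ht. rewrite Glin. specialize (H7 y). apply Rabs_le_between in H7.
      assert (0 <= a * (t * (a * (f4 y + K)))).
      { apply Rmult_le_pos; trivial. apply Rmult_le_pos; [lra|]. apply Rmult_le_pos; lra. }
      lra.
    - intros y. specialize (H0 y). lra.
    - intros t y Ht. specialize (Hm t y Ht). specialize (HM y). specialize (H6 y).
      apply Rabs_le_between in HM, H6.
      assert (t * (a * f2 y) <= t * (a * K)).
      { apply Rmult_le_compat_l; trivial. apply Rmult_le_compat_l; lra. }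
      pose proof (Rle_0_sqr (a * t - 1)) as Q. unfold Rsqr in Q.
      apply Rmult_le_compat_l with (r := K / 2) in Q; lra. }
  assert (Hd : 0 <= s * sqrt h) by (apply Rmult_le_pos; trivial; apply sqrt_pos).
  destruct (symavg_taylor_le f f2 K _ x Hd Hf) as [T _].
  assert (Q : s * sqrt h * (s * sqrt h) = 2 * a * h).
  { replace (s * sqrt h * (s * sqrt h)) with (s * s * (sqrt h * sqrt h)) by ring.
    rewrite sqrt_sqrt by trivial. unfold a. field. }
  replace (s * sqrt h * (s * sqrt h) * (s * sqrt h) * (s * sqrt h))
    with ((s * sqrt h * (s * sqrt h)) * (s * sqrt h * (s * sqrt h))) in T by ring.
  rewrite Q in T. replace (s ^ 4) with (4 * (a * a)) by (unfold a; field).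
  assert (0 <= K * (a * a * (h * h))).
  { apply Rmult_le_pos; trivial. apply Rmult_le_pos; now apply Rmult_le_pos. }
  lra.
Qed.

Lemma bounded_symavg d f M : bounded_by M f -> bounded_by M (symavg d f).
Proof.
  intros H x. pose proof (H (x + d)) as P. pose proof (H (x - d)) as Q.
  apply Rabs_le_between in P, Q. unfold symavg. apply Rabs_le. lra.
Qed.

(** The induction restarts the clock: [v (t + h) x + c] is again a supersolution and dominates one
    walk step at time 0. Each step costs [c], of order [h * h], so [n] steps with [n * h] fixed cost
    only order [h]. *)
Lemma heat_many_steps n s h K : 0 <= s -> 0 <= h ->
  forall v m f f2 M x, lsc v -> super (G_fun s s) v ->
  (forall t x, 0 <= t -> m <= v t x) -> C4b f f2 K -> bounded_by M f ->
  (forall x, f x <= v 0 x) ->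
  symiter n (s * sqrt h) f x - INR n * (K * s ^ 4 * (h * h)) <= v (INR n * h) x.
Proof.
  intros Hs Hh. induction n as [|n IH]; intros v m f f2 M x Lv Sv Hm Hf HM H0.
  - simpl. rewrite !Rmult_0_l, Rminus_0_r. apply H0.
  - set (c := K * s ^ 4 * (h * h)) in *.
    assert (S : forall y, symavg (s * sqrt h) f y <= v (0 + h) y + c).
    { intros y. pose proof (heat_one_step s v m f f2 K M h y Hs Lv Sv Hm Hf HM H0 Hh).
      rewrite Rplus_0_l. unfold c. lra. }
    pose proof (IH (fun t x => v (t + h) x + c) (m + c) (symavg (s * sqrt h) f)
      (symavg (s * sqrt h) f2) M x (lsc_shift v h c Hh Lv) (super_shift_time _ v h c Hh Sv)) as Q.
    simpl symiter. rewrite S_INR.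
    replace ((INR n + 1) * h) with (INR n * h + h) by ring.
    enough (symiter n (s * sqrt h) (symavg (s * sqrt h) f) x - INR n * c <= v (INR n * h + h) x + c)
      by lra.
    apply Q; trivial.
    + intros t y Ht. assert (m <= v (t + h) y) by (apply Hm; lra). lra.
    + now apply C4b_symavg.
    + now apply bounded_symavg.
Qed.

(** * Averaging operators on Lipschitz functions of time and space *)

Definition Lip2 (C : R) (v : R -> R -> R) : Prop := forall t s x y,
  Rabs (v t x - v s y) <= C * (Rabs (t - s) + Rabs (x - y)).

Lemma Lip2_x C v t : Lip2 C v -> lipschitz C (v t).
Proof.
  intros H x y. specialize (H t t x y). unfold Rminus at 2 in H.
  rewrite Rplus_opp_r, Rabs_R0, Rplus_0_l in H. exact H.
Qed.

Lemma Lip2_t C v x : Lip2 C v -> lipschitz C (fun t => v t x).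
Proof.
  intros H t s. specialize (H t s x x). unfold Rminus at 3 in H.
  rewrite Rplus_opp_r, Rabs_R0, Rplus_0_r in H. exact H.
Qed.

Lemma Lip2_continuity C v t x : Lip2 C v -> continuity_2d_pt v t x.
Proof.
  intros H e. pose proof (lipschitz_pos _ _ (Lip2_x C v 0 H)) as HC.
  assert (P : 0 < e / (2 * (C + 1))) by (apply Rdiv_lt_0_compat; [apply cond_pos|lra]).
  exists (mkposreal _ P). simpl. intros s y H1 H2.
  eapply Rle_lt_trans; [apply H|].
  apply Rle_lt_trans with ((C + 1) * (Rabs (s - t) + Rabs (y - x))).
  - apply Rmult_le_compat_r; [|lra]. pose proof (Rabs_pos (s - t)). pose proof (Rabs_pos (y - x)). lra.
  - apply Rlt_le_trans with ((C + 1) * (e / (2 * (C + 1)) + e / (2 * (C + 1)))).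
    + apply Rmult_lt_compat_l; lra. + right. field. lra.
Qed.

Lemma Lip2_lsc C v : Lip2 C v -> lsc v.
Proof. intros H. apply lsc_continuity_2d. intros. now apply Lip2_continuity with C. Qed.

Definition xavg (d : R) (v : R -> R -> R) (t x : R) : R := avg d (v t) x.
Definition tavg (d : R) (v : R -> R -> R) (t x : R) : R := avg d (fun s => v s x) t.
Definition symavg2 (d : R) (v : R -> R -> R) (t x : R) : R := symavg d (v t) x.

Fixpoint symiter2 (n : nat) (d : R) (v : R -> R -> R) : R -> R -> R :=
  match n with O => v | S n => symiter2 n d (symavg2 d v) end.

Lemma symiter2_E n d v t : symiter2 n d v t = symiter n d (v t).
Proof.
  revert v. induction n as [|n IH]; intros v; simpl; [reflexivity|apply IH].
Qed.

Lemma Lip2_xavg C d v : Lip2 C v -> Lip2 C (xavg d v).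
Proof.
  intros H t s x y. unfold xavg. apply avg_diff.
  - exists C. now apply Lip2_x.
  - exists C. now apply Lip2_x.
  - intros r _. eapply Rle_trans; [apply H|].
    replace (x + d * r - (y + d * r)) with (x - y) by ring. lra.
Qed.

Lemma Lip2_tavg C d v : Lip2 C v -> Lip2 C (tavg d v).
Proof.
  intros H t s x y. unfold tavg.
  apply (avg_diff d (fun s => v s x) (fun s => v s y)).
  - exists C. now apply Lip2_t.
  - exists C. now apply Lip2_t.
  - intros r _. eapply Rle_trans; [apply H|].
    replace (t + d * r - (s + d * r)) with (t - s) by ring. lra.
Qed.

Lemma Lip2_symavg2 C d v : Lip2 C v -> Lip2 C (symavg2 d v).
Proof.
  intros H t s x y. unfold symavg2, symavg.
  pose proof (H t s (x + d) (y + d)) as A. pose proof (H t s (x - d) (y - d)) as B.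
  replace (x + d - (y + d)) with (x - y) in A by ring.
  replace (x - d - (y - d)) with (x - y) in B by ring.
  apply Rabs_le_between in A, B. apply Rabs_le. lra.
Qed.

(** The properties of an average that transport [dominates_heat]. The monotonicity clause looks only
    at nonnegative times, which is why averages in time are taken forward. *)
Definition averaging (X : (R -> R -> R) -> R -> R -> R) : Prop :=
  (forall C v, Lip2 C v -> Lip2 C (X v)) /\
  (forall C v d, Lip2 C v -> X (symavg2 d v) = symavg2 d (X v)) /\
  (forall C v T, Lip2 C v -> 0 <= T -> X (fun t x => v (t + T) x) = fun t x => X v (t + T) x) /\
  (forall C v w c, Lip2 C v -> Lip2 C w -> (forall t x, 0 <= t -> v t x <= w t x + c) ->
     forall t x, 0 <= t -> X v t x <= X w t x + c).

Lemma averaging_xavg d : averaging (xavg d).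
Proof.
  split; [|split; [|split]].
  - intros. now apply Lip2_xavg.
  - intros C v e H. fun_ext2 t x. unfold xavg, symavg2, symavg.
    assert (L : lip (v t)) by (exists C; now apply Lip2_x).
    assert (L1 : forall c, lip (fun x => v t (x + c))).
    { intros c. exists C. intros y z. pose proof (Lip2_x C v t H (y + c) (z + c)) as A.
      now replace (y + c - (z + c)) with (y - z) in A by ring. }
    pose proof (avg_lincomb d _ _ (/ 2) (/ 2) x (L1 e) (L1 (- e))) as Q.
    transitivity (avg d (fun x => / 2 * v t (x + e) + / 2 * v t (x + - e)) x).
    + unfold avg. apply RInt_ext. intros r _. unfold Rminus. 
      real_eq. field.
    + rewrite Q. unfold avg.
      rewrite (RInt_ext (fun r => v t (x + d * r + e)) (fun r => v t (x + e + d * r))).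
      2:{ intros r _. f_equal. ring. }
      rewrite (RInt_ext (fun r => v t (x + d * r + - e)) (fun r => v t (x - e + d * r))).
      2:{ intros r _. f_equal. ring. }
      real_eq. field.
  - reflexivity.
  - intros C v w c Hv Hw H t x Ht. apply avg_le.
    + exists C. now apply Lip2_x. + exists C. now apply Lip2_x.
    + intros. now apply H.
Qed.

Lemma averaging_tavg d : 0 <= d -> averaging (tavg d).
Proof.
  intros Hd. split; [|split; [|split]].
  - intros. now apply Lip2_tavg.
  - intros C v e H. fun_ext2 t x. unfold tavg, symavg2, symavg.
    assert (L1 : forall y, lip (fun s => v s y)) by (intros y; exists C; now apply Lip2_t).
    pose proof (avg_lincomb d _ _ (/ 2) (/ 2) t (L1 (x + e)) (L1 (x - e))) as Q.
    transitivity (avg d (fun s => / 2 * v s (x + e) + / 2 * v s (x - e)) t).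
    + unfold avg. apply RInt_ext. intros r _.
      real_eq. field.
    + rewrite Q. field.
  - intros C v T H HT. fun_ext2 t x. unfold tavg, avg.
    apply RInt_ext. intros r _. f_equal. ring.
  - intros C v w c Hv Hw H t x Ht. unfold tavg.
    apply (avg_le d (fun s => v s x) (fun s => w s x)).
    + exists C. now apply Lip2_t. + exists C. now apply Lip2_t.
    + intros r Hr. apply H. nra.
Qed.

Lemma averaging_symiter2 X n d C v : averaging X -> Lip2 C v ->
  X (symiter2 n d v) = symiter2 n d (X v).
Proof.
  intros (_ & HX & _). revert v. induction n as [|n IH]; intros v Hv; simpl; trivial.
  rewrite IH by now apply Lip2_symavg2. now rewrite (HX C).
Qed.

Lemma Lip2_symiter2 n d C v : Lip2 C v -> Lip2 C (symiter2 n d v).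
Proof.
  revert v. induction n as [|n IH]; intros v Hv; simpl; trivial. now apply IH, Lip2_symavg2.
Qed.

(** A form, free of heat kernels, of the statement that [v (t + T)] lies above the heat flow of
    volatility [s] started from [v t]. The number of steps does not depend on the point, as
    averaging over points requires. *)
Definition dominates_heat (s : R) (v : R -> R -> R) : Prop := forall T eta, 0 <= T -> 0 < eta ->
  exists n, (0 < n)%nat /\ forall t x, 0 <= t ->
    symiter2 n (s * sqrt (T / INR n)) v t x <= v (t + T) x + eta.

Lemma averaging_dominates_heat X C s v : averaging X -> Lip2 C v -> dominates_heat s v ->
  dominates_heat s (X v).
Proof.
  intros HX HC H T eta HT He. destruct (H T eta HT He) as (n & Hn & Hn').
  exists n. split; trivial. intros t x Ht.
  rewrite <- (averaging_symiter2 X n _ C v) by trivial.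
  destruct HX as (H1 & H2 & H3 & H4).
  pose proof (H3 C v T HC HT) as E.
  replace (X v (t + T) x) with (X (fun t x => v (t + T) x) t x) by now rewrite E.
  apply (H4 C); trivial.
  - now apply Lip2_symiter2.
  - intros u w y z. specialize (HC (u + T) (w + T) y z).
    now replace (u + T - (w + T)) with (u - w) in HC by ring.
Qed.

(** A slice [v t0] is only Lipschitz, so the walk is compared on its fourfold average; replacing one
    by the other costs [4 * C * d] twice, and the number of steps makes the remaining error at most
    [eta / 2]. *)
Lemma super_dominates_heat s v C M : 0 <= s -> Lip2 C v -> super (G_fun s s) v ->
  (forall t x, Rabs (v t x) <= M) -> dominates_heat s v.
Proof.
  intros Hs HC Sv HM T eta HT He.
  pose proof (lipschitz_pos _ _ (Lip2_x C v 0 HC)) as HC0.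
  set (d := eta / (16 * (C + 1))).
  assert (Hd : 0 < d) by (apply Rdiv_lt_0_compat; lra).
  assert (HdE : d * (16 * (C + 1)) = eta) by (unfold d; field; lra).
  destruct (avg4_C4b d M Hd) as [K HK0].
  assert (Hsm : 4 * C * d <= eta / 4) by nra.
  assert (K0 : 0 <= K).
  { destruct (HK0 (fun _ => 0)) as (f1 & f3 & f4 & _ & _ & _ & _ & _ & H6 & _).
    { exists 0. apply lipschitz_const. }
    { intros y. specialize (HM 0 0). rewrite Rabs_R0. pose proof (Rabs_pos (v 0 0)). lra. }
    eapply Rle_trans; [apply Rabs_pos|]. apply (H6 0). }
  set (N := K * s ^ 4 * (T * T)).
  assert (N0 : 0 <= N).
  { apply Rmult_le_pos; [|now apply Rmult_le_pos]. apply Rmult_le_pos; trivial.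
    now apply pow_le. }
  destruct (nfloor_ex (2 * N / eta)) as (n & _ & Hn).
  { apply Rmult_le_pos; [lra|]. now apply Rinv_nonneg. }
  exists (S n). split; [lia|]. rewrite S_INR. intros t0 y Ht0. rewrite symiter2_E.
  assert (L0 : lip (v t0)) by (exists C; now apply Lip2_x).
  assert (B0 : bounded_by M (v t0)) by (intros u; apply HM).
  pose proof (HK0 (v t0) L0 B0) as HK.
  set (f := avg d (avg d (avg d (avg d (v t0))))) in *.
  assert (Hclose : forall y, Rabs (f y - v t0 y) <= 4 * C * d).
  { intros z. apply avg4_close; [lra|]. now apply Lip2_x. }
  set (p := INR n + 1) in *.
  assert (Hp : 0 < p) by (unfold p; pose proof (pos_INR n); lra).
  assert (Hh : 0 <= T / p).
  { apply Rmult_le_pos; trivial. now apply Rinv_nonneg. }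
  assert (Sv' : super (G_fun s s) (fun t x => v (t + t0) x + 4 * C * d))
    by now apply super_shift_time.
  assert (Lv' : lsc (fun t x => v (t + t0) x + 4 * C * d)).
  { apply lsc_shift; trivial. now apply Lip2_lsc with C. }
  pose proof (heat_many_steps (S n) s (T / p) K Hs Hh _ (- M + 4 * C * d) f
    (dq d (dq d (avg d (avg d (v t0))))) M y Lv' Sv') as Q.
  rewrite S_INR in Q. fold p in Q.
  replace (p * (T / p)) with T in Q by (field; lra).
  replace (p * (K * s ^ 4 * (T / p * (T / p)))) with (N / p) in Q by (unfold N; field; lra).
  assert (Np : N / p <= eta / 2).
  { apply Rmult_le_reg_r with p; trivial. replace (N / p * p) with N by (field; lra).
    apply Rmult_lt_compat_r with (r := eta) in Hn; trivial.
    replace (2 * N / eta * eta) with (2 * N) in Hn by (field; lra). lra. }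
  assert (Q' : symiter (S n) (s * sqrt (T / p)) f y - N / p <= v (T + t0) y + 4 * C * d).
  { apply Q; trivial.
    - intros t z Ht. specialize (HM (t + t0) z). apply Rabs_le_between in HM. lra.
    - intros z. unfold f.
      apply bounded_avg; [now do 3 apply lip_avg|]. apply bounded_avg; [now do 2 apply lip_avg|].
      apply bounded_avg; [now apply lip_avg|]. now apply bounded_avg.
    - intros z. rewrite Rplus_0_l. specialize (Hclose z). apply Rabs_le_between in Hclose. lra. }
  assert (D : symiter (S n) (s * sqrt (T / p)) (v t0) y <= symiter (S n) (s * sqrt (T / p)) f y + 4 * C * d).
  { apply symiter_le. intros z. specialize (Hclose z). apply Rabs_le_between in Hclose. lra. }
  rewrite (Rplus_comm t0). lra.
Qed.

Definition tquad (C : R) (F F' : R -> R -> R) : Prop := forall t h x,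
  Rabs (F (t + h) x - F t x - h * F' t x) <= C * (h * h).

Lemma tquad_xavg d C A B F F' : Lip2 A F -> Lip2 B F' -> tquad C F F' ->
  tquad C (xavg d F) (xavg d F').
Proof.
  intros HF HF' H t h x. unfold xavg.
  assert (L1 : lip (F (t + h))) by (exists A; now apply Lip2_x).
  assert (L2 : lip (F t)) by (exists A; now apply Lip2_x).
  assert (L3 : lip (F' t)) by (exists B; now apply Lip2_x).
  set (D := fun x => F (t + h) x - F t x - h * F' t x).
  assert (LD : lip D).
  { destruct L1 as [l1 L1], L2 as [l2 L2], L3 as [l3 L3]. exists (l1 + l2 + Rabs h * l3).
    intros u w. unfold D.
    replace (_ - _) with ((F (t + h) u - F (t + h) w) + (- (F t u - F t w) + - (h * (F' t u - F' t w)))) by ring.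
    eapply Rle_trans; [apply Rabs_triang|].
    eapply Rle_trans; [apply Rplus_le_compat_l, Rabs_triang|].
    rewrite !Rabs_Ropp, Rabs_mult.
    pose proof (L1 u w). pose proof (L2 u w).
    pose proof (Rmult_le_compat_l _ _ _ (Rabs_pos h) (L3 u w)). lra. }
  assert (E : avg d (F (t + h)) x - avg d (F t) x - h * avg d (F' t) x = avg d D x).
  { assert (E1 : avg d (F (t + h)) x = avg d (fun x => 1 * D x + 1 * (1 * F t x + h * F' t x)) x).
    { unfold avg. apply RInt_ext. intros r _. unfold D. simpl.
      req. }
    rewrite E1, avg_lincomb, avg_lincomb; trivial. { ring. }
    destruct L2 as [l2 L2], L3 as [l3 L3]. exists (l2 + Rabs h * l3). intros u w.
    replace (_ - _) with ((F t u - F t w) + (h * (F' t u - F' t w))) by ring.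
    eapply Rle_trans; [apply Rabs_triang|]. rewrite Rabs_mult.
    pose proof (L2 u w). pose proof (Rmult_le_compat_l _ _ _ (Rabs_pos h) (L3 u w)). lra. }
  rewrite E, <- (Rminus_0_r (avg d D x)), <- (avg_const d 0 0).
  apply avg_diff; trivial. { exists 0; apply lipschitz_const. }
  intros r _. rewrite Rminus_0_r. apply H.
Qed.

Lemma tquad_tavg d C v : 0 < d -> Lip2 C v ->
  tquad (2 * C / d) (tavg d v) (fun t x => dq d (fun s => v s x) t).
Proof.
  intros Hd H t h x. unfold tavg. apply (avg_quadratic d (fun s => v s x)); trivial.
  now apply Lip2_t.
Qed.

Lemma Lip2_tdq C d v : 0 < d -> Lip2 C v -> Lip2 (2 * C / d) (fun t x => dq d (fun s => v s x) t).
Proof.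
  intros Hd H t s x y. unfold dq.
  replace (_ - _) with (((v (t + d) x - v (s + d) y) - (v t x - v s y)) * / d) by (field; lra).
  rewrite Rabs_mult, (Rabs_pos_eq (/ d)).
  2:{ now apply Rinv_nonneg. }
  unfold Rdiv. rewrite (Rmult_assoc (2 * C)), (Rmult_comm (/ d)), <- Rmult_assoc.
  apply Rmult_le_compat_r. { now apply Rinv_nonneg. }
  pose proof (H t s x y) as P. pose proof (H (t + d) (s + d) x y) as Q.
  replace (t + d - (s + d)) with (t - s) in Q by ring.
  apply Rabs_le_between in P, Q. apply Rabs_le. lra.
Qed.

Definition xdq (d : R) (v : R -> R -> R) (t x : R) : R := dq d (v t) x.

Lemma Lip2_xdq C d v : 0 < d -> Lip2 C v -> Lip2 (2 * C / d) (xdq d v).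
Proof.
  intros Hd H t s x y. unfold xdq, dq.
  replace (_ - _) with (((v t (x + d) - v s (y + d)) - (v t x - v s y)) * / d) by (field; lra).
  rewrite Rabs_mult, (Rabs_pos_eq (/ d)).
  2:{ now apply Rinv_nonneg. }
  unfold Rdiv. rewrite (Rmult_assoc (2 * C)), (Rmult_comm (/ d)), <- Rmult_assoc.
  apply Rmult_le_compat_r. { now apply Rinv_nonneg. }
  pose proof (H t s x y) as P. pose proof (H t s (x + d) (y + d)) as Q.
  replace (x + d - (y + d)) with (x - y) in Q by ring.
  apply Rabs_le_between in P, Q. apply Rabs_le. lra.
Qed.

Lemma le_of_quadratic a b N : (forall T, 0 < T -> T * a <= T * b + N * (T * T)) -> a <= b.
Proof.
  intros H. apply Rnot_lt_le. intros Hlt.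
  set (T := (a - b) / (2 * (Rabs N + 1))).
  assert (HN : 0 < Rabs N + 1) by (pose proof (Rabs_pos N); lra).
  assert (HT : 0 < T) by (apply Rdiv_lt_0_compat; lra).
  specialize (H T HT). pose proof (Rle_abs N).
  assert (E : T * (2 * (Rabs N + 1)) = a - b) by (unfold T; field; lra).
  assert (T * (a - b) <= T * ((Rabs N + 1) * T)).
  { assert (N * (T * T) <= (Rabs N + 1) * (T * T)).
    { apply Rmult_le_compat_r; [apply Rle_0_sqr|lra]. } lra. }
  apply Rmult_le_reg_l in H1; trivial. lra.
Qed.

(* Averaging preserves domination of the heat semigroups of both extreme volatilities,
   hence turns a viscosity supersolution into a classical one; here the convexity of G
   is used. *)
Lemma mollify sl su v C M e : 0 <= sl <= su -> Lip2 C v -> super (G_fun sl su) v ->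
  (forall t x, Rabs (v t x) <= M) -> 0 < e ->
  exists y yt yx yxx, smooth y yt yx yxx /\ Lip2 C y /\
    (forall t x, 0 < t -> G_fun sl su (yxx t x) <= yt t x) /\
    (forall t x, Rabs (y t x - v t x) <= e).
Proof.
  intros Hs HC Sv HM He.
  pose proof (lipschitz_pos _ _ (Lip2_x C v 0 HC)) as C0.
  (* One average in time and four in space move [v] by at most [5 * C * d]. *)
  set (d := e / (5 * C + 1)).
  assert (Hd : 0 < d) by (apply Rdiv_lt_0_compat; lra).
  assert (Hd0 : 0 <= d) by lra.
  assert (HdE : d * (5 * C + 1) = e) by (unfold d; field; lra).
  set (v0 := tavg d v). set (v1 := xavg d v0). set (v2 := xavg d v1). set (v3 := xavg d v2).
  set (y := xavg d v3).
  assert (L0 : Lip2 C v0) by now apply Lip2_tavg.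
  assert (L1 : Lip2 C v1) by now apply Lip2_xavg.
  assert (L2 : Lip2 C v2) by now apply Lip2_xavg.
  assert (L3 : Lip2 C v3) by now apply Lip2_xavg.
  assert (L4 : Lip2 C y) by now apply Lip2_xavg.
  set (w0 := fun t x => dq d (fun s => v s x) t).
  set (w1 := xavg d w0). set (w2 := xavg d w1). set (w3 := xavg d w2).
  set (C' := 2 * C / d).
  assert (M0 : Lip2 C' w0) by now apply Lip2_tdq.
  assert (M1 : Lip2 C' w1) by now apply Lip2_xavg.
  assert (M2 : Lip2 C' w2) by now apply Lip2_xavg.
  assert (M3 : Lip2 C' w3) by now apply Lip2_xavg.
  assert (M4 : Lip2 C' (xavg d w3)) by now apply Lip2_xavg.
  assert (TQ : tquad C' y (xavg d w3)).
  { apply tquad_xavg with C C'; trivial. apply tquad_xavg with C C'; trivial.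
    apply tquad_xavg with C C'; trivial. apply tquad_xavg with C C'; trivial.
    now apply tquad_tavg. }
  assert (B0 : forall t, bounded_by M (v0 t)).
  { intros t x. apply (bounded_avg d (fun s => v s x)).
    - exists C. now apply Lip2_t. - intros s. apply HM. }
  destruct (avg4_C4b d M Hd) as [K HK].
  assert (C4 : forall t, C4b (y t) (xdq d (xdq d v2) t) K).
  { intros t. apply (HK (v0 t)). { exists C. now apply Lip2_x. } apply B0. }
  assert (DH : forall s, sl <= s <= su -> dominates_heat s y).
  { intros s Hs'. assert (S : dominates_heat s v).
    { apply super_dominates_heat with C M; trivial; [lra|].
      apply super_weaken with (G_fun sl su); trivial. intros a. apply G_fun_le; lra. }
    apply averaging_dominates_heat with C; trivial. apply averaging_xavg.
    apply averaging_dominates_heat with C; trivial. apply averaging_xavg.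
    apply averaging_dominates_heat with C; trivial. apply averaging_xavg.
    apply averaging_dominates_heat with C; trivial. apply averaging_xavg.
    apply averaging_dominates_heat with C; trivial. now apply averaging_tavg. }
  assert (HI : forall s t x, sl <= s <= su -> 0 <= t ->
    s ^ 2 / 2 * xdq d (xdq d v2) t x <= xavg d w3 t x).
  { intros s t x Hs' Ht. set (a := s ^ 2 / 2). set (b := xdq d (xdq d v2) t x).
    (* [y (t + T) x] expands with time derivative [xavg d w3 t x], the walk from [y t] with drift
       [a * b], both with errors quadratic in [T]. The tolerance [eta], and with it the number of
       steps, is disposed of before [T] tends to 0. *)
    apply le_of_quadratic with (C' + K * (a * a)). intros T HT.
    apply le_epsilon. intros eta Heta.
    destruct (DH s Hs' T eta (Rlt_le _ _ HT) Heta) as (n & Hn & Q).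
    specialize (Q t x Ht). rewrite symiter2_E in Q.
    assert (Hn' : 0 < INR n) by now apply lt_0_INR.
    assert (P0 : 0 <= T / INR n).
    { apply Rmult_le_pos; [lra|]. now apply Rinv_nonneg. }
    pose proof (symiter_ge n (s * sqrt (T / INR n)) _ _ K x
      ltac:(apply Rmult_le_pos; [lra|apply sqrt_pos]) (C4 t)) as Z.
    replace (s * sqrt (T / INR n) * (s * sqrt (T / INR n)))
      with (s * s * (sqrt (T / INR n) * sqrt (T / INR n))) in Z by ring.
    rewrite sqrt_sqrt in Z by trivial.
    replace (INR n * (s * s * (T / INR n) / 2)) with (a * T) in Z by (unfold a; field; lra).
    fold b in Z. specialize (TQ t T x). apply Rabs_le_between in TQ. lra. }
  exists y, (xavg d w3), (xdq d v3), (xdq d (xdq d v2)).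
  refine (conj _ (conj L4 (conj _ _))).
  - intros t x _.
    assert (D : forall v, Lip2 C v -> forall x : R, is_derive (xavg d v t) x (xdq d v t x)).
    { intros u Hu z. apply (is_derive_avg d (u t)); trivial. exists C. now apply Lip2_x. }
    split7.
    + apply is_derive_quadratic with C'. intros h. apply TQ.
    + now apply D.
    + apply (is_derive_dq d (v3 t) (xdq d v2 t)). intros z. now apply D.
    + now apply Lip2_continuity with C.
    + now apply Lip2_continuity with C'.
    + apply Lip2_continuity with C'. now apply Lip2_xdq.
    + apply Lip2_continuity with (2 * C' / d). apply Lip2_xdq; trivial. now apply Lip2_xdq.
  - intros t x Ht. set (b := xdq d (xdq d v2) t x).
    destruct (Rle_dec 0 b).
    + rewrite G_fun_pos by trivial. pose proof (HI su t x ltac:(lra) (Rlt_le _ _ Ht)) as Q.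
      fold b in Q. lra.
    + rewrite G_fun_neg by lra. pose proof (HI sl t x ltac:(lra) (Rlt_le _ _ Ht)) as Q.
      fold b in Q. lra.
  - intros t x.
    pose proof (avg4_close d (v0 t) C x Hd0 (Lip2_x C v0 t L0)) as Q1.
    pose proof (avg_close d (fun s => v s x) C t Hd0 (Lip2_t C v x HC)) as Q2.
    change (Rabs (y t x - v0 t x) <= 4 * C * d) in Q1.
    change (Rabs (v0 t x - v t x) <= C * d) in Q2.
    apply Rabs_le_between in Q1, Q2. apply Rabs_le. lra.
Qed.

(** Freezing at time 0 keeps the function Lipschitz on the whole plane, where [Lip2] and the
    averages live. *)
Definition extend (v : R -> R -> R) (t x : R) : R := v (Rmax 0 t) x.

Lemma extend_eq v t x : 0 <= t -> extend v t x = v t x.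
Proof. intros H. unfold extend. now rewrite Rmax_right. Qed.

Lemma super_ext G u v : (forall t x, 0 < t -> u t x = v t x) -> super G u -> super G v.
Proof.
  intros E H psi ft fx fxx t x Hs Ht [d Hd]. apply (H _ _ _ _ t x Hs Ht).
  assert (P : 0 < Rmin d t) by (apply Rmin_pos; [apply cond_pos|trivial]).
  exists (mkposreal _ P). simpl. intros s y H1 H2.
  rmin d t.
  pose proof (Rabs_def2 _ _ H1).
  specialize (Hd s y ltac:(lra) ltac:(lra)). rewrite !E; trivial. lra.
Qed.

Lemma super_le_perron G sl su phi M L u m : 0 <= sl <= su -> G = G_fun sl su ->
  bounded_by M phi -> lipschitz L phi ->
  lsc (fun t x => - u t x) -> (forall t x, 0 <= t -> u t x <= m) ->
  super (Gbar G) (fun t x => - u t x) -> (forall x, u 0 x <= phi x) ->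
  forall t x, 0 <= t -> u t x <= perron G phi t x.
Proof.
  intros Hs -> HM HL Lu Bu Su Iu t x Ht.
  set (K := su ^ 2 / 2). pose proof (elliptic_G_fun sl su Hs) as HG. fold K in HG.
  pose proof (G_fun_0 sl su) as G0.
  pose proof (approx_C2_lip phi M L HM HL) as HA.
  apply le_epsilon. intros e He.
  set (d := e / (8 * (L + 1))).
  pose proof (lipschitz_pos _ _ HL) as L0.
  assert (Hd : 0 < d) by (apply Rdiv_lt_0_compat; lra).
  assert (Hd0 : 0 <= d) by lra.
  assert (HdE : d * (8 * (L + 1)) = e) by (unfold d; field; lra).
  assert (Lp : lip phi) by now exists L.
  set (p := avg d (avg d phi)).
  assert (HpL : lipschitz L p) by (now do 2 apply lipschitz_avg).
  destruct (avg2_C2b d phi M Hd Lp HM) as [Hp2 HpM]. fold p in Hp2, HpM.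
  assert (Hclose : forall z, Rabs (phi z - p z) <= e / 4).
  { intros z. rewrite Rabs_minus_sym.
    eapply Rle_trans; [apply avg2_close with (L := L); trivial; lra|]. lra. }
  set (B := 2 * (2 * M / d) / d) in *.
  assert (B0 : 0 <= K * B).
  { apply Rmult_le_pos; [apply HG|]. eapply Rle_trans; [apply Rabs_pos|]. apply (proj2 (proj2 (proj2 Hp2)) 0). }
  set (C := K * B + L).
  set (V := perron (G_fun sl su) p). set (v := extend V).
  assert (vC : Lip2 C v).
  { intros s r z w. unfold v, extend.
    pose proof (perron_time_lip K _ HG G0 p _ _ B M (Rmax 0 s) (Rmax 0 r) z Hp2 HpM
      (Rmax_l 0 s) (Rmax_l 0 r)) as Q1.
    pose proof (perron_lip K _ HG G0 p M L (Rmax 0 r) z w HpM (Rmax_l 0 r) HpL) as Q2.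
    fold V in Q1, Q2.
    assert (Q3 : Rabs (Rmax 0 s - Rmax 0 r) <= Rabs (s - r)).
    { unfold Rmax, Rabs. destruct (Rle_dec 0 s), (Rle_dec 0 r); repeat destruct Rcase_abs; lra. }
    apply Rmult_le_compat_l with (r := K * B) in Q3; trivial.
    pose proof (Rmult_le_pos _ _ B0 (Rabs_pos (z - w))).
    pose proof (Rmult_le_pos _ _ L0 (Rabs_pos (s - r))).
    replace (V (Rmax 0 s) z - V (Rmax 0 r) w)
      with ((V (Rmax 0 s) z - V (Rmax 0 r) z) + (V (Rmax 0 r) z - V (Rmax 0 r) w)) by ring.
    eapply Rle_trans; [apply Rabs_triang|]. unfold C. lra. }
  assert (vS : super (G_fun sl su) v).
  { apply super_ext with V.
    - intros s z Hs'. symmetry. apply extend_eq. lra.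
    - apply (perron_super K _ p M HG G0 HpM). }
  assert (vM : forall s z, Rabs (v s z) <= M).
  { intros s z. apply (perron_bounded K); trivial. apply Rmax_l. }
  destruct (mollify sl su v C M (e / 4) Hs vC vS vM ltac:(lra))
    as (y & yt & yx & yxx & Sy & Ly & Gy & Ey).
  (* Smoothing the data and mollifying each shift the initial values by at most [e / 4]; lifting by
     [c] restores the order with [u] at time 0. *)
  set (c := e / 2).
  pose proof (smooth_opp _ _ _ _ (smooth_plus _ _ _ _ _ _ _ _ Sy (smooth_affine_time c 0))) as Sb.
  assert (R1 : - (y t x + (c + 0 * t)) <= - u t x).
  { apply (super_ge_smooth (Gbar (G_fun sl su)) K (fun t x => - u t x) _ _ _ _ (m + M + e)
      (elliptic_Gbar _ _ HG) Lu Su Sb); trivial.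
    - apply lsc_continuity_2d. intros s z _. cont2. now apply Lip2_continuity with C.
    - intros s z Hs'. unfold Gbar. rewrite Ropp_involutive, !Rplus_0_r.
      specialize (Gy s z Hs'). lra.
    - intros z. specialize (Ey 0 z). specialize (Iu z). specialize (Hclose z).
      unfold v in Ey. rewrite extend_eq in Ey by lra. unfold V in Ey.
      rewrite (perron_initial_C2 K _ HG G0 p _ _ B M z Hp2 HpM) in Ey.
      apply Rabs_le_between in Ey, Hclose. unfold c. lra.
    - intros s z Hs'. specialize (Ey s z). specialize (vM s z). specialize (Bu s z Hs').
      apply Rabs_le_between in Ey, vM. unfold c. lra. }
  pose proof (perron_close K _ HG G0 phi p M M (e / 4) t x HM HpM Ht Hclose) as R2.
  specialize (Ey t x). unfold v in Ey. rewrite extend_eq in Ey by trivial. fold V in R2.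
  apply Rabs_le_between in R2, Ey. unfold c in R1. lra.
Qed.

(** * The flow of the G-heat equation *)

Definition flow (sl su : R) (phi : R -> R) (t x : R) : R := perron (G_fun sl su) phi t x.

Definition solves (G phi : R -> R) (u : R -> R -> R) : Prop :=
  lsc u /\ lsc (fun t x => - u t x) /\ bounded_halfplane u /\
  super G u /\ super (Gbar G) (fun t x => - u t x) /\ (forall x, u 0 x = phi x).

Lemma continuous_halfplane_iff u :
  continuous_halfplane u <-> lsc u /\ lsc (fun t x => - u t x).
Proof.
  split.
  - intros H. assert (E : forall t x e, 0 <= t -> 0 < e -> exists d, 0 < d /\
      forall s y, 0 <= s -> Rabs (s - t) < d -> Rabs (y - x) < d -> Rabs (u s y - u t x) < e).
    { intros t x e Ht He. specialize (H t x Ht).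
      apply filterlim_locally with (eps := mkposreal e He) in H.
      unfold within in H.
      apply (locally_2d_locally (fun s y => 0 <= s -> ball (u t x) (mkposreal e He) (u s y))) in H.
      destruct H as [d Hd]. exists d. split; [apply cond_pos|].
      intros s y Hs H1 H2. exact (Hd s y H1 H2 Hs). }
    split; intros t x e Ht He; destruct (E t x e Ht He) as (d & Hd & Hd');
    exists d; split; trivial; intros s y Hs H1 H2; specialize (Hd' s y Hs H1 H2);
    apply Rabs_def2 in Hd'; lra.
  - intros [H1 H2] t x Ht. apply filterlim_locally. intros eps. unfold within.
    apply (locally_2d_locally (fun s y => 0 <= s -> ball (u t x) eps (u s y))).
    destruct (H1 t x eps Ht (cond_pos eps)) as (d1 & D1 & E1).
    destruct (H2 t x eps Ht (cond_pos eps)) as (d2 & D2 & E2).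
    exists (mkposreal _ (Rmin_pos _ _ D1 D2)). simpl. intros s y Hs Hy Hs0.
    rmin d1 d2.
    specialize (E1 s y Hs0 ltac:(lra) ltac:(lra)). specialize (E2 s y Hs0 ltac:(lra) ltac:(lra)).
    apply Rabs_def1; simpl; unfold minus, plus, opp; simpl; lra.
Qed.

Lemma solves_iff G phi u : G_heat_solution G phi u <-> solves G phi u.
Proof.
  unfold G_heat_solution, solves. rewrite continuous_halfplane_iff, super_iff, sub_iff. tauto.
Qed.

Lemma bounded_lipschitz_iff phi :
  bounded_lipschitz phi <-> exists M L, bounded_by M phi /\ lipschitz L phi.
Proof.
  split.
  - intros [[M HM] [L HL]]. now exists M, L.
  - intros (M & L & HM & HL). split; [now exists M|now exists L].
Qed.

Section Flow.
Variables sl su : R.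
Hypothesis Hs : 0 <= sl <= su.
Let HG := elliptic_G_fun sl su Hs.
Let G0 := G_fun_0 sl su.

Lemma flow_solves phi : bounded_lipschitz phi -> solves (G_fun sl su) phi (flow sl su phi).
Proof.
  intros H. apply bounded_lipschitz_iff in H. destruct H as (M & L & HM & HL).
  pose proof (approx_C2_lip phi M L HM HL) as HA.
  destruct (perron_lsc _ _ phi M L HG G0 HM HL HA) as [C1 C2].
  refine (conj C1 (conj C2 (conj _ (conj _ (conj _ _))))).
  - exists M. intros t x Ht. now apply (perron_bounded _ _ HG G0).
  - now apply (perron_super _ _ phi M HG G0).
  - now apply (perron_sub _ _ phi M L HG G0).
  - intros x. now apply (perron_initial _ _ HG G0 phi M).
Qed.

Lemma flow_le phi w t x : bounded_lipschitz phi -> lsc w ->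
  (exists m, forall t x, 0 <= t -> m <= w t x) -> super (G_fun sl su) w ->
  (forall x, phi x <= w 0 x) -> 0 <= t -> flow sl su phi t x <= w t x.
Proof.
  intros H H1 H2 H3 H4 Ht. apply bounded_lipschitz_iff in H. destruct H as (M & L & HM & HL).
  apply (perron_le _ _ HG G0 phi M); trivial. now split.
Qed.

Lemma flow_ge phi u t x : bounded_lipschitz phi -> lsc (fun t x => - u t x) ->
  (exists m, forall t x, 0 <= t -> u t x <= m) -> super (Gbar (G_fun sl su)) (fun t x => - u t x) ->
  (forall x, u 0 x <= phi x) -> 0 <= t -> u t x <= flow sl su phi t x.
Proof.
  intros H H1 [m Hm] H3 H4 Ht. apply bounded_lipschitz_iff in H. destruct H as (M & L & HM & HL).
  now apply (super_le_perron _ sl su phi M L u m).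
Qed.

(** The Perron function is at once the least supersolution and the greatest subsolution, so a
    solution is squeezed between [flow_le] and [flow_ge]. *)
Lemma flow_unique phi u t x : bounded_lipschitz phi -> solves (G_fun sl su) phi u ->
  0 <= t -> u t x = flow sl su phi t x.
Proof.
  intros H (H1 & H2 & [M HM] & H4 & H5 & H6) Ht. apply Rle_antisym.
  - apply flow_ge; trivial.
    + exists M. intros s y Hs'. specialize (HM s y Hs'). apply Rabs_le_between in HM. lra.
    + intros y. rewrite H6. lra.
  - apply flow_le; trivial.
    + exists (- M). intros s y Hs'. specialize (HM s y Hs'). apply Rabs_le_between in HM. lra.
    + intros y. rewrite H6. lra.
Qed.

Lemma G_heat_flow phi t x : bounded_lipschitz phi -> 0 <= t ->
  G_heat (G_fun sl su) phi t x = flow sl su phi t x.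
Proof.
  intros H Ht. apply flow_unique; trivial. apply solves_iff. unfold G_heat.
  apply epsilon_spec. exists (flow sl su phi). now apply solves_iff, flow_solves.
Qed.

Lemma flow_bounded phi M t x : bounded_by M phi -> 0 <= t -> Rabs (flow sl su phi t x) <= M.
Proof. intros. now apply (perron_bounded _ _ HG G0). Qed.

Lemma flow_bl phi t : bounded_lipschitz phi -> 0 <= t -> bounded_lipschitz (flow sl su phi t).
Proof.
  intros H Ht. apply bounded_lipschitz_iff in H. destruct H as (M & L & HM & HL).
  apply bounded_lipschitz_iff. exists M, L. split.
  - intros x. now apply flow_bounded.
  - intros x y. now apply (perron_lip _ _ HG G0 phi M).
Qed.

Lemma flow_0 phi x : bounded_lipschitz phi -> flow sl su phi 0 x = phi x.
Proof. intros H. apply (flow_solves phi H). Qed.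

Lemma flow_monotone phi psi c t x : bounded_lipschitz phi -> bounded_lipschitz psi ->
  (forall x, phi x <= psi x + c) -> 0 <= t -> flow sl su phi t x <= flow sl su psi t x + c.
Proof.
  intros H H' Hle Ht. apply bounded_lipschitz_iff in H, H'.
  destruct H as (M & L & HM & HL). destruct H' as (M' & L' & HM' & HL').
  pose proof (perron_compare _ _ HG G0 psi phi M' M 0 c t x HM' HM Ht) as Q.
  rewrite Rplus_0_r in Q. apply Q. intros y. rewrite Rplus_0_r. apply Hle.
Qed.

Lemma flow_contraction phi psi c t x : bounded_lipschitz phi -> bounded_lipschitz psi ->
  (forall x, Rabs (phi x - psi x) <= c) -> 0 <= t ->
  Rabs (flow sl su phi t x - flow sl su psi t x) <= c.
Proof.
  intros H H' Hle Ht.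
  assert (flow sl su phi t x <= flow sl su psi t x + c).
  { apply flow_monotone; trivial. intros y. specialize (Hle y). apply Rabs_le_between in Hle. lra. }
  assert (flow sl su psi t x <= flow sl su phi t x + c).
  { apply flow_monotone; trivial. intros y. specialize (Hle y). apply Rabs_le_between in Hle. lra. }
  apply Rabs_le. lra.
Qed.

Lemma flow_equicont phi : bounded_lipschitz phi -> time_equicont (flow sl su phi).
Proof.
  intros H. apply bounded_lipschitz_iff in H. destruct H as (M & L & HM & HL).
  apply (perron_time_equicont _ _ HG G0 phi M); trivial. now apply approx_C2_lip with M L.
Qed.

Lemma solves_shift phi u s : 0 <= s -> solves (G_fun sl su) phi u ->
  solves (G_fun sl su) (u s) (fun t x => u (t + s) x).
Proof.
  intros H0 (H1 & H2 & [M HM] & H4 & H5 & H6).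
  assert (E : forall v : R -> R -> R, (fun t x => v (t + s) x) = (fun t x => v (t + s) x + 0)).
  { intros v. fun_ext2 t x. ring. }
  refine (conj _ (conj _ (conj _ (conj _ (conj _ _))))).
  - rewrite E. now apply lsc_shift.
  - rewrite (E (fun t x => - u t x)). now apply (lsc_shift (fun t x => - u t x)).
  - exists M. intros t x Ht. apply HM. lra.
  - rewrite E. now apply super_shift_time.
  - rewrite (E (fun t x => - u t x)). now apply (super_shift_time _ (fun t x => - u t x)).
  - intros x. now rewrite Rplus_0_l.
Qed.

Lemma flow_semigroup phi s t x : bounded_lipschitz phi -> 0 <= s -> 0 <= t ->
  flow sl su (flow sl su phi s) t x = flow sl su phi (t + s) x.
Proof.
  intros H H0 Ht. symmetry.
  apply (flow_unique (flow sl su phi s) (fun t x => flow sl su phi (t + s) x)); trivial.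
  - now apply flow_bl.
  - apply solves_shift with phi; trivial. now apply flow_solves.
Qed.

End Flow.

(** * Scaling, and the convolution for equal ratios *)

Lemma G_fun_scale sl su p a : 0 < p -> G_fun sl su (p * a) = p * G_fun sl su a.
Proof.
  intros H. destruct (Rle_dec 0 a).
  - rewrite !G_fun_pos by nra. field.
  - rewrite !G_fun_neg by nra. field.
Qed.

Lemma G_fun_scale_vol r sl su a : G_fun (r * sl) (r * su) a = r * r * G_fun sl su a.
Proof.
  destruct (Rle_dec 0 a).
  - rewrite !G_fun_pos by lra. field.
  - rewrite !G_fun_neg by lra. field.
Qed.

(** The condition on [G'] is the chain rule. Negative [a] is allowed so that reflections are covered
    along with dilations. *)
Lemma super_rescale G G' w c a h k : 0 < c -> a <> 0 -> 0 < k ->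
  (forall b, G' b = c * k * G (b / (a * a * k))) -> super G w ->
  super G' (fun t x => k * w (c * t) (a * x + h)).
Proof.
  intros Hc Ha Hk HG Hw psi ft fx fxx t x Hs Ht [d Hd].
  assert (T : forall t, 0 < t -> 0 < / c * t /\ is_derive (fun t => / c * t) t (/ c) /\
    continuity_pt (fun _ => / c) t).
  { intros u Hu. refine (conj _ (conj _ _)).
    - apply Rmult_lt_0_compat; trivial. now apply Rinv_0_lt_compat.
    - auto_derive; [exact I|req].
    - apply continuity_pt_const. now intros ? ?. }
  pose proof (smooth_scal (/ k) _ _ _ _
    (smooth_comp psi ft fx fxx (fun t => / c * t) (fun _ => / c) (/ a) (- h / a) Hs T)) as S.
  pose proof (Hw _ _ _ _ (c * t) (a * x + h) S) as F. cbv beta in F.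
  replace (/ c * (c * t)) with t in F by (field; lra).
  replace (/ a * (a * x + h) + - h / a) with x in F by (field; trivial).
  rewrite HG.
  replace (fxx t x / (a * a * k)) with (/ k * (/ a * / a * fxx t x)) by (field; lra).
  assert (ck : 0 < c * k) by now apply Rmult_lt_0_compat.
  replace (ft t x) with (c * k * (/ k * (/ c * ft t x))) by (field; lra).
  apply Rmult_le_compat_l; [lra|]. apply F; [now apply Rmult_lt_0_compat|].
  assert (HA : 0 < Rabs a) by now apply Rabs_pos_lt.
  assert (P : 0 < Rmin (c * d) (Rabs a * d)).
  { apply Rmin_pos; apply Rmult_lt_0_compat; trivial; apply cond_pos. }
  exists (mkposreal _ P). simpl. intros s y H1 H2.
  rmin (c * d) (Rabs a * d).
  specialize (Hd (/ c * s) (/ a * y + - h / a)). cbv beta in Hd.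
  replace (/ c * (c * t)) with t by (field; lra).
  replace (/ a * (a * x + h) + - h / a) with x by (field; trivial).
  replace (c * (/ c * s)) with s in Hd by (field; lra).
  replace (a * (/ a * y + - h / a) + h) with y in Hd by (field; trivial).
  assert (D1 : Rabs (/ c * s - t) < d).
  { replace (/ c * s - t) with (/ c * (s - c * t)) by (field; lra).
    rewrite Rabs_mult, (Rabs_pos_eq (/ c)).
    2:{ now apply Rinv_nonneg. }
    apply Rmult_lt_reg_l with c; trivial. rewrite <- Rmult_assoc, Rinv_r, Rmult_1_l by lra. lra. }
  assert (D2 : Rabs (/ a * y + - h / a - x) < d).
  { replace (/ a * y + - h / a - x) with (/ a * (y - (a * x + h))) by (field; trivial).
    rewrite Rabs_mult, Rabs_inv.
    apply Rmult_lt_reg_l with (Rabs a); trivial.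
    rewrite <- Rmult_assoc, Rinv_r, Rmult_1_l by lra. lra. }
  specialize (Hd D1 D2).
  apply Rmult_le_reg_l with k; trivial.
  replace (k * (w (c * t) (a * x + h) - / k * psi t x))
    with (k * w (c * t) (a * x + h) - psi t x) by (field; lra).
  replace (k * (w s y - / k * psi (/ c * s) (/ a * y + - h / a)))
    with (k * w s y - psi (/ c * s) (/ a * y + - h / a)) by (field; lra).
  exact Hd.
Qed.

Lemma lsc_rescale w c a h k : 0 < c -> a <> 0 -> 0 < k -> lsc w ->
  lsc (fun t x => k * w (c * t) (a * x + h)).
Proof.
  intros Hc Ha Hk Lw t x e Ht He.
  destruct (Lw (c * t) (a * x + h) (e / k)) as (d & Hd & Hd').
  { apply Rmult_le_pos; lra. } { now apply Rdiv_lt_0_compat. }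
  assert (HA : 0 < Rabs a) by now apply Rabs_pos_lt.
  exists (Rmin (d / c) (d / Rabs a)). split. { apply Rmin_pos; now apply Rdiv_lt_0_compat. }
  intros s y Hs H1 H2.
  rmin (d / c) (d / Rabs a).
  assert (Q : w (c * t) (a * x + h) - e / k < w (c * s) (a * y + h)).
  { apply Hd'.
    - apply Rmult_le_pos; lra.
    - replace (c * s - c * t) with (c * (s - t)) by ring.
      rewrite Rabs_mult, (Rabs_pos_eq c) by lra.
      replace d with (c * (d / c)) by (field; lra). apply Rmult_lt_compat_l; lra.
    - replace (a * y + h - (a * x + h)) with (a * (y - x)) by ring.
      rewrite Rabs_mult.
      replace d with (Rabs a * (d / Rabs a)) by (field; lra). apply Rmult_lt_compat_l; lra. }
  apply Rmult_lt_compat_l with (r := k) in Q; trivial.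
  replace (k * (w (c * t) (a * x + h) - e / k)) with (k * w (c * t) (a * x + h) - e) in Q
    by (field; lra). lra.
Qed.

Lemma bounded_lipschitz_affine phi k a h : bounded_lipschitz phi ->
  bounded_lipschitz (fun x => k * phi (a * x + h)).
Proof.
  intros H. apply bounded_lipschitz_iff in H. destruct H as (M & L & HM & HL).
  apply bounded_lipschitz_iff. exists (Rabs k * M), (Rabs k * (L * Rabs a)). split.
  - intros x. rewrite Rabs_mult. apply Rmult_le_compat_l; [apply Rabs_pos|apply HM].
  - intros x y. rewrite <- Rmult_minus_distr_l, Rabs_mult, (Rmult_assoc (Rabs k)).
    apply Rmult_le_compat_l; [apply Rabs_pos|].
    eapply Rle_trans; [apply HL|].
    replace (a * x + h - (a * y + h)) with (a * (x - y)) by ring. rewrite Rabs_mult. lra.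
Qed.

Lemma flow_rescale sl su r a h k phi t x : 0 <= sl <= su -> 0 < r -> a <> 0 -> 0 < k ->
  bounded_lipschitz phi -> 0 <= t ->
  flow (r * sl) (r * su) (fun x => k * phi (a * x + h)) t x =
    k * flow sl su phi (r * r * (a * a) * t) (a * x + h).
Proof.
  intros Hs Hr Ha Hk H Ht. symmetry.
  assert (Haa : 0 < a * a).
  { destruct (Rle_lt_or_eq_dec 0 (a * a) (Rle_0_sqr a)); trivial.
    exfalso. symmetry in e. apply Rmult_integral in e. tauto. }
  set (c := r * r * (a * a)).
  assert (Hc : 0 < c) by (apply Rmult_lt_0_compat; trivial; now apply Rmult_lt_0_compat).
  assert (E : forall b, G_fun (r * sl) (r * su) b = c * k * G_fun sl su (b / (a * a * k))).
  { intros b. rewrite G_fun_scale_vol.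
    assert (0 < a * a * k) by now apply Rmult_lt_0_compat.
    replace (b / (a * a * k)) with (/ (a * a * k) * b) by (field; lra).
    rewrite G_fun_scale by now apply Rinv_0_lt_compat. unfold c. field. lra. }
  apply (flow_unique (r * sl) (r * su)) with (u := fun t x => k * flow sl su phi (c * t) (a * x + h));
    trivial.
  - split; nra.
  - now apply bounded_lipschitz_affine.
  - destruct (flow_solves sl su Hs phi H) as (H1 & H2 & [M HM] & H4 & H5 & H6).
    assert (N : forall v : R -> R -> R, (fun t x => - (k * v (c * t) (a * x + h))) =
      (fun t x => k * (fun t x => - v t x) (c * t) (a * x + h))).
    { intros v. fun_ext2 u y. ring. }
    refine (conj _ (conj _ (conj _ (conj _ (conj _ _))))).
    + now apply lsc_rescale.
    + rewrite N. now apply (lsc_rescale (fun t x => - flow sl su phi t x)).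
    + exists (k * M). intros u y Hu. rewrite Rabs_mult, (Rabs_pos_eq k) by lra.
      apply Rmult_le_compat_l; [lra|]. apply HM. apply Rmult_le_pos; lra.
    + now apply super_rescale with (G_fun sl su).
    + rewrite N. apply (super_rescale (Gbar (G_fun sl su)) _ (fun t x => - flow sl su phi t x)); trivial.
      intros b. unfold Gbar. rewrite E.
      replace (- b / (a * a * k)) with (- (b / (a * a * k))) by (field; lra). ring.
    + intros y. rewrite Rmult_0_r. now rewrite H6.
Qed.

Lemma G_normal_flow sl su phi : 0 <= sl <= su -> bounded_lipschitz phi ->
  G_normal (G_fun sl su) phi = flow sl su phi 1 0.
Proof. intros Hs H. apply G_heat_flow; trivial. lra. Qed.

Lemma convolution_flow sl1 su1 sl2 su2 phi : 0 <= sl1 <= su1 -> 0 <= sl2 <= su2 ->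
  bounded_lipschitz phi ->
  convolution (G_normal (G_fun sl1 su1)) (G_normal (G_fun sl2 su2)) phi =
    flow sl1 su1 (flow sl2 su2 phi 1) 1 0.
Proof.
  intros H1 H2 H. unfold convolution.
  replace (fun x => G_normal (G_fun sl2 su2) (fun y => phi (x + y))) with (flow sl2 su2 phi 1).
  - apply G_normal_flow; trivial. apply flow_bl; trivial. lra.
  - apply functional_extensionality; intros x.
    replace (fun y => phi (x + y)) with (fun y => 1 * phi (1 * y + x)).
    2:{ apply functional_extensionality; intros y. rewrite Rmult_1_l. f_equal. ring. }
    rewrite G_normal_flow; trivial. 2:{ now apply bounded_lipschitz_affine. }
    pose proof (flow_rescale sl2 su2 1 1 x 1 phi 1 0 H2) as E.
    rewrite !Rmult_1_l, Rplus_0_l in E. symmetry. 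
    rewrite E; trivial; lra.
Qed.

Lemma is_G_normal_of_ratio sl1 su1 sl2 su2 : 0 < sl1 <= su1 -> 0 < sl2 <= su2 ->
  su1 / sl1 = su2 / sl2 ->
  is_G_normal (convolution (G_normal (G_fun sl1 su1)) (G_normal (G_fun sl2 su2))).
Proof.
  intros H1 H2 E. set (r := sl2 / sl1).
  assert (Hr : 0 < r) by (apply Rdiv_lt_0_compat; lra).
  assert (E1 : sl2 = r * sl1) by (unfold r; field; lra).
  assert (E2 : su2 = r * su1).
  { unfold r. replace (sl2 / sl1 * su1) with (sl2 * (su1 / sl1)) by (field; lra).
    rewrite E. field. lra. }
  (* The two flows are one flow run for the times 1 and [r * r]; the total time [1 + r * r] amounts
     to volatilities multiplied by [q]. *)
  set (q := sqrt (1 + r * r)).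
  assert (Hq : 0 < q) by (apply sqrt_lt_R0; nra).
  assert (Hqq : q * q = 1 + r * r) by (apply sqrt_sqrt; nra).
  exists (G_fun (q * sl1) (q * su1)). split.
  { exists (q * sl1), (q * su1). split; trivial. split; nra. }
  intros phi Hphi.
  assert (Aff : phi = fun x => 1 * phi (1 * x + 0)).
  { apply functional_extensionality; intros x. now rewrite !Rmult_1_l, Rplus_0_r. }
  assert (S : forall p t x, 0 < p -> 0 <= t ->
    flow (p * sl1) (p * su1) phi t x = flow sl1 su1 phi (p * p * t) x).
  { intros p t x Hp Ht. rewrite Aff at 1. rewrite flow_rescale; trivial; try lra.
    rewrite !Rmult_1_l, Rplus_0_r. f_equal. ring. }
  rewrite convolution_flow, G_normal_flow; trivial; try lra. 2:{ split; nra. }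
  rewrite E1, E2, S by lra.
  replace (flow (r * sl1) (r * su1) phi 1) with (flow sl1 su1 phi (r * r * 1)).
  2:{ apply functional_extensionality; intros x. rewrite S; trivial. lra. }
  rewrite flow_semigroup; trivial; try lra. 2:{ nra. }
  f_equal. lra.
Qed.

(** * Commutation of flows *)

(** The expansion looks at earlier times [t - h], from which a flow arriving at [(t, x)] is started;
    worsening the coefficients by [e] absorbs the remainders. *)
Lemma smooth_lower_taylor psi ft fx fxx t x e : smooth psi ft fx fxx -> 0 < t -> 0 < e ->
  exists r, 0 < r /\ forall h y, 0 <= h < r -> Rabs (y - x) < r -> h < t ->
    psi t x - (ft t x + e) * h + fx t x * (y - x) + (fxx t x - e) / 2 * (y - x) * (y - x)
      <= psi (t - h) y.
Proof.
  intros Hs Ht He.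
  destruct (Hs t x Ht) as (_ & _ & H3 & _ & C & _).
  destruct (C (mkposreal e He)) as [d1 D1]. simpl in D1.
  destruct (proj1 (is_derive_eps _ _ _) H3 e He) as (d2 & D2p & D2).
  exists (Rmin d1 d2). split. { apply Rmin_pos; [apply cond_pos|trivial]. }
  intros h y Hh Hy Hht. rmin d1 d2.
  assert (A : psi t y - (ft t x + e) * h <= psi (t - h) y).
  { destruct (Rle_lt_or_eq_dec 0 h (proj1 Hh)) as [c|<-].
    2:{ rewrite Rminus_0_r. lra. }
    destruct (MVT_cor2 (fun s => psi s y) (fun s => ft s y) (t - h) t) as (z & E & Hz); [lra| |].
    { intros z Hz. apply is_derive_Reals. apply Hs. lra. }
    assert (Q : Rabs (ft z y - ft t x) < e).
    { apply D1; [apply Rabs_def1|]; lra. }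
    apply Rabs_def2 in Q. replace (t - (t - h)) with h in E by ring.
    assert (ft z y * h <= (ft t x + e) * h) by (apply Rmult_le_compat_r; lra). lra. }
  set (p := fx t x) in *. set (a := fxx t x) in *.
  set (g := fun y => psi t y - (psi t x + p * (y - x) + (a - e) / 2 * (y - x) * (y - x))).
  set (g1 := fun y => fx t y - p - (a - e) * (y - x)).
  assert (Dg : forall z : R, is_derive g z (g1 z)).
  { intros z. unfold g, g1.
    replace (fx t z - p - (a - e) * (z - x)) with (minus (fx t z) (p + (a - e) * (z - x)))
      by (unfold minus, plus, opp; simpl; ring).
    apply (is_derive_minus (psi t)). { now apply Hs. }
    auto_derive; [exact I|].
    real_eq. field. }
  assert (G0 : g x = 0) by (unfold g; ring).
  enough (0 <= g y) by (unfold g in *; lra).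
  destruct (Rtotal_order y x) as [c|[->|c]].
  - destruct (MVT_cor2 g g1 y x c) as (z & E & Hz).
    { intros z _. apply is_derive_Reals, Dg. }
    pose proof (Rabs_def2 _ _ Hy) as Hy'. specialize (D2 z).
    rewrite (Rabs_left1 (z - x)) in D2 by lra.
    specialize (D2 ltac:(lra)). apply Rabs_le_between in D2.
    assert (g1 z <= 0) by (unfold g1; lra). rewrite G0 in E. nra.
  - lra.
  - destruct (MVT_cor2 g g1 x y c) as (z & E & Hz).
    { intros z _. apply is_derive_Reals, Dg. }
    pose proof (Rabs_def2 _ _ Hy) as Hy'. specialize (D2 z).
    rewrite (Rabs_pos_eq (z - x)) in D2 by lra.
    specialize (D2 ltac:(lra)). apply Rabs_le_between in D2.
    assert (0 <= g1 z) by (unfold g1; lra). rewrite G0 in E. nra.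
Qed.

Lemma smooth_quartic x0 k0 k1 k2 C g D D' :
  smooth (fun t x => k0 + k1 * (x - x0) + k2 * (x - x0) * (x - x0)
      - C * (x - x0) * (x - x0) * (x - x0) * (x - x0)
      + t * g - D * t * (x - x0) * (x - x0) - D' * t * t)
    (fun t x => g - D * (x - x0) * (x - x0) - 2 * D' * t)
    (fun t x => k1 + 2 * k2 * (x - x0) - 4 * C * (x - x0) * (x - x0) * (x - x0)
      - 2 * D * t * (x - x0))
    (fun t x => 2 * k2 - 12 * C * (x - x0) * (x - x0) - 2 * D * t).
Proof.
  intros t x Ht. split7; try (unfold Rminus; cont2).
  - auto_derive; [exact I|req].
  - auto_derive; [exact I|req].
  - auto_derive; [exact I|req].
Qed.

(* A test function at (t, x) is bounded below, slightly before time t, by a concave quartic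
   in space, for which an explicit classical subsolution is available. *)
Lemma super_of_flow_le sl su z M : 0 <= sl <= su ->
  (forall t x, 0 <= t -> Rabs (z t x) <= M) ->
  (forall t, 0 <= t -> bounded_lipschitz (z t)) ->
  (forall t h x, 0 <= t -> 0 <= h -> flow sl su (z t) h x <= z (t + h) x) ->
  super (G_fun sl su) z.
Proof.
  intros Hs HM Hbl Hz psi ft fx fxx t0 x0 Hpsi Ht0 [d Hd].
  set (G := G_fun sl su). pose proof (elliptic_G_fun sl su Hs) as HG. fold G in HG.
  set (K := su ^ 2 / 2) in HG. pose proof (proj1 HG) as HK.
  set (b := ft t0 x0). set (A := fxx t0 x0).
  assert (M0 : 0 <= M).
  { eapply Rle_trans; [apply Rabs_pos|]. apply (HM 0 0). lra. }
  enough (Main : forall e, 0 < e -> G (A - e) <= b + e).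
  { apply le_epsilon. intros e He.
    set (e' := e / (K + 1)). assert (He' : 0 < e') by (apply Rdiv_lt_0_compat; lra).
    specialize (Main e' He').
    destruct HG as [_ HG2]. destruct (HG2 (A - e') e') as [_ Q]; [lra|].
    replace (A - e' + e') with A in Q by ring.
    assert (E : e' * (K + 1) = e) by (unfold e'; field; lra). lra. }
  intros e He.
  destruct (smooth_lower_taylor psi ft fx fxx t0 x0 e Hpsi Ht0 He) as (r1 & Hr1 & T).
  fold b A in T. set (p := fx t0 x0) in T.
  set (r := Rmin (Rmin r1 d) (Rmin 1 t0)).
  assert (Hr : 0 < r /\ r <= r1 /\ r <= d /\ r <= 1 /\ r <= t0).
  { rmin (Rmin r1 d) (Rmin 1 t0).
    rmin r1 d. rmin 1 t0. fold r in H, H0. pose proof (cond_pos d).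
    assert (0 < r). { repeat apply Rmin_pos; lra. } lra. }
  clearbody r. destruct Hr as (Hr & R1 & R2 & R3 & R4).
  set (N := 2 * M + Rabs b + e).
  set (S := Rabs p + Rabs (A - e) + N).
  assert (S0 : 0 <= S).
  { unfold S, N. pose proof (Rabs_pos p). pose proof (Rabs_pos (A - e)). pose proof (Rabs_pos b). lra. }
  (* Beyond distance [r], where the test function says nothing, the quartic must outweigh the linear
     and quadratic terms, the time term and the oscillation of [z]; their sizes add up to [S]. *)
  set (C := S / (r * r * (r * r))).
  assert (Hr4 : 0 < r * r * (r * r)).
  { apply Rmult_lt_0_compat; now apply Rmult_lt_0_compat. }
  assert (C0 : 0 <= C).
  { apply Rmult_le_pos; trivial. now apply Rinv_nonneg. }
  set (z0 := z t0 x0).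
  assert (Low : forall h y, 0 <= h < r ->
    z0 - (b + e) * h + p * (y - x0) + (A - e) / 2 * (y - x0) * (y - x0)
      - C * (y - x0) * (y - x0) * (y - x0) * (y - x0) <= z (t0 - h) y).
  { intros h y Hh. set (u := y - x0).
    assert (Q4 : 0 <= C * u * u * u * u).
    { replace (C * u * u * u * u) with (C * ((u * u) * (u * u))) by ring.
      apply Rmult_le_pos; trivial. apply Rle_0_sqr. }
    destruct (Rlt_dec (Rabs u) r) as [c|c].
    - specialize (T h y). fold u in T. specialize (T ltac:(lra) ltac:(lra) ltac:(lra)).
      specialize (Hd (t0 - h) y). fold u in Hd.
      assert (Q : z t0 x0 - psi t0 x0 <= z (t0 - h) y - psi (t0 - h) y).
      { apply Hd; [|lra]. replace (t0 - h - t0) with (- h) by ring.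
        rewrite Rabs_Ropp, Rabs_pos_eq; lra. }
      fold z0 in Q. lra.
    - apply Rnot_lt_le in c.
      set (q := (u / r) * (u / r)).
      assert (Hq : 1 <= q).
      { unfold q. rewrite <- (Rabs_pos_eq (u / r * (u / r))) by apply Rle_0_sqr.
        rewrite Rabs_mult. unfold Rdiv. rewrite Rabs_mult, (Rabs_pos_eq (/ r)).
        2:{ now apply Rinv_nonneg. }
        assert (1 <= Rabs u * / r).
        { apply Rmult_le_reg_r with r; trivial. rewrite Rmult_assoc, Rinv_l; lra. }
        nra. }
      assert (Cu : C * u * u * u * u = S * (q * q)) by (unfold C, q; field; lra).
      assert (Uq : u * u = q * (r * r)) by (unfold q; field; lra).
      assert (U2 : u * u <= q).
      { rewrite Uq. assert (r * r <= 1) by nra. nra. }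
      assert (Q2 : q <= q * q) by nra.
      assert (U1 : Rabs u <= q).
      { apply Rsqr_incr_0_var; [|lra]. unfold Rsqr. rewrite <- Rabs_mult, Rabs_pos_eq by apply Rle_0_sqr.
        lra. }
      assert (P1 : p * u <= Rabs p * (q * q)).
      { eapply Rle_trans; [apply Rle_abs|]. rewrite Rabs_mult.
        apply Rmult_le_compat_l; [apply Rabs_pos|lra]. }
      assert (P2 : (A - e) / 2 * u * u <= Rabs (A - e) * (q * q)).
      { replace ((A - e) / 2 * u * u) with ((A - e) * (u * u / 2)) by field.
        eapply Rle_trans; [apply Rle_abs|]. rewrite Rabs_mult.
        apply Rmult_le_compat_l; [apply Rabs_pos|]. pose proof (Rle_0_sqr u) as Z. unfold Rsqr in Z.
        rewrite Rabs_pos_eq by lra. lra. }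
      assert (N0 : 0 <= N) by (unfold N; pose proof (Rabs_pos b); lra).
      assert (P3 : N <= N * (q * q)).
      { rewrite <- (Rmult_1_r N) at 1. apply Rmult_le_compat_l; trivial. lra. }
      assert (P4 : - (b + e) * h <= Rabs b + e).
      { assert (- b * h <= Rabs b).
        { eapply Rle_trans; [apply Rle_abs|]. rewrite Rabs_mult, Rabs_Ropp, (Rabs_pos_eq h) by lra.
          rewrite <- (Rmult_1_r (Rabs b)) at 2. apply Rmult_le_compat_l; [apply Rabs_pos|lra]. }
        nra. }
      assert (Z1 : z0 <= M).
      { unfold z0. specialize (HM t0 x0 ltac:(lra)). apply Rabs_le_between in HM. lra. }
      assert (Z2 : - M <= z (t0 - h) y).
      { specialize (HM (t0 - h) y ltac:(lra)). apply Rabs_le_between in HM. lra. }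
      rewrite Cu. unfold S. unfold N in *. lra. }
  (* [D] pays for the second derivative of the quartic and [D'] for that of the term with [D], each
     multiplied by [K]. The summand 1 lets [D' * t * t] dominate [t * g] up to a constant, so that
     the barrier stays bounded above. *)
  set (g := G (A - e)). set (D := 12 * K * C). set (D' := K * D + 1).
  assert (D0 : 0 <= D) by (unfold D; apply Rmult_le_pos; lra).
  assert (D'1 : 1 <= D') by (unfold D'; pose proof (Rmult_le_pos _ _ HK D0); lra).
  assert (Step : forall h, 0 <= h < r -> z0 - (b + e) * h + h * g - D' * h * h <= z0).
  { intros h Hh.
    assert (BL : bounded_lipschitz (z (t0 - h))) by (apply Hbl; lra).
    destruct (flow_solves sl su Hs _ BL) as (L1 & _ & _ & L4 & _ & L6).
    pose proof (smooth_quartic x0 (z0 - (b + e) * h) p ((A - e) / 2) C g D D') as Sq.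
    assert (V : z0 - (b + e) * h + p * (x0 - x0) + (A - e) / 2 * (x0 - x0) * (x0 - x0)
      - C * (x0 - x0) * (x0 - x0) * (x0 - x0) * (x0 - x0)
      + h * g - D * h * (x0 - x0) * (x0 - x0) - D' * h * h <= flow sl su (z (t0 - h)) h x0).
    { apply (super_ge_smooth G K _ _ _ _ _ (2 * M + g * g) HG L1 L4 Sq); [| | | |lra].
      - apply lsc_continuity_2d. intros t x _. unfold Rminus. cont2.
      - intros t x Ht. set (u := x - x0). 
        destruct HG as [_ HG2].
        assert (U0 : 0 <= u * u) by apply Rle_0_sqr.
        assert (CU0 : 0 <= C * (u * u)) by now apply Rmult_le_pos.
        assert (DT0 : 0 <= D * t) by (apply Rmult_le_pos; lra).
        destruct (HG2 (2 * ((A - e) / 2) - 12 * C * u * u - 2 * D * t) (12 * C * (u * u) + 2 * (D * t)))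
          as [_ Q]; [lra|].
        replace (2 * ((A - e) / 2) - 12 * C * u * u - 2 * D * t + (12 * C * (u * u) + 2 * (D * t)))
          with (A - e) in Q by field.
        fold g in Q. unfold D' in *. unfold D in *. lra.
      - intros x. rewrite L6. specialize (Low h x Hh). lra.
      - intros t x Ht. specialize (Low h x Hh).
        pose proof (HM (t0 - h) x ltac:(lra)) as Z1. apply Rabs_le_between in Z1.
        pose proof (flow_bounded sl su Hs (z (t0 - h)) M t x) as Z2.
        assert (Z3 : Rabs (flow sl su (z (t0 - h)) t x) <= M).
        { apply Z2; trivial. intros y. apply HM. lra. }
        apply Rabs_le_between in Z3.
        assert (0 <= D * t * (x - x0) * (x - x0)).
        { rewrite Rmult_assoc. apply Rmult_le_pos; [now apply Rmult_le_pos|apply Rle_0_sqr]. }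
        assert (t * t <= D' * t * t).
        { rewrite Rmult_assoc. pose proof (Rle_0_sqr t) as Z. unfold Rsqr in Z. nra. }
        assert (t * g <= t * t + g * g).
        { pose proof (Rle_0_sqr (t - g)) as Z. unfold Rsqr in Z.
          pose proof (Rle_0_sqr t) as Z5. pose proof (Rle_0_sqr g) as Z6. unfold Rsqr in Z5, Z6. lra. }
        lra. }
    specialize (Hz (t0 - h) h x0 ltac:(lra) ltac:(lra)).
    replace (t0 - h + h) with t0 in Hz by ring. fold z0 in Hz.
    replace (x0 - x0) with 0 in V by ring. lra. }
  apply Rnot_lt_le. intros Hlt. fold g in Hlt.
  set (h := Rmin (r / 2) ((g - (b + e)) / (2 * D'))).
  assert (Hh : 0 < h). { apply Rmin_pos; [lra|]. apply Rdiv_lt_0_compat; lra. }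
  pose proof (Rmin_l (r / 2) ((g - (b + e)) / (2 * D'))) as B1.
  pose proof (Rmin_r (r / 2) ((g - (b + e)) / (2 * D'))) as B2. fold h in B1, B2.
  specialize (Step h ltac:(lra)).
  assert (B3 : D' * h <= (g - (b + e)) / 2).
  { apply Rmult_le_compat_l with (r := D') in B2; [|lra].
    replace (D' * ((g - (b + e)) / (2 * D'))) with ((g - (b + e)) / 2) in B2 by (field; lra). lra. }
  nra.
Qed.

Lemma flow_le_flow sl su sl' su' phi t x : 0 <= sl <= sl' -> sl' <= su' <= su ->
  bounded_lipschitz phi -> 0 <= t -> flow sl' su' phi t x <= flow sl su phi t x.
Proof.
  intros H1 H2 H Ht. destruct (flow_solves sl su ltac:(lra) phi H) as (L1 & _ & [M L3] & L4 & _ & L6).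
  apply flow_le; trivial; try lra.
  - exists (- M). intros s y Hs. specialize (L3 s y Hs). apply Rabs_le_between in L3. lra.
  - apply super_weaken with (G_fun sl su); trivial. intros a. apply G_fun_le; lra.
  - intros y. rewrite L6. lra.
Qed.

Lemma flow_time_scale sl su r phi t x : 0 <= sl <= su -> 0 < r -> bounded_lipschitz phi ->
  0 <= t -> flow (r * sl) (r * su) phi t x = flow sl su phi (r * r * t) x.
Proof.
  intros Hs Hr H Ht.
  assert (Aff : phi = fun x => 1 * phi (1 * x + 0)).
  { apply functional_extensionality; intros y. now rewrite !Rmult_1_l, Rplus_0_r. }
  rewrite Aff at 1. rewrite flow_rescale; trivial; try lra.
  rewrite !Rmult_1_l, Rplus_0_r. f_equal. ring.
Qed.

(* For the ordering of the ratios below, G_1 is the maximum of two positive multiples of G_2,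
   and the flows of these multiples commute with that of G_2. *)
Lemma flow_commute_le sl1 su1 sl2 su2 phi s t x : 0 < sl1 <= su1 -> 0 < sl2 <= su2 ->
  su2 / sl2 <= su1 / sl1 -> bounded_lipschitz phi -> 0 <= s -> 0 <= t ->
  flow sl1 su1 (flow sl2 su2 phi s) t x <= flow sl2 su2 (flow sl1 su1 phi t) s x.
Proof.
  intros H1 H2 Hr H H0 Ht.
  assert (Hr' : su2 * sl1 <= su1 * sl2).
  { apply Rmult_le_compat_r with (r := sl1 * sl2) in Hr; [|nra].
    replace (su2 / sl2 * (sl1 * sl2)) with (su2 * sl1) in Hr by (field; lra).
    replace (su1 / sl1 * (sl1 * sl2)) with (su1 * sl2) in Hr by (field; lra). exact Hr. }
  assert (S1 : 0 <= sl1 <= su1) by lra. assert (S2 : 0 <= sl2 <= su2) by lra.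
  set (z := fun t x => flow sl2 su2 (flow sl1 su1 phi t) s x).
  pose proof H as H'. apply bounded_lipschitz_iff in H'. destruct H' as (M & L & HM & HL).
  assert (B1 : forall t, 0 <= t -> bounded_lipschitz (flow sl1 su1 phi t)).
  { intros u Hu. now apply flow_bl. }
  assert (zM : forall t x, 0 <= t -> Rabs (z t x) <= M).
  { intros u y Hu. apply flow_bounded; trivial. intros w. now apply flow_bounded. }
  assert (zL : forall t x y, 0 <= t -> Rabs (z t x - z t y) <= L * Rabs (x - y)).
  { intros u y w Hu. unfold z, flow.
    apply (perron_lip _ _ (elliptic_G_fun _ _ S2) (G_fun_0 sl2 su2) _ M); trivial.
    - intros v. now apply flow_bounded.
    - intros v v'. now apply (perron_lip _ _ (elliptic_G_fun _ _ S1) (G_fun_0 sl1 su1) _ M). }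
  assert (zT : time_equicont z).
  { intros e He. destruct (flow_equicont sl1 su1 S1 phi H (e / 2)) as (d & Hd & Hd'); [lra|].
    exists d. split; trivial. intros u w y Hu Hw Huw.
    apply Rle_lt_trans with (e / 2); [|lra].
    apply flow_contraction; trivial; auto.
    intros v. left. now apply Hd'. }
  destruct (lsc_equicont z L (lipschitz_pos _ _ HL) zT zL) as [Lz _].
  (* The flow with volatilities [r * sl2] and [r * su2] is a time change of the outer flow in [z],
     hence commutes with it; it lies below the flow of [G_1] because its volatility interval is
     contained in that of [G_1]. *)
  assert (zS : forall r, 0 < r -> sl1 <= r * sl2 -> r * su2 <= su1 ->
    super (G_fun (r * sl2) (r * su2)) z).
  { intros r Hr0 A1 A2.
    assert (S3 : 0 <= r * sl2 <= r * su2).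
    { split; [apply Rmult_le_pos; lra|apply Rmult_le_compat_l; lra]. }
    apply super_of_flow_le with M; trivial.
    - intros u Hu. unfold z. apply flow_bl; auto.
    - intros u h y Hu Hh. unfold z at 1.
      assert (Hrh : 0 <= r * r * h) by (apply Rmult_le_pos; trivial; apply Rle_0_sqr).
      rewrite flow_time_scale; trivial. 2:{ apply flow_bl; auto. }
      rewrite flow_semigroup; auto. rewrite Rplus_comm.
      rewrite <- flow_semigroup; auto.
      unfold z. rewrite <- (Rplus_0_r (flow sl2 su2 (flow sl1 su1 phi (u + h)) s y)).
      apply flow_monotone; trivial.
      + apply flow_bl; auto.
      + apply B1; lra.
      + intros w. rewrite Rplus_0_r, <- flow_time_scale; auto.
        rewrite Rplus_comm, <- flow_semigroup; trivial.
        apply flow_le_flow; auto; lra. }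
  assert (zG : super (G_fun sl1 su1) z).
  { intros psi ft fx fxx u y Hp Hu Htouch.
    (* At a contact point only one branch of [G_1] matters: [r = su1 / su2] reproduces it for
       nonnegative second derivative and [r = sl1 / sl2] for negative. The order of the ratios makes
       both values admissible in [zS]. *)
    destruct (Rle_dec 0 (fxx u y)) as [c|c].
    - assert (R0 : 0 < su1 / su2) by (apply Rdiv_lt_0_compat; lra).
      assert (E : su1 / su2 * su2 = su1) by (field; lra).
      pose proof (zS (su1 / su2) R0) as Q. rewrite E in Q.
      assert (Q' : G_fun (su1 / su2 * sl2) su1 (fxx u y) <= ft u y).
      { apply (Q) with psi fx; trivial; [|lra].
        apply Rmult_le_reg_r with su2; [lra|].
        replace (su1 / su2 * sl2 * su2) with (su1 * sl2) by (field; lra). lra. }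
      rewrite G_fun_pos in *; trivial.
    - assert (R0 : 0 < sl1 / sl2) by (apply Rdiv_lt_0_compat; lra).
      assert (E : sl1 / sl2 * sl2 = sl1) by (field; lra).
      pose proof (zS (sl1 / sl2) R0) as Q. rewrite E in Q.
      assert (Q' : G_fun sl1 (sl1 / sl2 * su2) (fxx u y) <= ft u y).
      { apply (Q) with psi fx; trivial; [lra|].
        apply Rmult_le_reg_r with sl2; [lra|].
        replace (sl1 / sl2 * su2 * sl2) with (su2 * sl1) by (field; lra). lra. }
      rewrite G_fun_neg in *; lra. }
  apply (flow_le sl1 su1 S1 (flow sl2 su2 phi s) z); trivial.
  - now apply flow_bl.
  - exists (- M). intros u y Hu. specialize (zM u y Hu). apply Rabs_le_between in zM. lra.
  - intros y. unfold z. rewrite <- (Rplus_0_r (flow sl2 su2 (flow sl1 su1 phi 0) s y)).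
    apply flow_monotone; trivial. { apply B1; lra. }
    intros w. rewrite flow_0; trivial. lra.
Qed.

(** * Strict monotonicity *)

Lemma G_fun_subadd sl su a b : 0 <= sl <= su ->
  G_fun sl su (a + b) <= G_fun sl su a + G_fun sl su b.
Proof.
  intros H. pose proof (sq_le _ _ H). pose proof (pow2_ge_0 sl).
  set (p := sl ^ 2) in *. set (q := su ^ 2) in *.
  assert (E : forall x, (0 <= x -> G_fun sl su x = q * x / 2) /\ (x <= 0 -> G_fun sl su x = p * x / 2)).
  { intros x. split; intros; unfold p, q; [now apply G_fun_pos|now apply G_fun_neg]. }
  destruct (Rle_dec 0 a) as [A|A], (Rle_dec 0 b) as [B|B], (Rle_dec 0 (a + b)) as [C|C];
  try lra;
  repeat match goal with |- context [G_fun sl su ?x] =>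
    first [rewrite (proj1 (E x)) by lra | rewrite (proj2 (E x)) by lra] end; nra.
Qed.

(** Subadditivity of [G] gives [G a + Gbar G b <= G (a + b)], so a subsolution of the dual equation
    may be added to any subsolution. *)
Lemma sub_add_smooth sl su u b bt bx bxx : 0 <= sl <= su ->
  super (Gbar (G_fun sl su)) (fun t x => - u t x) -> smooth b bt bx bxx ->
  (forall t x, 0 < t -> bt t x <= Gbar (G_fun sl su) (bxx t x)) ->
  super (Gbar (G_fun sl su)) (fun t x => - (u t x + b t x)).
Proof.
  intros Hs Hu Hb Hbt psi ft fx fxx t x Hp Ht [d Hd].
  pose proof (smooth_plus _ _ _ _ _ _ _ _ Hp Hb) as S.
  pose proof (Hu _ _ _ _ t x S Ht) as F. cbv beta in F. specialize (Hbt t x Ht).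
  unfold Gbar in *.
  assert (Q : - G_fun sl su (- (fxx t x + bxx t x)) <= ft t x + bt t x).
  { apply F. exists d. intros s y H1 H2. specialize (Hd s y H1 H2). cbv beta in Hd. lra. }
  pose proof (G_fun_subadd sl su (- fxx t x) (- bxx t x) Hs) as A.
  replace (- fxx t x + - bxx t x) with (- (fxx t x + bxx t x)) in A by ring.
  lra.
Qed.

(** The exponential of this is a Gaussian of variance [c * (t + th)], with the power [m] of time in
    place of the power 1/2 of the heat kernel. *)
Definition bump_exp (m c th y t x : R) : R :=
  - m * ln (t + th) - (x - y) * (x - y) / (2 * c * (t + th)).

Lemma bump_smooth m c th y k : 0 < c -> 0 < th ->
  (forall t x, 0 <= t -> continuity_2d_pt (bump_exp m c th y) t x) /\
  smooth (fun t x => exp (bump_exp m c th y t x) - k)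
    (fun t x => exp (bump_exp m c th y t x) *
       (- m / (t + th) + (x - y) * (x - y) / (2 * c * (t + th) * (t + th))))
    (fun t x => exp (bump_exp m c th y t x) * (- (x - y) / (c * (t + th))))
    (fun t x => exp (bump_exp m c th y t x) *
       ((x - y) * (x - y) / (c * c * (t + th) * (t + th)) - 1 / (c * (t + th)))).
Proof.
  intros Hc Hth.
  assert (I : forall t x, 0 <= t -> continuity_2d_pt (fun t _ => / (t + th)) t x).
  { intros t x Ht. apply continuity_2d_pt_inv; [cont2|lra]. }
  assert (B : forall t x, 0 <= t -> continuity_2d_pt (bump_exp m c th y) t x).
  { intros t x Ht.
    apply continuity_2d_pt_ext_loc with
      (fun t x => - m * ln (t + th) - (x - y) * (x - y) * (/ (2 * c)) * / (t + th)).
    - exists (mkposreal th Hth). simpl. intros u v Hu _. unfold bump_exp.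
      apply Rabs_def2 in Hu. field. lra.
    - apply continuity_2d_pt_minus.
      + apply continuity_2d_pt_mult; [apply continuity_2d_pt_const|].
        apply (continuity_1d_2d_pt_comp ln (fun t _ => t + th)); [|cont2].
        apply derivable_continuous_pt. exists (/ (t + th)). apply derivable_pt_lim_ln. lra.
      + apply continuity_2d_pt_mult; [unfold Rminus; cont2|now apply I]. }
  split; trivial. intros t x Ht.
  assert (E : continuity_2d_pt (fun t x => exp (bump_exp m c th y t x)) t x).
  { apply (continuity_1d_2d_pt_comp exp (bump_exp m c th y)); [|apply B; lra].
    apply derivable_continuous_pt, derivable_pt_exp. }
  assert (I' := I t x (Rlt_le _ _ Ht)).
  assert (X : forall f g, (forall s z, 0 < s -> f s z = g s z) -> continuity_2d_pt f t x ->
    continuity_2d_pt g t x).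
  { intros f g Hfg Hf. apply continuity_2d_pt_ext_loc with f; trivial.
    destruct (locally_2d_pos t x Ht) as [d Hd]. exists d. intros u v Hu Hv.
    now apply Hfg, (Hd u v). }
  split7.
  - unfold bump_exp. auto_derive. { repeat split; try lra; apply Rgt_not_eq; nra. }
    real_eq. unfold Rminus, Rdiv.
    match goal with |- context [exp ?u] => generalize (exp u) end. intros. field. lra.
  - unfold bump_exp. auto_derive. { repeat split; try lra; apply Rgt_not_eq; nra. }
    real_eq. unfold Rminus, Rdiv.
    match goal with |- context [exp ?u] => generalize (exp u) end. intros. field. lra.
  - unfold bump_exp. auto_derive. { repeat split; try lra; apply Rgt_not_eq; nra. }
    real_eq. unfold Rminus, Rdiv.
    match goal with |- context [exp ?u] => generalize (exp u) end. intros. field. lra.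
  - apply continuity_2d_pt_minus; trivial. apply continuity_2d_pt_const.
  - apply continuity_2d_pt_mult; trivial.
    apply X with (fun t x => - m * / (t + th) + (x - y) * (x - y) * (/ (2 * c)) * / (t + th) * / (t + th)).
    + intros s z Hs. field. lra.
    + apply continuity_2d_pt_plus; repeat apply continuity_2d_pt_mult; trivial;
      unfold Rminus; cont2.
  - apply continuity_2d_pt_mult; trivial.
    apply X with (fun t x => - (x - y) * / c * / (t + th)).
    + intros s z Hs. field. lra.
    + repeat apply continuity_2d_pt_mult; trivial; unfold Rminus; cont2.
  - apply continuity_2d_pt_mult; trivial.
    apply X with (fun t x => (x - y) * (x - y) * (/ (c * c)) * / (t + th) * / (t + th) - / c * / (t + th)).
    + intros s z Hs. field. lra.
    + apply continuity_2d_pt_minus; repeat apply continuity_2d_pt_mult; trivial;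
      unfold Rminus; cont2.
Qed.

(** In the convex region [q >= 1] the dual operator acts with [sl], to which the variance is
    matched; near the peak it acts with [su], for which the power [m] pays. Both cases come down to
    [1 / 2 <= m]. *)
Lemma bump_subsolution sl su th y t x : 0 < sl <= su -> 0 < th -> 0 < t ->
  - (su ^ 2 / (2 * sl ^ 2)) / (t + th) + (x - y) * (x - y) / (2 * sl ^ 2 * (t + th) * (t + th)) <=
  Gbar (G_fun sl su)
    ((x - y) * (x - y) / (sl ^ 2 * sl ^ 2 * (t + th) * (t + th)) - 1 / (sl ^ 2 * (t + th))).
Proof.
  intros H Hth Ht. set (c := sl ^ 2).
  assert (Hc : 0 < c) by (unfold c; apply pow_lt; lra).
  assert (Hcs : c <= su ^ 2) by (apply sq_le; lra).
  set (T := t + th). assert (HT : 0 < T) by (unfold T; lra).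
  set (m := su ^ 2 / (2 * c)).
  assert (Hm : 1 / 2 <= m).
  { unfold m. apply Rmult_le_reg_r with (2 * c); [lra|].
    replace (su ^ 2 / (2 * c) * (2 * c)) with (su ^ 2) by (field; lra). lra. }
  set (q := (x - y) * (x - y) / (c * T)).
  assert (Hq : 0 <= q).
  { apply Rmult_le_pos; [apply Rle_0_sqr|]. left. apply Rinv_0_lt_compat.
    now apply Rmult_lt_0_compat. }
  replace (- m / T + (x - y) * (x - y) / (2 * c * T * T)) with (/ T * (- m + q / 2))
    by (unfold q; field; lra).
  replace ((x - y) * (x - y) / (c * c * T * T) - 1 / (c * T)) with (/ T * / c * (q - 1))
    by (unfold q; field; lra).
  assert (P : 0 < / T) by now apply Rinv_0_lt_compat.
  assert (P' : 0 < / c) by now apply Rinv_0_lt_compat.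
  unfold Gbar. replace (- (/ T * / c * (q - 1))) with (/ T * (/ c * (1 - q))) by ring.
  rewrite G_fun_scale by trivial. rewrite G_fun_scale by trivial.
  assert (Q : / c * G_fun sl su (1 - q) <= m - q / 2).
  { destruct (Rle_dec 0 (1 - q)).
    - rewrite G_fun_pos by lra.
      replace (/ c * (su ^ 2 * (1 - q) / 2)) with (m * (1 - q)) by (unfold m; field; lra). nra.
    - rewrite G_fun_neg by lra. fold c.
      replace (/ c * (c * (1 - q) / 2)) with ((1 - q) / 2) by (field; lra). lra. }
  apply Rmult_le_compat_l with (r := / T) in Q; lra.
Qed.

(** With [th = / (w * w)] and [ln w <= w] the right side is at least [a * w * w - 2 * m * w], and
    [w] is chosen to make [a * w] large enough. *)
Lemma bump_time m a N : 0 <= m -> 0 < a -> exists th, 0 < th <= 1 /\ N < m * ln th + a / th.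
Proof.
  intros Hm Ha. set (w := 1 + (2 * m + Rabs N + 1) / a).
  assert (W : 0 < (2 * m + Rabs N + 1) / a).
  { apply Rdiv_lt_0_compat; trivial. pose proof (Rabs_pos N). lra. }
  assert (Hw : 1 <= w) by (unfold w; lra).
  assert (Ew : a * w = a + (2 * m + Rabs N + 1)) by (unfold w; field; lra).
  exists (/ (w * w)). assert (H1 : 1 <= w * w) by nra.
  split. { split; [apply Rinv_0_lt_compat; lra|]. rewrite <- Rinv_1. apply Rinv_le_contravar; lra. }
  rewrite ln_Rinv by lra. rewrite ln_mult by lra.
  assert (L : ln w <= w).
  { pose proof (exp_ineq1_le (ln w)) as Q. rewrite exp_ln in Q by lra. lra. }
  assert (L2 : m * ln w <= m * w) by (apply Rmult_le_compat_l; trivial).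
  replace (a / / (w * w)) with (a * w * w) by (field; lra). rewrite Ew.
  pose proof (Rle_abs N). pose proof (Rabs_pos N). nra.
Qed.

(** If [f] exceeds [g] at [y], a bump positive only near [y] at time 0 can be added to the flow of
    [g] below the flow of [f]; the bump is arranged to be positive at [(t, x)], which rules out
    equality there. *)
Lemma flow_strict sl su f g t x : 0 < sl <= su -> bounded_lipschitz f -> bounded_lipschitz g ->
  (forall y, g y <= f y) -> 0 < t -> flow sl su f t x = flow sl su g t x ->
  forall y, f y = g y.
Proof.
  intros Hs Hf Hg Hle Ht E y. apply NNPP. intros Hne.
  set (e := f y - g y). assert (He : 0 < e) by (specialize (Hle y); unfold e; lra).
  assert (exists r, 0 < r /\ forall z, Rabs (z - y) < r -> e / 2 <= f z - g z).
  { destruct Hf as [_ [L1 HL1]]. destruct Hg as [_ [L2 HL2]].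
    pose proof (lipschitz_pos _ _ HL1) as P1. pose proof (lipschitz_pos _ _ HL2) as P2.
    set (r := e / (2 * (L1 + L2 + 1))).
    assert (Hr : 0 < r) by (apply Rdiv_lt_0_compat; lra).
    assert (Er : r * (2 * (L1 + L2 + 1)) = e) by (unfold r; field; lra).
    exists r. split; trivial. intros z Hz.
    pose proof (HL1 z y) as A. pose proof (HL2 z y) as B.
    apply Rabs_le_between in A, B. pose proof (Rabs_pos (z - y)). unfold e in *. nra. }
  destruct H as (r & Hr & Hfg).
  assert (S : 0 <= sl <= su) by lra.
  set (c := sl ^ 2). assert (Hc : 0 < c) by (unfold c; apply pow_lt; lra).
  set (m := su ^ 2 / (2 * c)).
  assert (Hm : 0 <= m).
  { apply Rmult_le_pos; [apply pow2_ge_0|]. left. apply Rinv_0_lt_compat. lra. }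
  set (N := m * ln (t + 1) + (x - y) * (x - y) / (2 * c * t)).
  destruct (bump_time m (r * r / (2 * c)) N Hm) as (th & [Hth Hth1] & HN).
  { apply Rdiv_lt_0_compat; nra. }
  (* [k] is the height of the Gaussian at distance [r] at time 0, so subtracting it leaves nothing
     positive farther out. [eps] keeps the bump below [e / 2], and [th] is small enough for the
     Gaussian to exceed [k] at [(t, x)]. *)
  set (k := exp (- m * ln th - r * r / (2 * c) / th)).
  set (eps := e / 2 * exp (m * ln th)).
  assert (Heps : 0 < eps) by (apply Rmult_lt_0_compat; [lra|apply exp_pos]).
  destruct (bump_smooth m c th y k Hc Hth) as [Bc Bs].
  pose proof (smooth_scal eps _ _ _ _ Bs) as Bs'. cbv beta in Bs'.
  set (b := fun t x => eps * (exp (bump_exp m c th y t x) - k)) in *.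
  assert (Emax : forall s z, 0 <= s -> bump_exp m c th y s z <= - m * ln th).
  { intros s z Hs'. unfold bump_exp.
    assert (ln th <= ln (s + th)).
    { destruct (Rle_lt_or_eq_dec 0 s Hs') as [l|<-]; [|rewrite Rplus_0_l; lra].
      left. apply ln_increasing; lra. }
    assert (m * ln th <= m * ln (s + th)) by now apply Rmult_le_compat_l.
    assert (0 <= (z - y) * (z - y) / (2 * c * (s + th))).
    { apply Rmult_le_pos; [apply Rle_0_sqr|]. left. apply Rinv_0_lt_compat. nra. }
    lra. }
  assert (exp_mono : forall u v, u <= v -> exp u <= exp v).
  { intros u v [l| ->]; [left; now apply exp_increasing|lra]. }
  assert (k0 : 0 < k) by apply exp_pos.
  assert (bmax : forall s z, 0 <= s -> b s z <= e / 2).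
  { intros s z Hs'. unfold b. specialize (exp_mono _ _ (Emax s z Hs')).
    replace (e / 2) with (eps * exp (- m * ln th)).
    - apply Rmult_le_compat_l; lra.
    - unfold eps. rewrite Rmult_assoc, <- exp_plus.
      replace (m * ln th + - m * ln th) with 0 by ring. rewrite exp_0. ring. }
  destruct (flow_solves sl su S g Hg) as (G1 & G2 & [M G3] & G4 & G5 & G6).
  assert (Q : flow sl su g t x + b t x <= flow sl su f t x).
  { apply (flow_ge sl su S f (fun t x => flow sl su g t x + b t x)); trivial; [| | | |lra].
    - replace (fun t x => - (flow sl su g t x + b t x))
        with (fun t x => - flow sl su g t x + - b t x).
      2:{ fun_ext2 s z. ring. }
      apply (lsc_plus (fun t x => - flow sl su g t x) (fun t x => - b t x)); trivial.
      apply lsc_continuity_2d. intros s z Hs'. apply continuity_2d_pt_opp. unfold b.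
      apply continuity_2d_pt_mult; [apply continuity_2d_pt_const|].
      apply continuity_2d_pt_minus; [|apply continuity_2d_pt_const].
      apply (continuity_1d_2d_pt_comp exp (bump_exp m c th y)); [|now apply Bc].
      apply derivable_continuous_pt, derivable_pt_exp.
    - exists (M + e / 2). intros s z Hs'. specialize (G3 s z Hs'). apply Rabs_le_between in G3.
      specialize (bmax s z Hs'). lra.
    - apply sub_add_smooth with (1 := S) (2 := G5) (3 := Bs').
      intros s z Hs'. pose proof (bump_subsolution sl su th y s z Hs Hth Hs') as Q.
      fold c m in Q. cbv beta.
      unfold Gbar in *.
      set (ee := exp (bump_exp m c th y s z)) in *.
      assert (He0 : 0 < eps * ee) by (apply Rmult_lt_0_compat; trivial; apply exp_pos).
      rewrite <- !(Rmult_assoc eps).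
      rewrite Ropp_mult_distr_r, G_fun_scale by trivial.
      rewrite Ropp_mult_distr_r. apply Rmult_le_compat_l; lra.
    - intros z. rewrite G6. destruct (Rlt_dec (Rabs (z - y)) r) as [l|l].
      + specialize (Hfg z l). specialize (bmax 0 z (Rle_refl 0)). lra.
      + assert (b 0 z <= 0); [|specialize (Hle z); lra].
        unfold b. assert (exp (bump_exp m c th y 0 z) <= k).
        { apply exp_mono. unfold bump_exp. rewrite Rplus_0_l.
          assert (r * r <= (z - y) * (z - y)).
          { rewrite <- (Rabs_pos_eq ((z - y) * (z - y))) by apply Rle_0_sqr.
            rewrite Rabs_mult. apply Rmult_le_compat; lra. }
          replace (r * r / (2 * c) / th) with (r * r / (2 * c * th)) by (field; lra).
          assert (r * r / (2 * c * th) <= (z - y) * (z - y) / (2 * c * th)).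
          { apply Rmult_le_compat_r; trivial. left. apply Rinv_0_lt_compat. nra. }
          lra. }
        nra. }
  assert (P : k < exp (bump_exp m c th y t x)).
  { apply exp_increasing. unfold bump_exp.
    assert (A1 : ln (t + th) <= ln (t + 1)).
    { destruct (Rle_lt_or_eq_dec th 1 Hth1) as [l| ->]; [|lra]. left. apply ln_increasing; lra. }
    assert (A2 : m * ln (t + th) <= m * ln (t + 1)) by now apply Rmult_le_compat_l.
    assert (A3 : (x - y) * (x - y) / (2 * c * (t + th)) <= (x - y) * (x - y) / (2 * c * t)).
    { apply Rmult_le_compat_l; [apply Rle_0_sqr|]. apply Rinv_le_contravar; nra. }
    unfold N in HN. lra. }
  assert (0 < b t x) by (unfold b; apply Rmult_lt_0_compat; lra). lra.
Qed.

(** * The periodic eigenfunction *)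

Definition glue (c : R) (f g : R -> R) (y : R) : R := if Rle_dec y c then f y else g y.

Lemma is_derive_glue c (f g f1 g1 : R -> R) :
  (forall y : R, is_derive f y (f1 y)) -> (forall y : R, is_derive g y (g1 y)) ->
  f c = g c -> f1 c = g1 c -> forall y : R, is_derive (glue c f g) y (glue c f1 g1 y).
Proof.
  intros Hf Hg E E1 y. destruct (Rtotal_order y c) as [l|[l|l]].
  - replace (glue c f1 g1 y) with (f1 y).
    2:{ unfold glue. destruct (Rle_dec y c); lra. }
    apply is_derive_ext_loc with f; [|apply Hf].
    assert (P : 0 < c - y) by lra. exists (mkposreal _ P). intros z Hz.
    unfold ball in Hz; simpl in Hz. unfold AbsRing_ball, abs, minus, plus, opp in Hz; simpl in Hz.
    apply Rabs_def2 in Hz. unfold glue. destruct (Rle_dec z c); lra.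
  - subst y. replace (glue c f1 g1 c) with (f1 c).
    2:{ unfold glue. destruct (Rle_dec c c); lra. }
    apply is_derive_eps. intros e He.
    destruct (proj1 (is_derive_eps _ _ _) (Hf c) e He) as (d1 & D1 & E2).
    destruct (proj1 (is_derive_eps _ _ _) (Hg c) e He) as (d2 & D2 & E3).
    exists (Rmin d1 d2). split. { now apply Rmin_pos. }
    intros z Hz. rmin d1 d2.
    unfold glue at 2. destruct (Rle_dec c c); [|lra].
    unfold glue. destruct (Rle_dec z c).
    + apply E2. lra. + rewrite E, E1. apply E3. lra.
  - replace (glue c f1 g1 y) with (g1 y).
    2:{ unfold glue. destruct (Rle_dec y c); lra. }
    apply is_derive_ext_loc with g; [|apply Hg].
    assert (P : 0 < y - c) by lra. exists (mkposreal _ P). intros z Hz.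
    unfold ball in Hz; simpl in Hz. unfold AbsRing_ball, abs, minus, plus, opp in Hz; simpl in Hz.
    apply Rabs_def2 in Hz. unfold glue. destruct (Rle_dec z c); lra.
Qed.

Definition periodize (l : R) (f : R -> R) (x : R) : R :=
  f (x - 2 * l * IZR (Int_part ((x + l) / (2 * l)))).

Lemma periodize_eq l f x m : 0 < l -> - l <= x - 2 * l * IZR m < l ->
  periodize l f x = f (x - 2 * l * IZR m).
Proof.
  intros Hl H. unfold periodize.
  replace (Int_part ((x + l) / (2 * l))) with m; trivial.
  apply Int_part_spec. 
  assert (E : (x + l) / (2 * l) = IZR m + (x - 2 * l * IZR m + l) / (2 * l)) by (field; lra).
  assert (0 <= (x - 2 * l * IZR m + l) / (2 * l)).
  { apply Rmult_le_pos; [lra|]. left. apply Rinv_0_lt_compat. lra. }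
  assert ((x - 2 * l * IZR m + l) / (2 * l) < 1).
  { apply Rmult_lt_reg_r with (2 * l); [lra|].
    replace ((x - 2 * l * IZR m + l) / (2 * l) * (2 * l)) with (x - 2 * l * IZR m + l) by (field; lra).
    lra. }
  rewrite E. set (q := (x - 2 * l * IZR m + l) / (2 * l)) in *. clearbody q. lra.
Qed.

Lemma periodize_index l x : 0 < l -> exists m, - l <= x - 2 * l * IZR m < l.
Proof.
  intros Hl. exists (Int_part ((x + l) / (2 * l))).
  destruct (base_Int_part ((x + l) / (2 * l))) as [A B].
  set (n := IZR (Int_part ((x + l) / (2 * l)))) in *.
  apply Rmult_le_compat_r with (r := 2 * l) in A; [|lra].
  assert (B' : (x + l) / (2 * l) < n + 1) by lra.
  apply Rmult_lt_compat_r with (r := 2 * l) in B'; [|lra].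
  replace ((x + l) / (2 * l) * (2 * l)) with (x + l) in A, B' by (field; lra). lra.
Qed.

Lemma periodize_near l d f m x : 0 < l -> 0 < d <= 2 * l ->
  (forall w, - l - d < w < - l -> f (w + 2 * l) = f w) ->
  - l - d < x - 2 * l * IZR m < l -> periodize l f x = f (x - 2 * l * IZR m).
Proof.
  intros Hl Hd Hov H. destruct (Rle_dec (- l) (x - 2 * l * IZR m)).
  - apply periodize_eq; trivial. lra.
  - rewrite (periodize_eq l f x (m - 1)%Z); trivial; rewrite minus_IZR.
    + rewrite <- (Hov (x - 2 * l * IZR m)) by lra. f_equal. ring.
    + lra.
Qed.

(** On a collar of width [d] beyond the seam, [f] itself still agrees with its periodization, so
    differentiability at the seam is that of [f]. *)
Lemma is_derive_periodize l d f f1 : 0 < l -> 0 < d <= 2 * l ->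
  (forall w, - l - d < w < - l -> f (w + 2 * l) = f w) ->
  (forall y : R, is_derive f y (f1 y)) ->
  forall x : R, is_derive (periodize l f) x (periodize l f1 x).
Proof.
  intros Hl Hd Hov Hf x. destruct (periodize_index l x Hl) as [m Hm].
  rewrite (periodize_eq l f1 x m Hl Hm).
  apply is_derive_ext_loc with (fun x => f (x - 2 * l * IZR m)).
  - assert (P : 0 < Rmin d (l - (x - 2 * l * IZR m))) by (apply Rmin_pos; lra).
    exists (mkposreal _ P). intros z Hz.
    unfold ball in Hz; simpl in Hz. unfold AbsRing_ball, abs, minus, plus, opp in Hz; simpl in Hz.
    rmin d (l - (x - 2 * l * IZR m)).
    apply Rabs_def2 in Hz. symmetry. apply periodize_near with d; trivial. lra.
  - apply (is_derive_shift f (- (2 * l * IZR m)) x); trivial.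
Qed.

Lemma smooth_exp_decay eta p1 p2 : (forall x : R, is_derive eta x (p1 x)) ->
  (forall x : R, is_derive p1 x (p2 x)) -> (forall x, continuity_pt p2 x) ->
  smooth (fun t x => exp (- t / 2) * eta x) (fun t x => - / 2 * (exp (- t / 2) * eta x))
    (fun t x => exp (- t / 2) * p1 x) (fun t x => exp (- t / 2) * p2 x).
Proof.
  intros D1 D2 C2 s y _.
  assert (C : forall f, continuity_pt f y -> continuity_2d_pt (fun t x => exp (- t / 2) * f x) s y).
  { intros f Hf. apply continuity_2d_pt_mult.
    - apply (continuity_1d_2d_pt_comp (fun t => exp (- t / 2)) (fun t _ => t)); [|apply continuity_2d_pt_id1].
      apply continuity_pt_derive with (- 1 / 2 * exp (- s / 2)).
      auto_derive; [exact I|]. real_eq.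
      unfold Rdiv. ring.
    - now apply continuity_2d_snd. }
  pose proof (continuity_pt_derive _ _ _ (D1 y)) as C0.
  pose proof (continuity_pt_derive _ _ _ (D2 y)) as C1.
  split7; try (now apply C).
  - auto_derive; [exact I|]. real_eq.
    unfold Rdiv. ring.
  - apply (is_derive_scal eta), D1.
  - apply (is_derive_scal p1), D2.
  - apply continuity_2d_pt_mult; [apply continuity_2d_pt_const|now apply C].
Qed.

Section Eigenfunction.
Variables sl su : R.
Hypothesis H : 0 < sl <= su.

Definition lobe : R := sl * (PI / 2).
Definition half_period : R := lobe + su * (PI / 2).

(** Where [G(phi'') = - phi / 2] has a positive solution it is concave, [G] acts with [sl], and the
    equation is an oscillator of frequency [/ sl]; on negative values the frequency is [/ su].
    Amplitudes [sl] and [su] give slopes of modulus 1 at the zeros, so the arcs fit together to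
    second order. *)
Definition arch : R -> R :=
  glue (- lobe) (fun y => - su * sin ((- y - lobe) / su))
    (glue lobe (fun y => sl * cos (y / sl)) (fun y => - su * sin ((y - lobe) / su))).
Definition arch1 : R -> R :=
  glue (- lobe) (fun y => cos ((- y - lobe) / su))
    (glue lobe (fun y => - sin (y / sl)) (fun y => - cos ((y - lobe) / su))).
Definition arch2 : R -> R :=
  glue (- lobe) (fun y => sin ((- y - lobe) / su) / su)
    (glue lobe (fun y => - cos (y / sl) / sl) (fun y => sin ((y - lobe) / su) / su)).

Definition eigenfunction : R -> R := periodize half_period arch.

Lemma lobe_pos : 0 < lobe /\ lobe < half_period.
Proof.
  unfold half_period, lobe. pose proof PI_RGT_0. split; [nra|].
  assert (0 < su * (PI / 2)) by (apply Rmult_lt_0_compat; lra). lra.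
Qed.

Lemma lobe_div : lobe / sl = PI / 2.
Proof. unfold lobe. field. lra. Qed.

Lemma glue_at c f g y : (y <= c -> glue c f g y = f y) /\ (c < y -> glue c f g y = g y).
Proof. unfold glue. destruct (Rle_dec y c); split; intros; trivial; lra. Qed.

Lemma glue_corner : glue lobe (fun y => sl * cos (y / sl)) (fun y => - su * sin ((y - lobe) / su)) (- lobe) = 0 /\
  glue lobe (fun y => - sin (y / sl)) (fun y => - cos ((y - lobe) / su)) (- lobe) = 1.
Proof.
  destruct lobe_pos as [L _].
  rewrite !(proj1 (glue_at _ _ _ _)) by lra.
  replace (- lobe / sl) with (- (PI / 2)) by (rewrite <- lobe_div; field; lra).
  rewrite cos_neg, sin_neg, cos_PI2, sin_PI2. split; ring.
Qed.

Lemma is_derive_arch : forall y : R, is_derive arch y (arch1 y).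
Proof.
  destruct glue_corner as [C0 C1].
  apply is_derive_glue.
  - intros y. auto_derive; [exact I|].
    real_eq.
    replace (- y + - lobe) with (- y - lobe) by ring. unfold Rdiv. field. lra.
  - apply is_derive_glue.
    + intros y. auto_derive; [exact I|].
      real_eq. unfold Rdiv. field. lra.
    + intros y. auto_derive; [exact I|].
      real_eq.
      replace (y + - lobe) with (y - lobe) by ring. unfold Rdiv. field. lra.
    + rewrite lobe_div, cos_PI2. replace ((lobe - lobe) / su) with 0 by (field; lra).
      rewrite sin_0. ring.
    + rewrite lobe_div, sin_PI2. replace ((lobe - lobe) / su) with 0 by (field; lra).
      rewrite cos_0. ring.
  - rewrite C0. replace ((- - lobe - lobe) / su) with 0 by (field; lra). rewrite sin_0. ring.
  - rewrite C1. replace ((- - lobe - lobe) / su) with 0 by (field; lra). rewrite cos_0. ring.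
Qed.

Lemma is_derive_arch1 : forall y : R, is_derive arch1 y (arch2 y).
Proof.
  destruct lobe_pos as [L _]. destruct glue_corner as [C0 C1].
  apply is_derive_glue.
  - intros y. auto_derive; [exact I|].
    real_eq.
    replace (- y + - lobe) with (- y - lobe) by ring. unfold Rdiv. field. lra.
  - apply is_derive_glue.
    + intros y. auto_derive; [exact I|].
      real_eq. unfold Rdiv. field. lra.
    + intros y. auto_derive; [exact I|].
      real_eq.
      replace (y + - lobe) with (y - lobe) by ring. unfold Rdiv. field. lra.
    + rewrite lobe_div, sin_PI2. replace ((lobe - lobe) / su) with 0 by (field; lra).
      rewrite cos_0. ring.
    + rewrite lobe_div, cos_PI2. replace ((lobe - lobe) / su) with 0 by (field; lra).
      rewrite sin_0. field. lra.
  - rewrite C1. replace ((- - lobe - lobe) / su) with 0 by (field; lra). rewrite cos_0. ring.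
  - rewrite (proj1 (glue_at _ _ _ _)) by lra.
    replace ((- - lobe - lobe) / su) with 0 by (field; lra). rewrite sin_0.
    replace (- lobe / sl) with (- (PI / 2)) by (rewrite <- lobe_div; field; lra).
    rewrite cos_neg, cos_PI2. field. lra.
Qed.

(** The inverse of [G] at [- v / 2], as [G_curvature] checks; it solves the eigenvalue equation for
    the second derivative. *)
Definition curvature (v : R) : R := - Rmax v 0 / sl ^ 2 + Rmax (- v) 0 / su ^ 2.

Lemma arch_even y : arch (- y) = arch y.
Proof.
  destruct lobe_pos as [L _]. unfold arch.
  assert (C : forall s, sin 0 = 0 -> - su * sin ((lobe - lobe) / s) = 0).
  { intros s Hs. unfold Rminus, Rdiv. rewrite Rplus_opp_r, Rmult_0_l, Hs. ring. }
  destruct (Rtotal_order y lobe) as [A|[A|A]]; [destruct (Rtotal_order y (- lobe)) as [B|[B|B]]| |].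
  - rewrite (proj2 (glue_at (- lobe) _ _ (- y))) by lra.
    rewrite (proj2 (glue_at lobe _ _ (- y))) by lra.
    rewrite (proj1 (glue_at (- lobe) _ _ y)) by lra. reflexivity.
  - subst y. rewrite Ropp_involutive.
    rewrite (proj2 (glue_at (- lobe) _ _ lobe)) by lra.
    rewrite (proj1 (glue_at lobe _ _ lobe)) by lra.
    rewrite (proj1 (glue_at (- lobe) _ _ (- lobe))) by lra.
    rewrite lobe_div, cos_PI2, Ropp_involutive, (C su sin_0). ring.
  - rewrite (proj2 (glue_at (- lobe) _ _ (- y))) by lra.
    rewrite (proj1 (glue_at lobe _ _ (- y))) by lra.
    rewrite (proj2 (glue_at (- lobe) _ _ y)) by lra.
    rewrite (proj1 (glue_at lobe _ _ y)) by lra.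
    replace (- y / sl) with (- (y / sl)) by (field; lra). now rewrite cos_neg.
  - subst y.
    rewrite (proj1 (glue_at (- lobe) _ _ (- lobe))) by lra.
    rewrite (proj2 (glue_at (- lobe) _ _ lobe)) by lra.
    rewrite (proj1 (glue_at lobe _ _ lobe)) by lra.
    rewrite lobe_div, cos_PI2, Ropp_involutive, (C su sin_0). ring.
  - rewrite (proj1 (glue_at (- lobe) _ _ (- y))) by lra.
    rewrite (proj2 (glue_at (- lobe) _ _ y)) by lra.
    rewrite (proj2 (glue_at lobe _ _ y)) by lra.
    now rewrite Ropp_involutive.
Qed.

Lemma curvature_pos v : 0 <= v -> curvature v = - v / sl ^ 2.
Proof.
  intros Hv. unfold curvature. rewrite (Rmax_left v) by lra. rewrite (Rmax_right (- v)) by lra.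
  field. lra.
Qed.

Lemma curvature_neg v : v <= 0 -> curvature v = - v / su ^ 2.
Proof.
  intros Hv. unfold curvature. rewrite (Rmax_right v) by lra. rewrite (Rmax_left (- v)) by lra.
  field. lra.
Qed.

Lemma quarter_wave th : 0 <= th <= half_period - lobe -> 0 <= sin (th / su).
Proof.
  intros Ht. assert (E : half_period - lobe = su * (PI / 2)) by (unfold half_period; ring).
  pose proof PI_RGT_0.
  assert (0 <= th / su <= PI / 2).
  { split. apply Rmult_le_pos; [lra|]. left. apply Rinv_0_lt_compat. lra.
    apply Rmult_le_reg_r with su; [lra|]. replace (th / su * su) with th by (field; lra). lra. }
  apply sin_ge_0; lra.
Qed.

Lemma arch2_curvature y : - half_period <= y <= half_period -> arch2 y = curvature (arch y).
Proof.
  intros Hy. destruct lobe_pos as [L L'].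
  assert (Odd : forall y, lobe < y <= half_period ->
    sin ((y - lobe) / su) / su = curvature (- su * sin ((y - lobe) / su))).
  { intros z Hz. pose proof (quarter_wave (z - lobe) ltac:(lra)) as Q.
    rewrite curvature_neg by nra. field. lra. }
  unfold arch2, arch. destruct (Rle_dec y (- lobe)).
  - rewrite !(proj1 (glue_at (- lobe) _ _ y)) by lra.
    pose proof (quarter_wave (- y - lobe) ltac:(lra)) as Q.
    rewrite curvature_neg by nra. field. lra.
  - rewrite !(proj2 (glue_at (- lobe) _ _ y)) by lra. destruct (Rle_dec y lobe).
    + rewrite !(proj1 (glue_at lobe _ _ y)) by lra.
      assert (Q : 0 <= cos (y / sl)).
      { apply cos_ge_0.
        - apply Rmult_le_reg_r with sl; [lra|]. replace (y / sl * sl) with y by (field; lra).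
          unfold lobe in *. lra.
        - apply Rmult_le_reg_r with sl; [lra|]. replace (y / sl * sl) with y by (field; lra).
          unfold lobe in *. lra. }
      rewrite curvature_pos by nra. field. lra.
    + rewrite !(proj2 (glue_at lobe _ _ y)) by lra. apply Odd. lra.
Qed.

(** [half_period - lobe] is a quarter wave of the negative arc, so the ends of the period are its
    troughs, and reflection of the sine about [PI / 2] continues the arc past them. *)
Lemma arch_overlap w : - half_period - (half_period - lobe) < w < - half_period ->
  arch (w + 2 * half_period) = arch w /\ arch1 (w + 2 * half_period) = arch1 w.
Proof.
  intros Hw. destruct lobe_pos as [L L'].
  assert (E : (w + 2 * half_period - lobe) / su = PI - (- w - lobe) / su).
  { unfold half_period. field. lra. }
  unfold arch, arch1.
  rewrite !(proj2 (glue_at (- lobe) _ _ (w + 2 * half_period))) by lra.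
  rewrite !(proj2 (glue_at lobe _ _ (w + 2 * half_period))) by lra.
  rewrite !(proj1 (glue_at (- lobe) _ _ w)) by lra.
  rewrite E. rewrite sin_PI_x. split; trivial.
  rewrite Rtrigo_facts.cos_pi_minus. ring.
Qed.

Lemma eigenfunction_C2 :
  (forall x : R, is_derive eigenfunction x (periodize half_period arch1 x)) /\
  (forall x : R, is_derive (periodize half_period arch1) x (curvature (eigenfunction x))).
Proof.
  destruct lobe_pos as [L L']. split.
  - apply is_derive_periodize with (half_period - lobe); try lra.
    + intros w Hw. now apply arch_overlap. + apply is_derive_arch.
  - intros x. replace (curvature (eigenfunction x)) with (periodize half_period arch2 x).
    + apply is_derive_periodize with (half_period - lobe); try lra.
      * intros w Hw. now apply arch_overlap. * apply is_derive_arch1.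
    + destruct (periodize_index half_period x ltac:(lra)) as [m Hm].
      unfold eigenfunction. rewrite !(periodize_eq _ _ _ m) by lra. apply arch2_curvature. lra.
Qed.

Lemma eigenfunction_bl : bounded_lipschitz eigenfunction.
Proof.
  destruct eigenfunction_C2 as [D _].
  assert (T : forall z, -1 <= sin z <= 1 /\ -1 <= cos z <= 1).
  { intros z. split; [apply SIN_bound|apply COS_bound]. }
  apply bounded_lipschitz_iff. exists su, 1. split.
  - intros x. unfold eigenfunction, periodize. set (y := x - _). clearbody y. apply Rabs_le.
    unfold arch, glue. destruct (Rle_dec y (- lobe)); [|destruct (Rle_dec y lobe)].
    + destruct (T ((- y - lobe) / su)) as [A _]. nra.
    + destruct (T (y / sl)) as [_ A]. nra.
    + destruct (T ((y - lobe) / su)) as [A _]. nra.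
  - assert (B : forall x, Rabs (periodize half_period arch1 x) <= 1).
    { intros x. unfold periodize. set (y := x - _). clearbody y. apply Rabs_le.
      unfold arch1, glue. destruct (Rle_dec y (- lobe)); [|destruct (Rle_dec y lobe)].
      + destruct (T ((- y - lobe) / su)) as [_ A]. lra.
      + destruct (T (y / sl)) as [A _]. lra.
      + destruct (T ((y - lobe) / su)) as [_ A]. lra. }
    assert (Ord : forall a b, a < b -> Rabs (eigenfunction a - eigenfunction b) <= 1 * Rabs (a - b)).
    { intros a b Hab. destruct (MVT_cor2 eigenfunction (periodize half_period arch1) a b Hab) as (z & E & _).
      { intros z _. apply is_derive_Reals, D. }
      rewrite Rabs_minus_sym, E, Rabs_mult, (Rabs_minus_sym a).
      apply Rmult_le_compat_r; [apply Rabs_pos|apply B]. }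
    intros x y. destruct (Rtotal_order x y) as [c|[->|c]].
    + now apply Ord.
    + unfold Rminus. rewrite !Rplus_opp_r, Rabs_R0. lra.
    + rewrite Rabs_minus_sym, (Rabs_minus_sym x). now apply Ord.
Qed.

Lemma eigenfunction_even x : eigenfunction (- x) = eigenfunction x.
Proof.
  destruct lobe_pos as [L L']. unfold eigenfunction.
  destruct (periodize_index half_period x ltac:(lra)) as [m Hm].
  rewrite (periodize_eq _ _ x m) by lra.
  destruct (Req_dec (x - 2 * half_period * IZR m) (- half_period)) as [E|E].
  - rewrite (periodize_eq _ _ (- x) (- m + 1)%Z); [|lra|].
    + f_equal. rewrite plus_IZR, opp_IZR. lra.
    + rewrite plus_IZR, opp_IZR. lra.
  - rewrite (periodize_eq _ _ (- x) (- m)%Z); [|lra|].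
    + rewrite opp_IZR, <- arch_even. f_equal. ring.
    + rewrite opp_IZR. lra.
Qed.

Lemma eigenfunction_periodic x : eigenfunction (x + 2 * half_period) = eigenfunction x.
Proof.
  destruct lobe_pos as [L L']. unfold eigenfunction.
  destruct (periodize_index half_period x ltac:(lra)) as [m Hm].
  rewrite (periodize_eq _ _ x m) by lra.
  rewrite (periodize_eq _ _ _ (m + 1)%Z); [|lra|].
  - f_equal. rewrite plus_IZR. ring.
  - rewrite plus_IZR. lra.
Qed.

Lemma eigenfunction_values : eigenfunction 0 = sl /\ eigenfunction half_period = - su.
Proof.
  destruct lobe_pos as [L L']. unfold eigenfunction. split.
  - rewrite (periodize_eq _ _ 0 0%Z) by lra.
    replace (0 - 2 * half_period * 0) with 0 by ring. unfold arch.
    rewrite (proj2 (glue_at (- lobe) _ _ 0)) by lra. rewrite (proj1 (glue_at lobe _ _ 0)) by lra.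
    replace (0 / sl) with 0 by (field; lra). rewrite cos_0. ring.
  - rewrite (periodize_eq _ _ half_period 1%Z) by lra.
    replace (half_period - 2 * half_period * 1) with (- half_period) by ring.
    rewrite arch_even. unfold arch.
    rewrite (proj2 (glue_at (- lobe) _ _ half_period)) by lra.
    rewrite (proj2 (glue_at lobe _ _ half_period)) by lra.
    replace ((half_period - lobe) / su) with (PI / 2) by (unfold half_period; field; lra).
    rewrite sin_PI2. ring.
Qed.

Lemma G_curvature v : G_fun sl su (curvature v) = - v / 2.
Proof.
  assert (0 < sl ^ 2) by (apply pow_lt; lra). assert (0 < su ^ 2) by (apply pow_lt; lra).
  destruct (Rle_dec 0 v).
  - rewrite curvature_pos by trivial. rewrite G_fun_neg.
    + field. lra.
    + unfold Rdiv. assert (0 < / sl ^ 2) by now apply Rinv_0_lt_compat. nra.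
  - rewrite curvature_neg by lra. rewrite G_fun_pos.
    + field. lra.
    + unfold Rdiv. assert (0 < / su ^ 2) by now apply Rinv_0_lt_compat. nra.
Qed.

Lemma curvature_continuity v : continuity_pt curvature v.
Proof.
  assert (P : 0 < / sl ^ 2) by (apply Rinv_0_lt_compat, pow_lt; lra).
  assert (Q : 0 < / su ^ 2) by (apply Rinv_0_lt_compat, pow_lt; lra).
  apply lipschitz_continuity_pt with (/ sl ^ 2 + / su ^ 2). intros x y.
  unfold curvature, Rdiv.
  replace (_ - _) with (- (Rmax x 0 - Rmax y 0) * / sl ^ 2 + (Rmax (- x) 0 - Rmax (- y) 0) * / su ^ 2) by ring.
  eapply Rle_trans; [apply Rabs_triang|].
  rewrite !Rabs_mult, Rabs_Ropp, (Rabs_pos_eq (/ sl ^ 2)), (Rabs_pos_eq (/ su ^ 2)) by lra.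
  assert (A : Rabs (Rmax x 0 - Rmax y 0) <= Rabs (x - y)).
  { unfold Rmax, Rabs. destruct (Rle_dec x 0), (Rle_dec y 0); repeat destruct Rcase_abs; lra. }
  assert (B : Rabs (Rmax (- x) 0 - Rmax (- y) 0) <= Rabs (x - y)).
  { unfold Rmax, Rabs. destruct (Rle_dec (- x) 0), (Rle_dec (- y) 0); repeat destruct Rcase_abs; lra. }
  apply Rmult_le_compat_r with (r := / sl ^ 2) in A; [|lra].
  apply Rmult_le_compat_r with (r := / su ^ 2) in B; [|lra]. lra.
Qed.

(** Separation of variables: [G] is positively homogeneous, so the factor [exp (- t / 2)] passes
    through it, and the product is a classical solution. *)
Lemma flow_eigenfunction t x : 0 <= t ->
  flow sl su eigenfunction t x = exp (- t / 2) * eigenfunction x.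
Proof.
  intros Ht. symmetry. destruct eigenfunction_C2 as [D1 D2].
  assert (S : 0 <= sl <= su) by lra.
  assert (C0 : forall y, continuity_pt eigenfunction y) by (intros; eapply continuity_pt_derive, D1).
  assert (Cz : forall t x, continuity_2d_pt (fun t x => exp (- t / 2) * eigenfunction x) t x).
  { intros s y. apply continuity_2d_pt_mult; [|now apply continuity_2d_snd].
    apply (continuity_1d_2d_pt_comp (fun t => exp (- t / 2)) (fun t _ => t)); [|apply continuity_2d_pt_id1].
    apply continuity_pt_derive with (- 1 / 2 * exp (- s / 2)).
    auto_derive; [exact I|]. unfold Rdiv. req. }
  pose proof (smooth_exp_decay eigenfunction _ _ D1 D2) as Sm. cbv beta in Sm.
  specialize (Sm (fun z => continuity_pt_comp eigenfunction curvature z (C0 z) (curvature_continuity _))).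
  assert (E : forall s y, G_fun sl su (exp (- s / 2) * curvature (eigenfunction y)) =
    - / 2 * (exp (- s / 2) * eigenfunction y)).
  { intros s y. rewrite G_fun_scale by apply exp_pos. rewrite G_curvature. field. }
  apply (flow_unique sl su S eigenfunction (fun t x => exp (- t / 2) * eigenfunction x)); trivial.
  { apply eigenfunction_bl. }
  refine (conj _ (conj _ (conj _ (conj _ (conj _ _))))).
  - now apply lsc_continuity_2d.
  - apply lsc_continuity_2d. intros. now apply continuity_2d_pt_opp.
  - destruct eigenfunction_bl as [[M HM] _]. exists M. intros s y Hs.
    rewrite Rabs_mult, Rabs_pos_eq by (left; apply exp_pos).
    assert (exp (- s / 2) <= 1).
    { rewrite <- exp_0. destruct (Rle_lt_or_eq_dec 0 s Hs) as [l|<-].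
      - left. apply exp_increasing. lra.
      - right. f_equal. field. }
    pose proof (exp_pos (- s / 2)). specialize (HM y). pose proof (Rabs_pos (eigenfunction y)). nra.
  - apply (super_smooth _ _ _ _ _ _ (elliptic_G_fun sl su S) Sm). intros s y _. rewrite E. lra.
  - apply (super_smooth _ _ _ _ _ _ (elliptic_Gbar _ _ (elliptic_G_fun sl su S)) (smooth_opp _ _ _ _ Sm)).
    intros s y _. unfold Gbar. rewrite Ropp_involutive, E. lra.
  - intros y. replace (- 0 / 2) with 0 by field. rewrite exp_0. ring.
Qed.

End Eigenfunction.

(** * Eigenfunctions in the viscosity sense *)

(** Nonnegativity of the second derivative in the viscosity sense, tested by parabolas touching from
    above. *)
Definition viscosity_convex (d : R -> R) : Prop := forall x0 k1 k2 r, 0 < r ->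
  (forall x, Rabs (x - x0) < r -> d x - d x0 <= k1 * (x - x0) + k2 * ((x - x0) * (x - x0))) ->
  0 <= k2.

(** If the graph rose above its chord, the excess plus a small multiple [e] of the square of [x - c]
    would have an interior maximum, where a parabola with quadratic coefficient [- e] touches from
    above. *)
Lemma viscosity_convex_chord d a b c : (forall x, continuity_pt d x) -> viscosity_convex d ->
  a < c < b -> d c <= d a + (d b - d a) / (b - a) * (c - a).
Proof.
  intros Hd Hv Hc. apply Rnot_lt_le. intros Hlt.
  set (m := (d b - d a) / (b - a)) in *.
  set (D := d c - (d a + m * (c - a))). assert (HD : 0 < D) by (unfold D; lra).
  set (e := D / (2 * ((b - a) * (b - a)))).
  assert (Hba : 0 < (b - a) * (b - a)) by (apply Rmult_lt_0_compat; lra).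
  assert (He : 0 < e) by (apply Rdiv_lt_0_compat; lra).
  assert (Ee : e * ((b - a) * (b - a)) = D / 2) by (unfold e; field; lra).
  set (h := fun x => d x - (d a + m * (x - a)) + e * ((x - c) * (x - c))).
  destruct (continuity_ab_maj h a b) as (z & Hz & Bz); [lra| |].
  { intros x _. unfold h. apply continuity_pt_plus.
    - apply continuity_pt_minus; trivial. apply continuity_pt_derive with m.
      auto_derive; [exact I|req].
    - apply continuity_pt_derive with (e * (2 * (x - c))). auto_derive; [exact I|req]. }
  assert (hc : h c = D) by (unfold h, D; ring).
  assert (P : D <= h z) by (rewrite <- hc; apply Hz; lra).
  assert (Sm : forall u, (u = a \/ u = b) -> h u < D).
  { intros u Hu.
    assert (E0 : h u = e * ((u - c) * (u - c))).
    { destruct Hu as [->| ->]; unfold h, m; field; lra. }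
    rewrite E0. assert ((u - c) * (u - c) <= (b - a) * (b - a)) by (destruct Hu as [->| ->]; nra).
    apply Rmult_le_compat_l with (r := e) in H; lra. }
  assert (Iz : a < z < b).
  { split; apply Rnot_le_lt; intros Q.
    - specialize (Sm z). replace z with a in * by lra. specialize (Sm (or_introl eq_refl)). lra.
    - specialize (Sm z). replace z with b in * by lra. specialize (Sm (or_intror eq_refl)). lra. }
  assert (0 <= - e); [|lra].
  apply (Hv z (m - 2 * e * (z - c)) (- e) (Rmin (z - a) (b - z))).
  - apply Rmin_pos; lra.
  - intros x Hx. rmin (z - a) (b - z).
    apply Rabs_def2 in Hx. specialize (Hz x ltac:(lra)). unfold h in Hz. lra.
Qed.

Lemma viscosity_affine d : (forall x, continuity_pt d x) -> viscosity_convex d ->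
  viscosity_convex (fun x => - d x) -> forall x, d x = d 0 + (d 1 - d 0) * x.
Proof.
  intros Hd H1 H2 x.
  set (a := Rmin x 0 - 1). set (b := Rmax x 1 + 1).
  rmin x 0. pose proof (Rmax_l x 1). pose proof (Rmax_r x 1).
  set (m := (d b - d a) / (b - a)).
  assert (E : forall c, a < c < b -> d c = d a + m * (c - a)).
  { intros c Hc. apply Rle_antisym.
    - now apply viscosity_convex_chord.
    - pose proof (viscosity_convex_chord (fun x => - d x) a b c) as Q. cbv beta in Q.
      replace ((- d b - - d a) / (b - a)) with (- m) in Q by (unfold m; field; lra).
      enough (- d c <= - d a + - m * (c - a)) by lra. apply Q; trivial.
      intros y. now apply continuity_pt_opp. }
  rewrite (E x), (E 0), (E 1) by (unfold a, b; lra). ring.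
Qed.

Section EllipticEigenvalue.
Variables (sl su : R) (g : R -> R).
Hypotheses (H : 0 < sl <= su) (Hg : bounded_lipschitz g)
  (Hflow : forall s x, 0 < s -> flow sl su g s x = exp (- s / 2) * g x).

(** A test function [eta] for [g] becomes [exp (- t / 2) * eta x] for the flow, applied at time 1.
    Since [sl] is positive, [G] is strictly increasing and the resulting inequality can be solved
    for the second derivative. *)
Lemma eigen_touch eta p1 p2 x0 r : (forall x : R, is_derive eta x (p1 x)) ->
  (forall x : R, is_derive p1 x (p2 x)) -> (forall x, continuity_pt p2 x) -> 0 < r ->
  eta x0 = g x0 ->
  ((forall x, Rabs (x - x0) < r -> eta x <= g x) -> p2 x0 <= curvature sl su (g x0)) /\
  ((forall x, Rabs (x - x0) < r -> g x <= eta x) -> curvature sl su (g x0) <= p2 x0).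
Proof.
  intros D1 D2 C2 Hr E.
  pose proof (smooth_exp_decay eta p1 p2 D1 D2 C2) as S.
  destruct (flow_solves sl su ltac:(lra) g Hg) as (_ & _ & _ & S1 & S2 & _).
  set (k := exp (- (1) / 2)) in *.
  assert (Hk : 0 < k) by apply exp_pos.
  assert (Mono : forall a b, G_fun sl su a <= G_fun sl su b -> a <= b).
  { intros a b Hab. apply Rnot_lt_le. intros Hlt.
    assert (0 < sl ^ 2) by (apply pow_lt; lra). assert (0 < su ^ 2) by (apply pow_lt; lra).
    destruct (Rle_dec 0 b).
    - rewrite !G_fun_pos in Hab by lra. nra.
    - rewrite (G_fun_neg sl su b) in Hab by lra. destruct (Rle_dec 0 a).
      + rewrite G_fun_pos in Hab by lra. nra.
      + rewrite G_fun_neg in Hab by lra. nra. }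
  assert (Near : locally_2d (fun s _ => 0 < s) 1 x0) by (apply locally_2d_pos; lra).
  destruct Near as [d Hd].
  assert (P : 0 < Rmin d r) by (apply Rmin_pos; [apply cond_pos|trivial]).
  split; intros T; apply Mono; rewrite G_curvature by trivial.
  - assert (Q : G_fun sl su (k * p2 x0) <= - / 2 * (k * eta x0)).
    { apply (S1 _ _ _ _ 1 x0 S Rlt_0_1). exists (mkposreal _ P). simpl. intros s y Hs Hy.
      rmin d r.
      assert (0 < s) by (apply (Hd s y); lra).
      rewrite !Hflow by lra. rewrite E.
      assert (0 < exp (- s / 2)) by apply exp_pos.
      specialize (T y ltac:(lra)).
      assert (exp (- s / 2) * eta y <= exp (- s / 2) * g y) by (apply Rmult_le_compat_l; lra). lra. }
    rewrite G_fun_scale in Q by trivial. rewrite E in Q. apply Rmult_le_reg_l with k; lra.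
  - assert (Q : Gbar (G_fun sl su) (- (k * p2 x0)) <= - (- / 2 * (k * eta x0))).
    { apply (S2 _ _ _ _ 1 x0 (smooth_opp _ _ _ _ S) Rlt_0_1).
      exists (mkposreal _ P). simpl. intros s y Hs Hy.
      rmin d r.
      assert (0 < s) by (apply (Hd s y); lra).
      rewrite !Hflow by lra. rewrite E.
      assert (0 < exp (- s / 2)) by apply exp_pos.
      specialize (T y ltac:(lra)).
      assert (exp (- s / 2) * g y <= exp (- s / 2) * eta y) by (apply Rmult_le_compat_l; lra). lra. }
    unfold Gbar in Q. rewrite Ropp_involutive, G_fun_scale in Q by trivial. rewrite E in Q.
    apply Rmult_le_reg_l with k; lra.
Qed.

Lemma is_derive_primitive (f : R -> R) (x : R) : (forall y, continuity_pt f y) ->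
  is_derive (fun x => RInt f 0 x) x (f x).
Proof.
  intros Hf.
  assert (C : forall y, continuous f y) by (intros; now apply continuity_pt_filterlim).
  apply (is_derive_RInt f (fun x => RInt f 0 x) 0 x); [|apply C].
  exists (mkposreal 1 Rlt_0_1). intros y _. apply (RInt_correct f).
  apply (ex_RInt_continuous f). intros; apply C.
Qed.

(** Let [F] be a second primitive of the continuous function [curvature] of [g]. By [eigen_touch]
    the difference [g - F] is convex and concave in the viscosity sense, hence affine, and [g]
    inherits two derivatives from [F]. *)
Lemma eigen_regular : exists g1, (forall x : R, is_derive g x (g1 x)) /\
  (forall x : R, is_derive g1 x (curvature sl su (g x))).
Proof.
  destruct Hg as [_ [L HL]].
  assert (Cg : forall x, continuity_pt g x) by (intros; now apply lipschitz_continuity_pt with L).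
  assert (Cc : forall x, continuity_pt (fun x => curvature sl su (g x)) x).
  { intros x. apply (continuity_pt_comp g (curvature sl su)); trivial. now apply curvature_continuity. }
  set (F1 := fun x => RInt (fun x => curvature sl su (g x)) 0 x).
  assert (DF1 : forall x : R, is_derive F1 x (curvature sl su (g x))).
  { intros x. now apply (is_derive_primitive (fun x => curvature sl su (g x))). }
  set (F := fun x => RInt F1 0 x).
  assert (DF : forall x : R, is_derive F x (F1 x)).
  { intros x. apply is_derive_primitive. intros y. eapply continuity_pt_derive, DF1. }
  set (d := fun x => g x - F x).
  assert (T : forall x0 k1 k2 r, 0 < r ->
    ((forall x, Rabs (x - x0) < r -> k1 * (x - x0) + k2 * ((x - x0) * (x - x0)) <= d x - d x0) -> k2 <= 0) /\
    ((forall x, Rabs (x - x0) < r -> d x - d x0 <= k1 * (x - x0) + k2 * ((x - x0) * (x - x0))) -> 0 <= k2)).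
  { intros x0 k1 k2 r Hr.
    destruct (eigen_touch (fun x => (d x0 + k1 * (x - x0) + k2 * ((x - x0) * (x - x0))) + F x)
      (fun x => (k1 + 2 * k2 * (x - x0)) + F1 x) (fun x => 2 * k2 + curvature sl su (g x)) x0 r) as [T1 T2];
      trivial.
    - intros x. apply is_derive_sub_poly; trivial. auto_derive; [exact I|req].
    - intros x. apply is_derive_sub_poly; trivial. auto_derive; [exact I|req].
    - intros x. apply (continuity_pt_plus (fun _ => 2 * k2) (fun x => curvature sl su (g x))); trivial.
      apply continuity_pt_const. now intros ? ?.
    - unfold d. req.
    - split; intros Q.
      + assert (2 * k2 + curvature sl su (g x0) <= curvature sl su (g x0)); [|lra].
        apply T1. intros x Hx. specialize (Q x Hx). unfold d in *. lra.
      + assert (curvature sl su (g x0) <= 2 * k2 + curvature sl su (g x0)); [|lra].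
        apply T2. intros x Hx. specialize (Q x Hx). unfold d in *. lra. }
  assert (Cd : forall x, continuity_pt d x).
  { intros x. apply continuity_pt_minus; trivial. eapply continuity_pt_derive, DF. }
  pose proof (viscosity_affine d Cd) as A.
  assert (A' : forall x, d x = d 0 + (d 1 - d 0) * x).
  { apply A.
    - intros x0 k1 k2 r Hr Q. now apply (T x0 k1 k2 r Hr).
    - intros x0 k1 k2 r Hr Q. enough (- k2 <= 0) by lra. apply (T x0 (- k1) (- k2) r Hr).
      intros x Hx. specialize (Q x Hx). lra. }
  exists (fun x => (d 1 - d 0) + F1 x). split.
  - intros x. apply (is_derive_ext (fun x => (d 0 + (d 1 - d 0) * x) + F x)).
    + intros y. rewrite <- A'. unfold d. req.
    + apply is_derive_sub_poly; trivial. auto_derive; [exact I|req].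
  - intros x. rewrite <- (Rplus_0_l (curvature sl su (g x))).
    apply is_derive_sub_poly; trivial. apply (is_derive_const (V := R_NormedModule)).
Qed.

(** Added to the square of the slope, this is the energy conserved by the equation whose second
    derivative is [curvature]. *)
Definition potential (v : R) : R :=
  Rmax 0 v * Rmax 0 v / sl ^ 2 + Rmax 0 (- v) * Rmax 0 (- v) / su ^ 2.

Lemma is_derive_potential (v : R) : is_derive potential v (-2 * curvature sl su v).
Proof.
  unfold potential, curvature.
  replace (-2 * (- Rmax v 0 / sl ^ 2 + Rmax (- v) 0 / su ^ 2))
    with (/ sl ^ 2 * (2 * Rmax 0 v) + / su ^ 2 * (-1 * (2 * Rmax 0 (- v)))).
  2:{ rewrite (Rmax_comm v), (Rmax_comm (- v)). field. split; apply Rgt_not_eq; lra. }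
  apply (is_derive_ext (fun v => / sl ^ 2 * (Rmax 0 v * Rmax 0 v) +
    / su ^ 2 * (Rmax 0 (- v) * Rmax 0 (- v)))).
  { intros t. simpl. real_eq. field.
    split; apply Rgt_not_eq; lra. }
  apply (is_derive_plus (fun v => / sl ^ 2 * (Rmax 0 v * Rmax 0 v))).
  - apply (is_derive_scal (fun v => Rmax 0 v * Rmax 0 v)), is_derive_pos_sq.
  - apply (is_derive_scal (fun v => Rmax 0 (- v) * Rmax 0 (- v))).
    apply (is_derive_comp (fun v => Rmax 0 v * Rmax 0 v) (fun v => - v)).
    + apply is_derive_pos_sq. + auto_derive; [exact I|req].
Qed.

Lemma symmetric_critical (f f1 : R -> R) a : (forall x : R, is_derive f x (f1 x)) ->
  (forall x, f (2 * a - x) = f x) -> f1 a = 0.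
Proof.
  intros Hf Hs.
  assert (D : is_derive f a (-1 * f1 (2 * a - a))).
  { apply (is_derive_ext (fun x => f (2 * a - x))); trivial.
    apply (is_derive_comp f (fun x => 2 * a - x)); trivial. auto_derive; [exact I|req]. }
  replace (2 * a - a) with a in D by ring.
  pose proof (is_derive_unique _ _ _ D) as E1. pose proof (is_derive_unique _ _ _ (Hf a)) as E2.
  simpl in E1, E2. rewrite E1 in E2. lra.
Qed.

(** The symmetries about 0 and [l] make both points critical, so the energy is purely potential
    there and its conservation equates the squares of [g 0 / sl] and [g l / su]. *)
Lemma eigen_amplitudes l : (forall x, g (- x) = g x) -> (forall x, g (2 * l - x) = g x) ->
  0 < g 0 -> g l < 0 -> g 0 / sl = - g l / su.
Proof.
  intros S0 S1 P0 P1. destruct eigen_regular as (g1 & D1 & D2).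
  assert (Z0 : g1 0 = 0).
  { apply (symmetric_critical g g1 0 D1). intros x. rewrite <- S0. f_equal. ring. }
  assert (Z1 : g1 l = 0) by now apply (symmetric_critical g g1 l D1).
  set (e := fun x => g1 x * g1 x + potential (g x)).
  assert (De : forall x : R, is_derive e x 0).
  { intros x.
    replace 0 with ((curvature sl su (g x) * g1 x + g1 x * curvature sl su (g x))
      + g1 x * (-2 * curvature sl su (g x))) by ring.
    apply (is_derive_plus (fun x => g1 x * g1 x) (fun x => potential (g x))).
    - apply (is_derive_mult g1 g1); trivial. intros; apply Rmult_comm.
    - apply (is_derive_comp potential g); trivial. apply is_derive_potential. }
  assert (E : e 0 = e l).
  { destruct (MVT_gen e 0 l (fun _ => 0)) as (c & _ & Hc).
    - intros x _. apply De.
    - intros x _. eapply continuity_pt_derive, De.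
    - lra. }
  unfold e in E. rewrite Z0, Z1 in E. unfold potential in E.
  rewrite (Rmax_right 0 (g 0)), (Rmax_left 0 (- g 0)), (Rmax_left 0 (g l)), (Rmax_right 0 (- g l)) in E by lra.
  assert (F : (g 0 / sl) * (g 0 / sl) = (- g l / su) * (- g l / su)).
  { transitivity (0 * 0 + (g 0 * g 0 / sl ^ 2 + 0 * 0 / su ^ 2)); [field; lra|].
    rewrite E. field. lra. }
  assert (0 < g 0 / sl) by (apply Rdiv_lt_0_compat; lra).
  assert (0 < - g l / su) by (apply Rdiv_lt_0_compat; lra).
  apply Rsqr_inj; unfold Rsqr; lra.
Qed.

End EllipticEigenvalue.

(** * Convolutions *)

Lemma flow_affine sl su a h k phi t x : 0 <= sl <= su -> a <> 0 -> 0 < k ->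
  bounded_lipschitz phi -> 0 <= t ->
  flow sl su (fun x => k * phi (a * x + h)) t x = k * flow sl su phi (a * a * t) (a * x + h).
Proof.
  intros Hs Ha Hk H Ht. pose proof (flow_rescale sl su 1 a h k phi t x Hs Rlt_0_1 Ha Hk H Ht) as E.
  rewrite !Rmult_1_l in E. exact E.
Qed.

Lemma flow_homogeneous sl su k phi t x : 0 <= sl <= su -> 0 < k -> bounded_lipschitz phi ->
  0 <= t -> flow sl su (fun x => k * phi x) t x = k * flow sl su phi t x.
Proof.
  intros Hs Hk H Ht. pose proof (flow_affine sl su 1 0 k phi t x Hs R1_neq_R0 Hk H Ht) as E.
  rewrite !Rmult_1_l, Rplus_0_r in E. rewrite <- E. f_equal.
  apply functional_extensionality; intros y. now rewrite Rmult_1_l, Rplus_0_r.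
Qed.

Lemma flow_reflect sl su h phi t x : 0 <= sl <= su -> bounded_lipschitz phi ->
  (forall x, phi (h - x) = phi x) -> 0 <= t ->
  flow sl su phi t (h - x) = flow sl su phi t x.
Proof.
  intros Hs H Hphi Ht.
  pose proof (flow_affine sl su (-1) h 1 phi t x Hs ltac:(lra) Rlt_0_1 H Ht) as E.
  replace (-1 * -1 * t) with t in E by ring. replace (-1 * x + h) with (h - x) in E by ring.
  rewrite Rmult_1_l in E. rewrite <- E. f_equal.
  apply functional_extensionality; intros y. rewrite Rmult_1_l, <- (Hphi y). f_equal. ring.
Qed.

Section Converse.
Variables sl1 su1 sl2 su2 sl su : R.
Hypotheses (H1 : 0 < sl1 <= su1) (H2 : 0 < sl2 <= su2) (H0 : 0 <= sl <= su).
Hypothesis Hconv : forall phi, bounded_lipschitz phi ->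
  flow sl1 su1 (flow sl2 su2 phi 1) 1 0 = flow sl su phi 1 0.

Let S1 : 0 <= sl1 <= su1. Proof. lra. Qed.
Let S2 : 0 <= sl2 <= su2. Proof. lra. Qed.

(** The hypothesis sees only time 1 and the point 0; applied to the datum [phi (a * y + x)] with
    [a = sqrt t], it reaches every time and point by scaling and translation. *)
Lemma convolution_all_times phi t x : bounded_lipschitz phi -> 0 < t ->
  flow sl1 su1 (flow sl2 su2 phi t) t x = flow sl su phi t x.
Proof.
  intros H Ht. set (a := sqrt t).
  assert (Ha : 0 < a) by now apply sqrt_lt_R0.
  assert (Haa : a * a = t) by (apply sqrt_sqrt; lra).
  set (psi := fun y => 1 * phi (a * y + x)).
  assert (Hpsi : bounded_lipschitz psi) by now apply bounded_lipschitz_affine.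
  specialize (Hconv psi Hpsi). unfold psi in Hconv at 2.
  rewrite flow_affine in Hconv by (trivial; lra).
  replace (flow sl2 su2 psi 1) with (fun y => 1 * flow sl2 su2 phi t (a * y + x)) in Hconv.
  - rewrite flow_affine in Hconv; trivial; try lra. 2:{ apply flow_bl; trivial; lra. }
    rewrite Haa, !Rmult_1_l, Rmult_1_r, Rmult_0_r, Rplus_0_l in Hconv. exact Hconv.
  - apply functional_extensionality; intros y. unfold psi.
    rewrite flow_affine by (trivial; lra). now rewrite Haa, Rmult_1_r.
Qed.

Let phi := eigenfunction sl2 su2.
Let Hphi : bounded_lipschitz phi.
Proof. now apply eigenfunction_bl. Qed.

Lemma convolution_eigen s t x : 0 < s -> 0 < t ->
  flow sl1 su1 (flow sl2 su2 (flow sl1 su1 phi t) s) s x =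
  flow sl1 su1 (fun y => exp (- s / 2) * flow sl1 su1 phi t y) s x.
Proof.
  intros Hs Ht.
  assert (E2 : forall r, 0 <= r -> flow sl2 su2 phi r = fun y => exp (- r / 2) * phi y).
  { intros r Hr. apply functional_extensionality; intros y. now apply flow_eigenfunction. }
  assert (B1 : bounded_lipschitz (flow sl1 su1 phi t)) by (apply flow_bl; trivial; lra).
  set (k := exp (- t / 2)). set (q := exp (- s / 2)).
  assert (Hk : 0 < k) by apply exp_pos. assert (Hq : 0 < q) by apply exp_pos.
  rewrite flow_homogeneous; trivial; try lra.
  (* The flow of [G] at time [s + t] is computed twice: directly, with total decay [k * q], and
     through time [t], where the factor [k] comes out at once. The common factor [k] then
     cancels. *)
  pose proof (convolution_all_times phi (s + t) x Hphi ltac:(lra)) as A.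
  rewrite E2 in A by lra. rewrite flow_homogeneous in A; trivial; try lra.
  2:{ apply exp_pos. }
  rewrite <- (flow_semigroup sl su H0 phi t s x) in A; trivial; try lra.
  replace (flow sl su phi t) with (fun y => k * flow sl1 su1 phi t y) in A.
  2:{ apply functional_extensionality; intros y. rewrite <- convolution_all_times by trivial.
      rewrite E2 by lra. rewrite flow_homogeneous; trivial; lra. }
  rewrite flow_homogeneous in A; trivial; try lra.
  rewrite <- convolution_all_times in A by trivial.
  rewrite <- (flow_semigroup sl1 su1 S1 phi t s x) in A; trivial; try lra.
  replace (exp (- (s + t) / 2)) with (k * q) in A.
  - apply Rmult_eq_reg_l with k; lra.
  - unfold k, q. rewrite <- exp_plus. f_equal. field.
Qed.

Lemma eigen_preserved s t x : su1 / sl1 <> su2 / sl2 -> 0 < s -> 0 < t ->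
  flow sl2 su2 (flow sl1 su1 phi t) s x = exp (- s / 2) * flow sl1 su1 phi t x.
Proof.
  intros Hne Hs Ht.
  assert (B1 : bounded_lipschitz (flow sl1 su1 phi t)) by (apply flow_bl; trivial; lra).
  assert (B2 : bounded_lipschitz (flow sl2 su2 (flow sl1 su1 phi t) s)) by (apply flow_bl; trivial; lra).
  assert (B3 : bounded_lipschitz (fun y => exp (- s / 2) * flow sl1 su1 phi t y)).
  { pose proof (bounded_lipschitz_affine _ (exp (- s / 2)) 1 0 B1) as B.
    replace (fun y => exp (- s / 2) * flow sl1 su1 phi t y)
      with (fun y => exp (- s / 2) * flow sl1 su1 phi t (1 * y + 0)); trivial.
    apply functional_extensionality; intros y. now rewrite Rmult_1_l, Rplus_0_r. }
  assert (C : forall y, flow sl1 su1 (flow sl2 su2 phi s) t y = exp (- s / 2) * flow sl1 su1 phi t y).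
  { intros y. replace (flow sl2 su2 phi s) with (fun y => exp (- s / 2) * phi y).
    - apply flow_homogeneous; trivial; try lra. apply exp_pos.
    - apply functional_extensionality; intros z. symmetry. apply flow_eigenfunction; trivial. lra. }
  destruct (Rlt_or_le (su2 / sl2) (su1 / sl1)) as [c|c].
  - apply (flow_strict sl1 su1 (flow sl2 su2 (flow sl1 su1 phi t) s)
      (fun y => exp (- s / 2) * flow sl1 su1 phi t y) s 0); trivial.
    + intros y. rewrite <- C. apply flow_commute_le; trivial; lra.
    + now apply convolution_eigen.
  - symmetry. apply (flow_strict sl1 su1 (fun y => exp (- s / 2) * flow sl1 su1 phi t y)
      (flow sl2 su2 (flow sl1 su1 phi t) s) s 0); trivial.
    + intros y. rewrite <- C. apply flow_commute_le; trivial; lra.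
    + symmetry. now apply convolution_eigen.
Qed.

Lemma ratio_of_convolution : su1 / sl1 = su2 / sl2.
Proof.
  apply NNPP. intros Hne. set (l := half_period sl2 su2).
  destruct (eigenfunction_values sl2 su2 H2) as [V0 Vl]. fold phi l in V0, Vl.
  (* The tolerance [sl2] is the smaller modulus of the extreme values [sl2] and [- su2] of [phi]; a
     time this short preserves their signs. *)
  destruct (flow_equicont sl1 su1 S1 phi Hphi sl2) as (d & Hd & Hd'); [lra|].
  set (t := d / 2). assert (Ht : 0 < t) by (unfold t; lra).
  assert (Near : forall x, Rabs (flow sl1 su1 phi t x - phi x) < sl2).
  { intros x. rewrite <- (flow_0 sl1 su1 S1 phi x Hphi).
    apply Hd'; try lra. rewrite Rminus_0_r, Rabs_pos_eq; unfold t; lra. }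
  set (g := flow sl1 su1 phi t) in *.
  assert (Bg : bounded_lipschitz g) by (apply flow_bl; trivial; lra).
  assert (P0 : 0 < g 0).
  { specialize (Near 0). apply Rabs_def2 in Near. lra. }
  assert (Pl : g l < 0).
  { specialize (Near l). apply Rabs_def2 in Near. lra. }
  assert (Amp : g 0 / sl2 = - g l / su2).
  { apply eigen_amplitudes; trivial.
    - intros s x Hs. now apply eigen_preserved.
    - intros x. replace (- x) with (0 - x) by ring. unfold g. apply flow_reflect; trivial; try lra.
      intros y. replace (0 - y) with (- y) by ring. now apply eigenfunction_even.
    - intros x. unfold g. apply flow_reflect; trivial; try lra.
      intros y. unfold phi. rewrite <- (eigenfunction_even sl2 su2 H2).
      replace (- (2 * l - y)) with (y - 2 * l) by ring.
      rewrite <- (eigenfunction_periodic sl2 su2 H2). f_equal. unfold l. ring. }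
  set (a := sl1 / sl2). set (b := su1 / su2).
  assert (Ha : 0 < a) by (apply Rdiv_lt_0_compat; lra).
  assert (Hb : 0 < b) by (apply Rdiv_lt_0_compat; lra).
  assert (Ea : a * sl2 = sl1) by (unfold a; field; lra).
  assert (Eb : b * su2 = su1) by (unfold b; field; lra).
  assert (Scale : forall r x, 0 < r -> flow (r * sl2) (r * su2) phi t x = exp (- (r * r * t) / 2) * phi x).
  { intros r x Hr. rewrite flow_time_scale; trivial; try lra.
    apply flow_eigenfunction; trivial. apply Rmult_le_pos; [apply Rle_0_sqr|lra]. }
  assert (Dec : forall p q, 0 < p < q -> exp (- (q * q * t) / 2) < exp (- (p * p * t) / 2)).
  { intros p q Hpq. apply exp_increasing. assert (p * p < q * q) by nra.
    apply Rmult_lt_compat_r with (r := t) in H; lra. }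
  assert (F0 : forall k, k * sl2 / sl2 = k) by (intros; field; lra).
  assert (Fl : forall k, - (k * - su2) / su2 = k) by (intros; field; lra).
  assert (Mon : forall u v c, 0 < c -> u <= v -> u / c <= v / c).
  { intros u v c Hc Huv. apply Rmult_le_compat_r; trivial. now apply Rinv_nonneg. }
  assert (Sa : 0 <= a * sl2 <= a * su2).
  { split; [lra|]. apply Rmult_le_compat_l; lra. }
  assert (Sb : 0 <= b * sl2 <= b * su2).
  { split; [apply Rmult_le_pos; lra|]. apply Rmult_le_compat_l; lra. }
  assert (Ra : su1 / sl1 = b / a * (su2 / sl2)) by (unfold a, b; field; lra).
  (* For [a < b] the multiples of [G_2] with factors [a] and [b] both have volatility intervals
     inside that of [G_1], so both flows bound [g] from below. Factor [a] is used at 0 and the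
     faster decay [b] at [l], where [phi] is negative; this gives [- g l / su2 < g 0 / sl2]. For
     [b < a] the inclusions and inequalities are reversed. *)
  destruct (Rtotal_order a b) as [c|[c|c]].
  - assert (a * su2 <= b * su2) by (apply Rmult_le_compat_r; lra).
    assert (a * sl2 <= b * sl2) by (apply Rmult_le_compat_r; lra).
    assert (Q0 : exp (- (a * a * t) / 2) * sl2 <= g 0).
    { rewrite <- V0, <- Scale by trivial. apply flow_le_flow; trivial; lra. }
    assert (Ql : exp (- (b * b * t) / 2) * - su2 <= g l).
    { rewrite <- Vl, <- Scale by trivial. apply flow_le_flow; trivial; lra. }
    apply (Mon _ _ sl2) in Q0; [|lra]. rewrite F0 in Q0.
    apply Ropp_le_contravar, (Mon _ _ su2) in Ql; [|lra]. rewrite Fl in Ql.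
    specialize (Dec a b ltac:(lra)). lra.
  - apply Hne. rewrite Ra, c. field. lra.
  - assert (b * su2 <= a * su2) by (apply Rmult_le_compat_r; lra).
    assert (b * sl2 <= a * sl2) by (apply Rmult_le_compat_r; lra).
    assert (Q0 : g 0 <= exp (- (a * a * t) / 2) * sl2).
    { rewrite <- V0, <- Scale by trivial. apply flow_le_flow; trivial; lra. }
    assert (Ql : g l <= exp (- (b * b * t) / 2) * - su2).
    { rewrite <- Vl, <- Scale by trivial. apply flow_le_flow; trivial; lra. }
    apply (Mon _ _ sl2) in Q0; [|lra]. rewrite F0 in Q0.
    apply Ropp_le_contravar, (Mon _ _ su2) in Ql; [|lra]. rewrite Fl in Ql.
    specialize (Dec b a ltac:(lra)). lra.
Qed.

End Converse.

Theorem theorem3p1 (sl1 su1 sl2 su2 : R)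
  (h1 : 0 < sl1 <= su1) (h2 : 0 < sl2 <= su2) :
  is_G_normal (convolution (G_normal (G_fun sl1 su1)) (G_normal (G_fun sl2 su2)))
  <-> su1 / sl1 = su2 / sl2.
Proof.
  split.
  - intros (G & (sl & su & Hs & HG) & HN).
    replace G with (G_fun sl su) in HN by (apply functional_extensionality; intros a; now rewrite HG).
    apply (ratio_of_convolution sl1 su1 sl2 su2 sl su h1 h2 Hs). intros phi Hphi.
    specialize (HN phi Hphi).
    rewrite convolution_flow, G_normal_flow in HN by (trivial; lra). exact HN.
  - now apply is_G_normal_of_ratio.
Qed.
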